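(* Let $(M,x) \supseteq (K,v)$ be a finite normal extension of valued fields, with decomposition field $K_{\mathrm h,x}$, inertia field $K_{\mathrm i,x}$ and ramification field $K_{\mathrm v,x}$. Then \begin{align*} [K_{\mathrm h,x}:K] &= g_{M,v},\\ [K_{\mathrm i,x}:K_{\mathrm h,x}] &= f_{\mathrm s}(x/v)=f_{\mathrm s}(x|_{K_{\mathrm i,x}}/x|_{K_{\mathrm h,x}}),\\ [K_{\mathrm v,x}:K_{\mathrm i,x}] &= e_{\mathrm t}(x/v)=e_{\mathrm t}(x|_{K_{\mathrm v,x}}/x|_{K_{\mathrm i,x}}),\\ [M:K_{\mathrm v,x}] &= d_{\mathrm w}(x/v)=d_{\mathrm w}(x/x|_{K_{\mathrm v,x}}). \end{align*} Let $(L,w)$ be an intermediate extension of $(M,x) \supseteq (K,v)$ (that is, $K\subseteq L\subseteq M$ and $w=x|_L$). Then \begin{align*} [L_{\mathrm h,x}:K_{\mathrm h,x}] &= d_{\mathrm w}(w/v)\,e_{\mathrm t}(w/v)\,f_{\mathrm s}(w/v),\\ [L_{\mathrm i,x}:K_{\mathrm i,x}] &= d_{\mathrm w}(w/v)\,e_{\mathrm t}(w/v),\\ [L_{\mathrm v,x}:K_{\mathrm v,x}] &= d_{\mathrm w}(w/v). \end{align*}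
   Context: Valuations. A valuation ring on a field $K$ is a subring $\mathcal O\subseteq K$ such that for all $x\in K^*$ one has $x\in\mathcal O$ or $x^{-1}\in\mathcal O$. A valuation $v$ on $K$ is given by a valuation ring $\mathcal O_v$, with maximal ideal $\mathfrak m_v$, residue field $k_v=\mathcal O_v/\mathfrak m_v$ and value group $\Delta_v=K^*/\mathcal O_v^*$ (ordered abelian group). Put $p_v=\operatorname{char}(k_v)$ if this is nonzero and $p_v=1$ otherwise. A valued field is a pair $(K,v)$. An extension $(L,w)\supseteq(K,v)$ (also $w/v$, ''$w$ extends $v$'') is a field extension $L/K$ with a valuation $w$ on $L$ such that $\mathcal O_w\cap K=\mathcal O_v$; then $\Delta_v\subseteq\Delta_w$ and $k_v\subseteq k_w$. It is called finite, normal, etc. if $L/K$ is. For a subfield $K'\subseteq L$, $w|_{K'}$ is the valuation with ring $\mathcal O_w\cap K'$. $g_{L,v}$ is the number of extensions of $v$ to $L$. ''Normal'' means algebraic and normal, not necessarily separable. Numerical invariants of a finite extension $(L,w)\supseteq(K,v)$. Write $[\cdot:\cdot]_{\mathrm s}$ and $[\cdot:\cdot]_{\mathrm i}$ for separability and inseparability degree. $e(w/v)=(\Delta_w:\Delta_v)$; $e_{\mathrm t}(w/v)=\operatorname{lcm}\{m\in\mathbf Z_{\ge1}: m\mid e(w/v),\gcd(m,p_v)=1\}$; $e_{\mathrm w}(w/v)=e(w/v)/e_{\mathrm t}(w/v)$; $f(w/v)=[k_w:k_v]$; $f_{\mathrm s}(w/v)=[k_w:k_v]_{\mathrm s}$;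 $f_{\mathrm i}(w/v)=[k_w:k_v]_{\mathrm i}$; $n(w/v)=\frac{g_{N,w}}{g_{N,v}}[L:K]$ for any finite normal $N/K$ containing $L$ (independent of $N$); $d(w/v)=\frac{n(w/v)}{e(w/v)f(w/v)}$; $d_{\mathrm w}(w/v)=d(w/v)e_{\mathrm w}(w/v)f_{\mathrm i}(w/v)$. Decomposition, inertia and ramification. Let $(M,x)\supseteq(K,v)$ be a normal extension of valued fields and $G=\operatorname{Aut}_K(M)$, acting on valuations of $M$ extending $v$ by $\mathcal O_{g(x')}=g(\mathcal O_{x'})$. $D_{x,K}=\{g\in G: gx=x\}$; $I_{x,K}$ is the kernel of the natural map $D_{x,K}\to\operatorname{Aut}_{k_v}(k_x)$; $V_{x,K}$ is the kernel of the homomorphism $I_{x,K}\to\operatorname{Hom}(\Delta_x/\Delta_v,k_x^* )$ sending $g$ to $(\overline c\mapsto\overline{g(c)/c})$. Let $M_{K,\mathrm{sep}}$ be the subfield of elements of $M$ separable algebraic over $K$. Put $K_{\mathrm h,x}=M_{K,\mathrm{sep}}^{D_{x,K}}$ (decomposition field), $K_{\mathrm i,x}=M_{K,\mathrm{sep}}^{I_{x,K}}$ (inertia field), $K_{\mathrm v,x}=M_{K,\mathrm{sep}}^{V_{x,K}}$ (ramification field). For an intermediate field $L$ of $M/K$, the fields $L_{\mathrm h,x},L_{\mathrm i,x},L_{\mathrm v,x}$ are the same objects formed for the normal extension $(M,x)\supseteq(L,x|_L)$. *)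

(* Defs.v *)
From HB Require Import structures.
From mathcomp Require Import all_boot all_order all_algebra all_fingroup all_field.
From mathcomp Require Import ring_quotient generic_quotient finmap.
From mathcomp Require Import boolp classical_sets functions cardinality.

Set Implicit Arguments.
Unset Strict Implicit.
Unset Printing Implicit Defensive.

Import GRing.Theory.

Local Open Scope ring_scope.
Local Open Scope quotient_scope.

(* All valued fields live in an ambient finite extension [Om] of some field
   [F]; the ground field of a valued extension is itself a subfield [K] of [Om]
   and need not be the image of [F]. *)

Section FieldDegree.
Variable k : fieldType.
Implicit Types S T : set k.

Definition is_basis S T n (b : 'I_n -> k) : Prop :=
  [/\ forall i, T (b i),
      forall y, T y ->
        exists2 c : 'I_n -> k, forall i, S (c i) & y = \sum_i c i * b i &
      forall c : 'I_n -> k, (forall i, S (c i)) ->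
        \sum_i c i * b i = 0 -> forall i, c i = 0].

(* The degree [T : S] of subfields S <= T of k, with value 0 when it is
   infinite. *)
Definition ext_degree S T : nat :=
  xget 0%N [set n | exists b : 'I_n -> k, is_basis S T b]%classic.

Definition sep_closure S : set k :=
  [set a | exists p : {poly k},
    [/\ forall i, S p`_i, separable_poly p & root p a]]%classic.

Definition sep_degree S : nat := ext_degree S (sep_closure S).
Definition insep_degree S : nat := ext_degree (sep_closure S) setT.

End FieldDegree.

Section Valuation.
Variables (F : fieldType) (Om : fieldExtType F).
Implicit Types (E K L N : {subfield Om}).

Definition valuation_ring E (O : Om -> bool) : Prop :=
  [/\ {subset O <= E}, subring_closed O &
      {in E, forall a, a != 0 -> (a \in O) || (a^-1 \in O)}].

Record valuation E := Valuation {
  vring : Om -> bool;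
  vringP : valuation_ring E vring }.

HB.instance Definition _ E := gen_eqMixin (valuation E).
HB.instance Definition _ E := gen_choiceMixin (valuation E).

Lemma valuation_subring E (v : valuation E) : subring_closed (vring v).
Proof. by case: (vringP v). Qed.

HB.instance Definition _ E (v : valuation E) :=
  GRing.isSubringClosed.Build Om (vring v) (valuation_subring v).

Record vint E (v : valuation E) := VInt { vint_val : Om; _ : vint_val \in vring v }.
HB.instance Definition _ E (v : valuation E) := [isSub for @vint_val E v].
HB.instance Definition _ E (v : valuation E) := [Choice of vint v by <:].
HB.instance Definition _ E (v : valuation E) :=
  [SubChoice_isSubComNzRing of vint v by <:].

Definition vmax E (v : valuation E) : {pred vint v} :=
  fun a => ~~ `[< exists b, a * b = 1 >].
Arguments vmax [E] v _.

Lemma vmaxPn E (v : valuation E) (a : vint v) :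
  reflect (exists b, a * b = 1) (a \notin vmax v).
Proof. by rewrite unfold_in /vmax negbK; exact: asboolP. Qed.

Lemma vmaxE E (v : valuation E) (a : vint v) :
  (a \in vmax v) = (val a == 0) || ((val a)^-1 \notin vring v).
Proof.
rewrite unfold_in -[RHS]negbK negb_or negbK; congr (~~ _).
apply/asboolP/andP => [[b ab1]|[a0 aV]].
  have ab1' : val a * val b = 1 by rewrite -rmorphM ab1 rmorph1.
  have a0 : val a != 0.
    by apply/eqP => a0; move/eqP: ab1'; rewrite a0 mul0r eq_sym oner_eq0.
  split=> //; suff -> : (val a)^-1 = val b by exact: valP.
  by apply: (mulfI a0); rewrite ab1' mulfV.
by exists (VInt aV); apply: val_inj; rewrite rmorphM /= mulfV // rmorph1.
Qed.

Lemma vmax_idealr E (v : valuation E) : idealr_closed (vmax v).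
Proof.
have mulmax (a b : vint v) : b \in vmax v -> a * b \in vmax v.
  rewrite !unfold_in; apply: contraNN => /asboolP[c abc].
  by apply/asboolP; exists (a * c); rewrite mulrCA mulrA.
split; first by rewrite vmaxE rmorph0 eqxx.
  by rewrite vmaxE rmorph1 oner_eq0 invr1 rpred1.
move=> a x y xm ym; apply: contraT => /vmaxPn[b axyb].
have {}xm := mulmax a _ xm; move: (a * x) xm axyb => {a}x xm xyb.
have [x0|x0] := eqVneq x 0.
  by apply: contraLR ym => _; apply/vmaxPn; exists b; rewrite -xyb x0 add0r.
have [y0|y0] := eqVneq y 0.
  by apply: contraLR xm => _; apply/vmaxPn; exists b; rewrite -xyb y0 addr0.
have vx0 : val x != 0 by apply: contra_neq x0 => h; apply: val_inj; rewrite h rmorph0.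
have vy0 : val y != 0 by apply: contra_neq y0 => h; apply: val_inj; rewrite h rmorph0.
have [sOE _ vP] := vringP v.
have xyE : val x / val y \in E by rewrite rpred_div ?sOE ?(valP x) ?(valP y).
have /orP[h|h] := vP _ xyE (mulf_neq0 vx0 (invr_neq0 vy0)).
  suff: (1 : vint v) \in vmax v by rewrite vmaxE rmorph1 oner_eq0 invr1 rpred1.
  have <- : (VInt h + 1) * b * y = 1.
    by rewrite mulrAC -[RHS]xyb mulrDl mul1r; congr ((_ + _) * _); apply: val_inj; rewrite /= divfK.
  exact: mulmax.
suff: (1 : vint v) \in vmax v by rewrite vmaxE rmorph1 oner_eq0 invr1 rpred1.
rewrite invf_div in h.
have <- : (1 + VInt h) * b * x = 1.
  by rewrite mulrAC -[RHS]xyb mulrDl mul1r; congr ((_ + _) * _); apply: val_inj; rewrite /= divfK.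
exact: mulmax.
Qed.

HB.instance Definition _ E (v : valuation E) :=
  isIdealr.Build (vint v) (vmax v) (vmax_idealr v).

Definition residue E (v : valuation E) : Type := {ideal_quot vmax v}.
HB.instance Definition _ E (v : valuation E) := GRing.ComNzRing.on (residue v).

(* The residue class of [a]; it is [0] when [a] is not in the valuation ring. *)
Definition res E (v : valuation E) (a : Om) : residue v :=
  \pi_({ideal_quot vmax v}) (insubd (0 : vint v) a).

Lemma resE E (v : valuation E) (a : vint v) :
  res v (val a) = \pi_({ideal_quot vmax v}) a.
Proof. by rewrite /res valKd. Qed.

Lemma res_eq0 E (v : valuation E) (a : vint v) :
  (res v (val a) == 0) = (a \in vmax v).
Proof.
rewrite resE -[in RHS](subr0 a) Quotient.idealrBE.
by congr (_ == _); rewrite -(rmorph0 \pi_({ideal_quot vmax v})).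
Qed.

Definition residue_inv E (v : valuation E) (a : residue v) : residue v :=
  res v (val (repr (a : {ideal_quot vmax v})))^-1.

Lemma residue_mulVf E (v : valuation E) (a : residue v) :
  a != 0 -> residue_inv a * a = 1.
Proof.
set r := repr (a : {ideal_quot vmax v}).
have ra : a = res v (val r) by rewrite resE reprK.
rewrite [X in X != 0]ra res_eq0 => /vmaxPn[b rb1].
have rb1' : val r * val b = 1 by rewrite -rmorphM rb1 rmorph1.
have r0 : val r != 0.
  by apply/eqP => r0; move/eqP: rb1'; rewrite r0 mul0r eq_sym oner_eq0.
rewrite /residue_inv -/r (_ : (val r)^-1 = val b); last first.
  by apply: (mulfI r0); rewrite rb1' mulfV.
rewrite [X in _ * X]ra !resE.
have -> : \pi_({ideal_quot vmax v}) b * \pi r = \pi_({ideal_quot vmax v}) (b * r).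
  by rewrite rmorphM.
by rewrite mulrC rb1 rmorph1.
Qed.

Lemma residue_inv0 E (v : valuation E) : residue_inv (0 : residue v) = 0.
Proof.
set r := repr (0 : {ideal_quot vmax v}).
have : r \in vmax v by rewrite -res_eq0 resE reprK.
rewrite vmaxE /residue_inv /res -/r.
case/orP => [/eqP ->|rV]; last by rewrite /insubd insubN ?rmorph0.
by rewrite invr0 (_ : insubd _ _ = 0) ?rmorph0 // -[RHS](valKd 0).
Qed.

HB.instance Definition _ E (v : valuation E) :=
  GRing.ComNzRing_isField.Build (residue v)
    (@residue_mulVf E v) (residue_inv0 v).

(* The residue characteristic, replaced by 1 when it is 0. *)
Definition char_exp E (v : valuation E) : nat :=
  xget 1%N [set p | p \in [pchar residue v]]%classic.

Definition extends L (w : valuation L) K (v : valuation K) : Prop :=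
  (K <= L)%VS /\ forall a, (a \in vring v) = (a \in K) && (a \in vring w).

Lemma restrict_subproof K L (sKL : (K <= L)%VS) (w : valuation L) :
  valuation_ring K [pred a | (a \in K) && (a \in vring w)].
Proof.
split=> [a /andP[] //||a aK a0].
  split=> [|a b|a b]; rewrite !inE ?rpred1 //.
    by move=> /andP[aK aw] /andP[bK bw]; rewrite !rpredB.
  by move=> /andP[aK aw] /andP[bK bw]; rewrite !rpredM.
have [_ _ wP] := vringP w.
by have := wP _ (subvP sKL _ aK) a0; rewrite !inE rpredV aK.
Qed.

Definition restrict K L (sKL : (K <= L)%VS) (w : valuation L) : valuation K :=
  Valuation (restrict_subproof sKL w).

Definition num_ext N K (v : valuation K) : nat :=
  #|` fset_set [set u : valuation N | extends u v]%classic|.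

(* The class of [c] in L^* / O_w^*, as a subset of [Om]. *)
Definition vclass L (w : valuation L) (c : Om) : set Om :=
  [set c * u | u in [set u | [&& u != 0, u \in vring w & u^-1 \in vring w]]]%classic.

Definition value_group L (w : valuation L) : set (set Om) :=
  [set vclass w c | c in [set c | (c \in L) && (c != 0)]]%classic.

(* The image of the value group of (K, v) in that of an extension (L, w). *)
Definition sub_value_group L (w : valuation L) K (v : valuation K) :
    set (set Om) :=
  [set vclass w c | c in [set c | (c \in K) && (c != 0)]]%classic.

Definition class_mul (A B : set Om) : set Om :=
  [set a * b | a in A & b in B]%classic.

(* The cosets of the value group of v in that of w. *)
Definition value_cosets L (w : valuation L) K (v : valuation K) :
    set (set (set Om)) :=
  [set [set class_mul g d | d in sub_value_group w v] | g in value_group w]%classic.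

(* The image of the residue field of (K, v) in that of an extension (L, w). *)
Definition sub_residue L (w : valuation L) K (v : valuation K) :
    set (residue w) :=
  [set res w a | a in [set` vring v]]%classic.
Arguments sub_residue [L] w [K] v _.

Section Invariants.
Variables (L : {subfield Om}) (w : valuation L).
Variables (K : {subfield Om}) (v : valuation K).

Definition val_e : nat := #|` fset_set (value_cosets w v)|.
Definition val_et : nat :=
  \big[lcmn/1%N]_(1 <= m < val_e.+1 | (m %| val_e)%N && coprime m (char_exp v)) m.
Definition val_ew : rat := val_e%:R / val_et%:R.

Definition val_f : nat := ext_degree (sub_residue w v) setT.
Definition val_fs : nat := sep_degree (sub_residue w v).
Definition val_fi : nat := insep_degree (sub_residue w v).

(* [N] is an auxiliary finite normal extension of [K] containing [L], on which
   these quantities do not depend. *)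
Definition val_n (N : {subfield Om}) : rat :=
  (num_ext N w)%:R / (num_ext N v)%:R * (\dim_K L)%:R.
Definition val_d (N : {subfield Om}) : rat := val_n N / (val_e%:R * val_f%:R).
Definition val_dw (N : {subfield Om}) : rat := val_d N * val_ew * val_fi%:R.

End Invariants.

End Valuation.

Section Ramification.
Variables (F : fieldType) (Om : splittingFieldType F).
Implicit Types K M : {subfield Om}.

(* The elements of M that are separable over K, see [mem_sep_subfield]. *)
Definition sep_subfield K M : {subfield Om} :=
  <<K; separable_generator K M>>%AS.

Lemma mem_sep_subfield K M a : (K <= M)%VS ->
  (a \in sep_subfield K M) = (a \in M) && separable_element K a.
Proof.
move=> sKM; apply/idP/andP => [aS|[aM aK]].
  split; last first.
    have := separable_generatorP M K; rewrite adjoin_separable_eq.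
    by move/separableP/(_ _ aS).
  suff /subvP/(_ _ aS) : (<<K; separable_generator K M>> <= M)%VS by [].
  by apply/FadjoinP/andP; rewrite sKM separable_generator_mem.
rewrite -separable_inseparable_element.
have /purely_inseparableP-> // := separable_generator_maximal M K.
by rewrite (separable_elementS _ aK) // subv_adjoin.
Qed.

Section Groups.
Variables (M : {subfield Om}) (x : valuation M) (K : {subfield Om}).

Definition decomp_group : {set gal_of M} :=
  [set g in 'Gal(M / K)%g |
    `[< (g @` [set` vring x] = [set` vring x])%classic >]].

Definition inertia_group : {set gal_of M} :=
  [set g in decomp_group |
    `[< forall a, a \in vring x -> res x (g a) = res x a >]].

Definition ramif_group : {set gal_of M} :=
  [set g in inertia_group |
    `[< forall c, c \in M -> c != 0 -> res x (g c / c) = 1 >]].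

Definition sep_fixed (A : {set gal_of M}) : {subfield Om} :=
  (fixedField A :&: sep_subfield K M)%AS.

Definition decomp_field : {subfield Om} := sep_fixed decomp_group.
Definition inertia_field : {subfield Om} := sep_fixed inertia_group.
Definition ramif_field : {subfield Om} := sep_fixed ramif_group.

Lemma sep_fixed_sub A : (sep_fixed A <= M)%VS.
Proof. exact: subv_trans (capvSl _ _) (fixedField_bound _). Qed.

End Groups.
End Ramification.

(* Main.v *)
Require Import Defs.
From HB Require Import structures.
From mathcomp Require Import ring_quotient generic_quotient finmap ring.
From mathcomp Require Import all_boot all_order all_algebra all_fingroup all_solvable all_field.
From mathcomp Require Import boolp classical_sets cardinality.

(* Write G = Gal(M/K) and D, I, V for the decomposition, inertia and
   ramification groups. For a subgroup H of G the subfield of separable elements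
   fixed by H has degree [G : H] over K and Galois group H, so everything reduces
   to computing group indices:
   - [G : D] = g_{M,v}, because G permutes the extensions of v transitively:
     the coefficient of least valuation in an algebraic relation of a yields a
     denominator of a valid at all the extensions simultaneously, hence a
     Chinese remainder theorem for them, and one compares norms;
   - [D : I] = f_s(x/v), because D maps onto the automorphisms of the residue
     field; lifting a generator of its separable part to an element that
     vanishes at the other conjugates of x shows the surjectivity;
   - [I : V] = e_t(x/v), because the pairing (g, c) |-> res (g c / c) between I/V
     and the prime-to-p part of the value group quotient is perfect. If
     res (g c / c) = 1 for all g in I, then the norm of b c over a Sylow
     p-subgroup of I followed by a trace to K, for suitable b, has the value of
     a p-power of c, so that c has p-power order modulo K.
   The formulas for w/v follow because all these quantities are multiplicative
   in towers and d_w = n / (e_t f_s). *)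

Set Implicit Arguments.
Unset Strict Implicit.
Unset Printing Implicit Defensive.

Import GRing.Theory.
Local Open Scope ring_scope.

Arguments vmax {F Om E} v _.
Arguments sub_residue {F Om L} w {K} v _.

(** Inseparability, of M/K as well as of k_x/k_v, shapes the argument. An element of M fixed by
    Gal(M/K) is in general only purely inseparable over K, so a descent to K passes through a [q]-th
    power, with [q] a power of the characteristic ([q = 1] in characteristic 0), and injectivity of
    Frobenius undoes the power afterwards. Valuations are handled as rings: comparing the values of
    [a] and [b] means asking whether [a / b] is integral, and value group quotients are handled
    through representatives. Residue fields come without the structure of a finite extension. It is
    built from a basis of k_x over the image of k_v, whose existence follows from the bound by
    [M:K]; only then does Galois theory apply to k_x. The auxiliary field N in d_w may be unrelated
    to M. The counts of extensions in different N are compared through the whole of [Om], and this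
    requires that a valuation of a subfield always extends to [Om]. *)

Lemma dim_tower (F : fieldType) (L : fieldExtType F) (K E M : {subfield L}) :
  (K <= E)%VS -> (E <= M)%VS -> \dim_K M = (\dim_K E * \dim_E M)%N.
Proof.
move=> sKE sEM; apply/eqP.
rewrite -(eqn_pmul2r (adim_gt0 K)) mulnAC !divnK ?field_dimS ?(subv_trans sKE) //.
by rewrite mulnC divnK ?field_dimS.
Qed.

(** Injectivity of Frobenius. When the characteristic is 0 the hypothesis forces [q = 1], so both
    cases are treated uniformly. *)
Lemma pchar_nat_expI (R : idomainType) (q : nat) :
  [pchar R].-nat q -> injective (fun a : R => a ^+ q).
Proof.
move=> qR a b /= ab; apply/eqP; rewrite -subr_eq0.
have : (a - b) ^+ q = 0.
  by rewrite exprDn_pchar // exprNn_pchar // ab subrr.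
by move/eqP; rewrite expf_eq0 => /andP[].
Qed.

(** * Fixed fields of separable elements *)

Section SepFixed.
Variables (F : fieldType) (Om : splittingFieldType F).
Implicit Types K L M : {subfield Om}.

Lemma sep_subfield_bound K M : (K <= M)%VS -> (sep_subfield K M <= M)%VS.
Proof. by move=> sKM; apply/subvP => a; rewrite mem_sep_subfield // => /andP[]. Qed.

Lemma sub_sep_subfield K M : (K <= sep_subfield K M)%VS.
Proof. exact: subv_adjoin. Qed.

Lemma expr_sep_subfield K M a : a \in M ->
  exists2 q, [pchar Om].-nat q & a ^+ q \in sep_subfield K M.
Proof.
move=> aM; have /purely_inseparableP/(_ _ aM) := separable_generator_maximal M K.
by move/purely_inseparable_elementP_pchar => [q qn aq]; exists q.
Qed.

Lemma gal_expr_id M (g : gal_of M) q a : [pchar Om].-nat q ->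
  g (a ^+ q) = a ^+ q -> g a = a.
Proof. by move=> qn; rewrite rmorphXn => /(pchar_nat_expI qn). Qed.

Section Fixed.
Variables K M : {subfield Om}.
Hypotheses (sKM : (K <= M)%VS) (nKM : normalField K M).
Let S := sep_subfield K M.
Let sSM : (S <= M)%VS. Proof. exact: sep_subfield_bound. Qed.
Let sKS : (K <= S)%VS. Proof. exact: sub_sep_subfield. Qed.

Lemma sep_subfield_normal : normalField K S.
Proof.
apply/forall_inP => f fK; apply/eqP.
have sfS : (f @: S <= S)%VS.
  apply/subvP => _ /memv_imgP[a aS ->].
  move: aS; rewrite !mem_sep_subfield // => /andP[aM sa].
  have /forall_inP/(_ f fK)/eqP fM := nKM.
  rewrite -fM memv_img //=.
  have Kf : kHom K {:Om} f by move: fK; rewrite inE => /andP[].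
  apply/separable_elementP; exists (minPoly K a); split=> //.
    exact: minPolyOver.
  by apply: (kHom_root_id _ Kf) => //; rewrite ?subvf ?memvf ?minPolyOver ?root_minPoly.
by apply/eqP; rewrite eqEdim sfS /= limg_dim_eq // (eqP (AEnd_lker0 f)) capv0.
Qed.

Lemma sep_subfield_galois : galois K S.
Proof.
rewrite /galois sKS sep_subfield_normal andbT /=.
by apply/separableP => a; rewrite mem_sep_subfield // => /andP[].
Qed.

Lemma gal_sep_img (g : gal_of M) : g \in 'Gal(M / K)%g -> (g @: S <= S)%VS.
Proof.
move=> gG; apply/subvP => _ /memv_imgP[a aS ->].
move: aS; rewrite !mem_sep_subfield // => /andP[aM sa].
rewrite memv_gal //=; apply/separable_elementP; exists (minPoly K a).
by rewrite minPolyOver root_minPoly_gal.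
Qed.

(** Restriction to the separable part. Since M/S is purely inseparable it will be an isomorphism
    from Gal(M/K) onto Gal(S/K), which moves degree computations into the Galois extension S/K. *)
Let rs (g : gal_of M) : gal_of S := gal S g.

Let rsE g : g \in 'Gal(M / K)%g -> {in S, rs g =1 g}.
Proof. by move=> gG a aS; rewrite /rs galK // gal_sep_img. Qed.

Let rsM : {in 'Gal(M / K)%g &, {morph rs : g h / (g * h)%g}}.
Proof.
move=> g h gG hG; apply/eqP/gal_eqP => a aS.
have gaS : g a \in S by rewrite -(rsE gG aS) memv_gal.
have aM := subvP sSM _ aS.
by rewrite (rsE (groupM gG hG) aS) !galM // (rsE gG aS) (rsE hG gaS).
Qed.

Canonical rs_morphism := Morphism rsM.

Let rs_inj : ('injm rs_morphism)%g.
Proof.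
apply/injmP => g h gG hG /= e; apply/eqP/gal_eqP => a aM.
have [q qn aq] := expr_sep_subfield K aM.
apply: (pchar_nat_expI qn) => /=.
have := congr1 (fun k : gal_of S => k (a ^+ q)) e.
by rewrite (rsE gG aq) (rsE hG aq) !rmorphXn.
Qed.

Let rs_img : (rs_morphism @* 'Gal(M / K) = 'Gal(S / K))%g.
Proof.
apply/setP => h; apply/idP/idP => [/morphimP[g gG _ ->]|hG].
  rewrite gal_kHom //; apply/kAHomP => a aK.
  by rewrite /= rsE ?(fixed_gal sKM gG) // (subvP sKS).
have hK : kHom K S h by rewrite -gal_kHom.
have [g gG gE] := kHom_to_gal (introT andP (conj sKS sSM)) nKM hK.
apply/morphimP; exists g => //; apply/eqP/gal_eqP => a aS /=.
by rewrite rsE // gE.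
Qed.

Lemma dim_sep_fixed (H : {group gal_of M}) : H \subset 'Gal(M / K)%g ->
  \dim_K (sep_fixed K H) = #|'Gal(M / K) : H|%g.
Proof.
move=> sHG.
(* Seen inside S, this is the fixed field of the image of H, where the Galois correspondence
   applies. *)
have -> : sep_fixed K H = fixedField_aspace (rs_morphism @* H)%g.
  apply/val_inj/vspaceP => a; rewrite /= memv_cap.
  apply/andP/idP => [[/mem_fixedFieldP[aM aH] aS]|/mem_fixedFieldP[aS aH]].
    apply/fixedFieldP => // _ /morphimP[g gG gH ->].
    by rewrite /= rsE ?aH.
  split=> //; apply/fixedFieldP => [|g gH]; first exact: (subvP sSM).
  have gG := fintype.subsetP sHG _ gH.
  by rewrite -rsE // (aH _ (mem_morphim _ gG gH)).
rewrite (dim_fixed_galois sep_subfield_galois); last by rewrite -rs_img morphimS.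
rewrite -rs_img /= -!divgS ?morphimS //.
by rewrite !card_injm.
Qed.

(** An automorphism fixing the separable H-invariants fixes all H-invariants, because these are
    purely inseparable over the former. *)
Lemma gal_sep_fixed (H : {group gal_of M}) : H \subset 'Gal(M / K)%g ->
  'Gal(M / sep_fixed K H)%g = H.
Proof.
move=> sHG; apply/eqP; rewrite finset.eqEsubset; apply/andP; split; last first.
  by rewrite -{1}(gal_fixedField H) galS ?capvSl.
apply/fintype.subsetP => g gG; rewrite -(gal_fixedField H); have sM := sep_fixed_sub K H.
rewrite gal_kHom ?fixedField_bound //; apply/kAHomP => a aH.
have [aM _] := mem_fixedFieldP aH.
have [q qn aq] := expr_sep_subfield K aM.
apply: (gal_expr_id qn); apply: (fixed_gal sM gG).
by rewrite memv_cap rpredX.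
Qed.

Lemma sep_fixed_gal : sep_fixed K 'Gal(M / K)%g = K.
Proof.
apply/val_inj/eqP; rewrite eq_sym eqEdim /= subv_cap galois_connection_subv //.
rewrite sub_sep_subfield /=.
have := dim_sep_fixed (subxx _); rewrite indexgg /= => d1.
have sK : (K <= sep_fixed K 'Gal(M / K)%g)%VS.
  by rewrite subv_cap galois_connection_subv // sub_sep_subfield.
by rewrite -(divnK (field_dimS sK)) d1 mul1n.
Qed.

Lemma sub_sep_fixed (A : {set gal_of M}) :
  A \subset 'Gal(M / K)%g -> (K <= sep_fixed K A)%VS.
Proof. by move=> sA; rewrite subv_cap sub_sep_subfield -galois_connection // sA. Qed.

(** The fixed field of the full group may exceed K when M/K is inseparable, but only by purely
    inseparable elements. *)
Lemma expr_fixed a : a \in fixedField 'Gal(M / K)%g ->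
  exists2 q, [pchar Om].-nat q & a ^+ q \in K.
Proof.
move=> aG; have [aM _] := mem_fixedFieldP aG.
have [q qn aq] := expr_sep_subfield K aM; exists q => //.
by rewrite -sep_fixed_gal memv_cap rpredX.
Qed.

End Fixed.

Lemma sep_fixed_gal_sub K L M : (K <= L)%VS -> (L <= M)%VS -> normalField K M ->
  sep_fixed K 'Gal(M / L)%g = sep_subfield K L.
Proof.
move=> sKL sLM nKM; have sKM := subv_trans sKL sLM.
apply/val_inj/vspaceP => a; rewrite memv_cap !mem_sep_subfield //.
apply/and3P/andP => [[aL aM sa]|[aL sa]]; last first.
  by rewrite (subvP (galois_connection_subv sLM)) ?(subvP sLM).
split=> //; rewrite -(sep_fixed_gal sLM (normalFieldS sKL nKM)) memv_cap aL.
by rewrite mem_sep_subfield // aM (separable_elementS sKL).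
Qed.

End SepFixed.

(** * Valuations and approximation *)

Section ValuationBasics.
Variables (F : fieldType) (Om : fieldExtType F).
Implicit Types (E K L : {subfield Om}).

Lemma valuation_inj E (u w : valuation E) :
  (forall a, (a \in vring u) = (a \in vring w)) -> u = w.
Proof.
case: u w => [o po] [o' po'] /= h; have e : o = o' by apply/funext => a; apply: h.
by rewrite e in po *; congr Valuation; apply: Prop_irrelevance.
Qed.

(** The maximal ideal as a subset of [Om], whereas [vmax] lives on the subtype of integral elements:
    in this form the ideals of several valuations can be compared on the same elements. *)
Definition vmaxid E (v : valuation E) : pred Om :=
  [pred a | (a \in vring v) && ((a == 0) || (a^-1 \notin vring v))].

Lemma vmaxid_def E (v : valuation E) a :
  (a \in vmaxid v) = (a \in vring v) && ((a == 0) || (a^-1 \notin vring v)).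
Proof. by []. Qed.

Section OneValuation.
Local Open Scope quotient_scope.
Variables (E : {subfield Om}) (v : valuation E).
Local Notation O := (vring v).
Local Notation m := (vmaxid v).

Lemma vring_sub : {subset O <= E}. Proof. by case: (vringP v). Qed.

Lemma vring_total a : a \in E -> a != 0 -> (a \in O) || (a^-1 \in O).
Proof. by case: (vringP v) => _ _ h /h. Qed.

Lemma vringVN a : a \in E -> a \notin O -> a^-1 \in O.
Proof.
move=> aE aO; have := vring_total aE; rewrite (negPf aO) /=; apply.
by apply: contraNneq aO => ->; rewrite rpred0.
Qed.

Lemma vmaxidW a : a \in m -> a \in O. Proof. by case/andP. Qed.

Lemma vmaxid_sub a : a \in m -> a \in E. Proof. by move/vmaxidW/vring_sub. Qed.

Lemma vmaxid_val (a : vint v) : (a \in vmax v) = (val a \in m).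
Proof. by rewrite vmaxE inE (valP a). Qed.

Lemma vmaxidE (a : Om) (aO : a \in O) : (a \in m) = (VInt aO \in vmax v).
Proof. by rewrite vmaxid_val. Qed.

Lemma vmaxid0 : 0 \in m. Proof. by rewrite inE rpred0 eqxx. Qed.

Lemma vmaxid1 : (1 \in m) = false.
Proof. by rewrite inE rpred1 oner_eq0 invr1 rpred1. Qed.

Lemma vmaxidM a b : a \in O -> b \in m -> a * b \in m.
Proof.
move=> aO bm; have bO := vmaxidW bm; move: bm; rewrite (vmaxidE bO) => bm.
have [h0 _ h] := vmax_idealr v; have := h (VInt aO) _ _ bm h0.
by rewrite addr0 vmaxid_val.
Qed.

Lemma vmaxidMr a b : a \in m -> b \in O -> a * b \in m.
Proof. by move=> am bO; rewrite mulrC vmaxidM. Qed.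

Lemma vmaxidD a b : a \in m -> b \in m -> a + b \in m.
Proof.
move=> am bm; have aO := vmaxidW am; have bO := vmaxidW bm.
move: am bm; rewrite (vmaxidE aO) (vmaxidE bO) => am bm.
have [_ _ h] := vmax_idealr v; have := h 1 _ _ am bm.
by rewrite mul1r vmaxid_val.
Qed.

Lemma vmaxidN a : (- a \in m) = (a \in m).
Proof. by rewrite !inE rpredN oppr_eq0 invrN rpredN. Qed.

Lemma vmaxidB a b : a \in m -> b \in m -> a - b \in m.
Proof. by move=> am bm; rewrite vmaxidD ?vmaxidN. Qed.

Lemma vmaxid_sum (I : Type) (r : seq I) (P : pred I) (f : I -> Om) :
  (forall i, P i -> f i \in m) -> \sum_(i <- r | P i) f i \in m.
Proof.
by move=> h; elim/big_ind : _ => //; [apply: vmaxid0|apply: vmaxidD].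
Qed.

Lemma vmaxidVN a : a \in E -> a \notin O -> a^-1 \in m.
Proof. by move=> aE aO; rewrite inE vringVN // invrK aO orbT. Qed.

Lemma vmaxidX a n : (0 < n)%N -> a \in m -> a ^+ n \in m.
Proof. by case: n => // n _ am; rewrite exprSr vmaxidM // rpredX // vmaxidW. Qed.

(** If [a] were a unit or not integral, its inverse would be integral, and multiplying by the [n]-th
    power of the inverse would put 1 in the ideal. *)
Lemma vmaxidXE a n : a \in E -> a ^+ n \in m -> a \in m.
Proof.
move=> aE anm; have [aO|aO] := boolP (a \in O); last first.
  have := vmaxidW anm => anO.
  have aV : a^-1 \in m by rewrite vmaxidVN.
  have a0 : a != 0 by apply: contraNneq aO => ->; rewrite rpred0.
  have : a^-1 ^+ n * a ^+ n \in m by rewrite vmaxidM ?rpredX ?vmaxidW.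
  by rewrite -exprMn mulVf // expr1n vmaxid1.
rewrite inE aO; have [//|a0 /=] := eqVneq a 0.
apply: contraT; rewrite negbK => aV.
have : a^-1 ^+ n * a ^+ n \in m by rewrite vmaxidM ?rpredX.
by rewrite -exprMn mulVf // expr1n vmaxid1.
Qed.

Lemma vmaxid_eq1_neq0 a : a - 1 \in m -> a != 0.
Proof.
by apply: contraTneq => ->; rewrite sub0r vmaxidN vmaxid1.
Qed.

Lemma vmaxid_eq1_ring a : a - 1 \in m -> a \in O.
Proof. by move/vmaxidW => h; rewrite -(subrK 1 a) rpredD ?rpred1. Qed.

Lemma vmaxid_eq1V a : a - 1 \in m -> a^-1 \in O.
Proof.
move=> h; have aO := vmaxid_eq1_ring h; apply: contraT => aV.
have am : a \in m by rewrite inE aO aV orbT.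
by rewrite -vmaxid1 -(subKr a 1) vmaxidB // -vmaxidN opprB.
Qed.

Lemma vmaxid_eq1M a b : a - 1 \in m -> b - 1 \in m -> a * b - 1 \in m.
Proof.
move=> ha hb; have -> : a * b - 1 = a * (b - 1) + (a - 1).
  by rewrite mulrBr mulr1 addrA subrK.
by rewrite vmaxidD // vmaxidM // vmaxid_eq1_ring.
Qed.

Lemma vmaxid_eq1_prod (I : Type) (r : seq I) (P : pred I) (f : I -> Om) :
  (forall i, P i -> f i - 1 \in m) -> \prod_(i <- r | P i) f i - 1 \in m.
Proof.
move=> h; elim/big_ind : _ => //; first by rewrite subrr vmaxid0.
exact: vmaxid_eq1M.
Qed.

Lemma vmaxid_prod (I : finType) (P : pred I) (f : I -> Om) i :
  (forall i, P i -> f i \in O) -> P i -> f i \in m ->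
  \prod_(i | P i) f i \in m.
Proof.
move=> h Pi fi; rewrite (bigD1 i) //= vmaxidMr // rpred_prod // => j /andP[Pj _].
exact: h.
Qed.

Lemma res_pi (a : Om) (aO : a \in O) : res v a = \pi_({ideal_quot vmax v}) (VInt aO).
Proof. exact: (resE (VInt aO)). Qed.

Lemma res_out a : a \notin O -> res v a = 0.
Proof. by move=> aO; rewrite /res /insubd insubN ?rmorph0. Qed.

Lemma res_eq0E a : a \in O -> (res v a == 0) = (a \in m).
Proof. by move=> aO; rewrite (res_eq0 (VInt aO)) vmaxid_val. Qed.

Lemma res_max a : a \in m -> res v a = 0.
Proof. by move=> am; apply/eqP; rewrite res_eq0E ?vmaxidW. Qed.

Lemma res0 : res v 0 = 0. Proof. exact: res_max vmaxid0. Qed.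

Lemma res1 : res v 1 = 1.
Proof.
rewrite (res_pi (rpred1 _)) -(rmorph1 \pi_({ideal_quot vmax v})).
by congr (\pi _); apply: val_inj.
Qed.

Lemma resD a b : a \in O -> b \in O -> res v (a + b) = res v a + res v b.
Proof.
move=> aO bO; rewrite (res_pi aO) (res_pi bO) (res_pi (rpredD aO bO)).
rewrite -[RHS](rmorphD \pi_({ideal_quot vmax v})).
by congr (\pi _); apply: val_inj.
Qed.

Lemma resN a : res v (- a) = - res v a.
Proof.
have [aO|aO] := boolP (a \in O); last by rewrite !res_out ?rpredN // oppr0.
have := resD aO (_ : - a \in O); rewrite rpredN subrr res0 => /(_ aO)/esym/eqP.
by rewrite addrC addr_eq0 => /eqP.
Qed.

Lemma resB a b : a \in O -> b \in O -> res v (a - b) = res v a - res v b.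
Proof. by move=> aO bO; rewrite resD ?rpredN // resN. Qed.

Lemma resM a b : a \in O -> b \in O -> res v (a * b) = res v a * res v b.
Proof.
move=> aO bO; rewrite (res_pi aO) (res_pi bO) (res_pi (rpredM aO bO)).
rewrite -[RHS](rmorphM \pi_({ideal_quot vmax v})).
by congr (\pi _); apply: val_inj.
Qed.

Lemma resX a n : a \in O -> res v (a ^+ n) = res v a ^+ n.
Proof.
move=> aO; elim: n => [|n IHn]; first by rewrite !expr0 res1.
by rewrite !exprS resM ?rpredX // IHn.
Qed.

Lemma res_sum (I : Type) (r : seq I) (P : pred I) (f : I -> Om) :
  (forall i, P i -> f i \in O) ->
  res v (\sum_(i <- r | P i) f i) = \sum_(i <- r | P i) res v (f i).
Proof.
move=> h; elim: r => [|i r IHr]; first by rewrite !big_nil res0.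
rewrite !big_cons; case: ifP => // Pi.
by rewrite resD ?IHr ?h ?rpred_sum.
Qed.

Lemma res_prod (I : Type) (r : seq I) (P : pred I) (f : I -> Om) :
  (forall i, P i -> f i \in O) ->
  res v (\prod_(i <- r | P i) f i) = \prod_(i <- r | P i) res v (f i).
Proof.
move=> h; elim: r => [|i r IHr]; first by rewrite !big_nil res1.
rewrite !big_cons; case: ifP => // Pi.
by rewrite resM ?IHr ?h ?rpred_prod.
Qed.

Lemma res_eqP a b : a \in O -> b \in O -> (res v a = res v b) <-> (a - b \in m).
Proof.
move=> aO bO; rewrite -res_eq0E ?rpredB // resB // subr_eq0.
by split => [->|/eqP].
Qed.

Lemma res_eq1P a : a - 1 \in m <-> res v a = 1.
Proof.
split=> [h|h]; first by rewrite -res1; apply/res_eqP; rewrite ?rpred1 ?vmaxid_eq1_ring.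
have aO : a \in O.
  apply: contraT => aO; move/eqP: h.
  by rewrite res_out // eq_sym oner_eq0.
by apply/res_eqP; rewrite ?rpred1 // res1.
Qed.

Lemma res_surj r : exists2 a, a \in O & res v a = r.
Proof.
exists (val (generic_quotient.repr (r : {ideal_quot vmax v}))); first exact: valP.
by rewrite resE reprK.
Qed.

Lemma resV a : a \in O -> a^-1 \in O -> res v a^-1 = (res v a)^-1.
Proof.
move=> aO aV; have [->|a0] := eqVneq a 0; first by rewrite invr0 res0 invr0.
have h : res v a * res v a^-1 = 1 by rewrite -resM // divff // res1.
have r0 : res v a != 0.
  by apply/eqP => r0; move/eqP: h; rewrite r0 mul0r eq_sym oner_eq0.
by apply: (mulfI r0); rewrite h divff.
Qed.

End OneValuation.

Section Extends.
Variables (L : {subfield Om}) (w : valuation L) (K : {subfield Om}) (v : valuation K).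
Hypothesis wv : extends w v.

Lemma extends_sub : (K <= L)%VS. Proof. by case: wv. Qed.

Lemma extends_ring a : a \in vring v -> a \in vring w.
Proof. by case: wv => _ ->; case/andP. Qed.

Lemma extends_ringE a : a \in K -> (a \in vring v) = (a \in vring w).
Proof. by case: wv => _ -> ->. Qed.

Lemma extends_max a : a \in K -> (a \in vmaxid v) = (a \in vmaxid w).
Proof. by move=> aK; rewrite !inE !extends_ringE ?rpredV. Qed.

Lemma extends_maxW a : a \in vmaxid v -> a \in vmaxid w.
Proof. by move=> h; rewrite -extends_max // (vmaxid_sub h). Qed.

End Extends.

Lemma extends_trans E L K (u : valuation E) (w : valuation L) (v : valuation K) :
  extends u w -> extends w v -> extends u v.
Proof.
move=> [sLE h] [sKL h']; split=> [|a]; first exact: subv_trans sLE.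
rewrite h' h; case: (boolP (a \in K)) => //= aK.
by rewrite (subvP sKL _ aK).
Qed.

Lemma restrict_extends K L (sKL : (K <= L)%VS) (w : valuation L) :
  extends w (restrict sKL w).
Proof. by split. Qed.

Lemma extends_restrict E L K (u : valuation E) (w : valuation L) (v : valuation K) :
  extends u v -> extends u w -> (K <= L)%VS -> extends w v.
Proof.
move=> [_ h] [_ h'] sKL; split=> // a; rewrite h h'.
by case: (boolP (a \in K)) => //= aK; rewrite (subvP sKL _ aK).
Qed.

(* A relation [\sum_i c_i a ^+ i = 0] scaled so that its last coefficient of
   least valuation is 1. *)
Lemma normalised_relation K (v : valuation K) a :
  exists p : {poly Om}, exists s : nat,
    [/\ root p a, forall i, p`_i \in vring v, p`_s = 1 &
        forall i, (s < i)%N -> p`_i \in vmaxid v].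
Proof.
pose q := minPoly K a; have qK : q \is a polyOver K := minPolyOver K a.
have q0 : q != 0 by rewrite monic_neq0 ?monic_minPoly.
pose good s := (q`_s != 0) && [forall i : 'I_(size q), q`_i / q`_s \in vring v].
have goodP s : reflect (q`_s != 0 /\ forall i, q`_i / q`_s \in vring v) (good s).
  apply: (iffP andP) => [[qs /forallP h]|[qs h]]; split=> //; last exact/forallP.
  move=> i; have [ip|ip] := ltnP i (size q); first exact: (h (Ordinal ip)).
  by rewrite nth_default // mul0r rpred0.
have good_size s : good s -> (s <= size q)%N.
  by case/andP => qs _; rewrite ltnW // ltnNge; apply: contra qs => /(nth_default 0) ->.
have cmp i j : q`_j != 0 -> (q`_i / q`_j \in vring v) || (q`_j / q`_i \in vring v).
  move=> qj; have [->|qi] := eqVneq q`_i 0; first by rewrite mul0r rpred0.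
  have := @vring_total _ v (q`_i / q`_j); rewrite invf_div; apply.
    by rewrite rpred_div ?(polyOverP qK).
  by rewrite mulf_neq0 ?invr_eq0.
have ex : exists s, good s.
  suff [s [qs h]] : exists s, q`_s != 0 /\
      forall i, (i < size q)%N -> q`_i / q`_s \in vring v.
    by exists s; apply/andP; split=> //; apply/forallP => i; apply: h.
  elim: (size q) => [|n [s [qs IHn]]].
    by exists (size q).-1; split=> //; rewrite -lead_coefE lead_coef_eq0.
  have /orP[h|h] := cmp n s qs.
    by exists s; split=> // i; rewrite ltnS leq_eqVlt => /predU1P[->|/IHn].
  have [qn|qn] := eqVneq q`_n 0.
    exists s; split=> // i; rewrite ltnS leq_eqVlt => /predU1P[->|/IHn//].
    by rewrite qn mul0r rpred0.
  exists n; split=> // i; rewrite ltnS leq_eqVlt => /predU1P[->|/IHn hi].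
    by rewrite divff // rpred1.
  by have := rpredM hi h; rewrite mulrA divfK.
case: (ex_maxnP ex good_size) => s /goodP[qs hs] smax.
exists ((q`_s)^-1 *: q); exists s; split.
- by rewrite rootE hornerZ (eqP (root_minPoly K a)) mulr0.
- by move=> i; rewrite coefZ mulrC.
- by rewrite coefZ mulVf.
move=> i si; rewrite coefZ inE [_ * q`_i]mulrC hs /=.
have [->|qi] := eqVneq q`_i 0; first by rewrite mul0r eqxx.
apply/orP; right; apply/negP; rewrite invf_div => h.
suff : (i <= s)%N by rewrite leqNgt si.
apply: smax; apply/goodP; split=> // j.
by have := rpredM (hs j) h; rewrite mulrA divfK.
Qed.

(** Let [y] be the part of the normalised relation from degree [s] on, divided by [a ^+ s]. Where
    [a] is integral, all terms of [y] except the constant term 1 lie in the maximal ideal. Elsewhere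
    the relation turns [y * a] into minus the lower part divided by [a ^+ s.-1], a polynomial in
    [a^-1]. One [y] thus serves all extensions of [v]. *)
Lemma common_denominator E K (v : valuation K) a : a \in E -> (K <= E)%VS ->
  exists2 y, y \in E & forall u : valuation E, extends u v ->
    [/\ y \in vring u, y * a \in vring u & a \in vring u -> y - 1 \in vmaxid u].
Proof.
move=> aE sKE; have [a0|a0] := eqVneq a 0.
  by exists 1 => [|u _]; rewrite ?rpred1 // a0 mulr0 rpred0 subrr vmaxid0.
have [p [s [pa pv ps pm]]] := normalised_relation v a.
have pK i : p`_i \in E by rewrite (subvP sKE) ?(vring_sub (pv i)).
pose y := (drop_poly s p).[a].
have y1 u : extends u v -> a \in vring u -> y - 1 \in vmaxid u.
  move=> uv au; have -> : y - 1 = (drop_poly s p - 1).[a] by rewrite !hornerE.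
  rewrite horner_coef; apply: vmaxid_sum => -[[|i] hi] _ /=.
    by rewrite coefB coef1 coef_drop_poly add0n ps subrr mul0r vmaxid0.
  rewrite coefB coef1 subr0 coef_drop_poly vmaxidMr ?rpredX //.
  by rewrite (extends_maxW uv) ?pm // addSn ltnS leq_addl.
have ya : y * a ^+ s = - \sum_(i < s) p`_i * a ^+ i.
  have <- : (take_poly s p).[a] = \sum_(i < s) p`_i * a ^+ i.
    rewrite (horner_coef_wide a (size_take_poly s p)); apply: eq_bigr => i _.
    by rewrite coef_take_poly ltn_ord.
  apply/eqP; rewrite -addr_eq0 -hornerXn -hornerM.
  by rewrite -hornerD addrC poly_take_drop; apply: pa.
exists y => [|u uv].
  by rewrite /y horner_coef rpred_sum // => i _; rewrite coef_drop_poly rpredM ?rpredX.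
have pu i : p`_i \in vring u by rewrite (extends_ring uv).
have yu : a \in vring u -> y \in vring u by move=> /(y1 _ _ uv)/vmaxid_eq1_ring.
have [au|au] := boolP (a \in vring u); first by rewrite rpredM ?yu //; split=> // _; apply: y1.
have aV : a^-1 \in vring u by rewrite vringVN.
suff yau : y * a \in vring u by split=> //; rewrite -(mulfK a0 y) rpredM.
(* For [s = 0] the lower part is empty and the relation reads [y = 0]. *)
clearbody y; case: s ya {y1 yu ps pm} => [|s] ya.
  by move: ya; rewrite big_ord0 expr0 mulr1 oppr0 => ->; rewrite mul0r rpred0.
have -> : y * a = - \sum_(i < s.+1) p`_i * a^-1 ^+ (s - i).
  apply: (mulIf (expf_neq0 s a0)); rewrite -mulrA -exprS ya mulNr mulr_suml.
  congr (- _); apply: eq_bigr => i _; rewrite -mulrA; congr (_ * _).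
  have is_ : (i <= s)%N by rewrite -ltnS.
  have -> : a ^+ s = a ^+ (s - i) * a ^+ i by rewrite -exprD subnK.
  by rewrite exprVn mulKf ?expf_neq0.
by rewrite rpredN rpred_sum // => i _; rewrite rpredM ?rpredX.
Qed.

(** The larger ring has the smaller maximal ideal. For [a] in the larger ring the common denominator
    is therefore congruent to 1 at both valuations, and dividing [y * a] by it stays in the smaller
    ring. *)
Lemma extends_incomparable E K (v : valuation K) (u1 u2 : valuation E) :
  extends u1 v -> extends u2 v -> {subset vring u1 <= vring u2} -> u1 = u2.
Proof.
move=> u1v u2v s12; apply: valuation_inj => a; apply/idP/idP => [/s12//|a2].
have aE := vring_sub a2; have sKE := extends_sub u1v.
have [y yE h] := common_denominator v aE sKE.
have [y1 ya1 _] := h _ u1v; have [_ _ /(_ a2) ym2] := h _ u2v.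
have ym1 : y - 1 \in vmaxid u1.
  rewrite inE rpredB ?rpred1 //=; case/andP: ym2 => _ /orP[->//|].
  by move=> yV; apply/orP; right; apply: contra yV; apply: s12.
by rewrite -(mulKf (vmaxid_eq1_neq0 ym1) a) rpredM ?vmaxid_eq1V.
Qed.

Lemma valuation_pair E K (v : valuation K) (u1 u2 : valuation E) :
  extends u1 v -> extends u2 v -> u1 != u2 ->
  exists e, [/\ forall u : valuation E, extends u v -> e \in vring u,
                e - 1 \in vmaxid u1 & e \in vmaxid u2].
Proof.
move=> u1v u2v ne.
have sub (u u' : valuation E) : extends u v -> extends u' v -> u != u' ->
    exists2 a : Om, a \in vring u & a \notin vring u'.
  move=> uv uv' /eqP ne'; apply: contra_notP ne' => h.
  apply: (extends_incomparable uv uv') => a au; apply: contraT => au'.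
  by case: h; exists a.
have [a a1 a2] := sub _ _ u1v u2v ne.
rewrite eq_sym in ne; have [b b2 b1] := sub _ _ u2v u1v ne.
have sKE := extends_sub u1v.
have [aE bE] := (vring_sub a1, vring_sub b2).
have a0 : a != 0 by apply: contraNneq a2 => ->; rewrite rpred0.
have b0 : b != 0 by apply: contraNneq b1 => ->; rewrite rpred0.
have ab : a / b \in vmaxid u1 by rewrite vmaxidM ?vmaxidVN.
have ba : b / a \in vmaxid u2 by rewrite vmaxidM ?vmaxidVN.
have d0 : 1 + a / b != 0 by rewrite (@vmaxid_eq1_neq0 _ u1) // addrAC subrr add0r.
(* This is [b / (a + b)], with [a / b] in the first ideal and [b / a] in the second: congruent to 1
   at [u1] and to 0 at [u2]. The denominator [y] below makes it integral everywhere without spoiling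
   either congruence. *)
pose e := (1 + a / b)^-1.
have e1 : e - 1 \in vmaxid u1.
  have -> : e - 1 = - (e * (a / b)).
    by rewrite -[X in e - X](mulVf d0) -/e mulrDr mulr1 opprD addrA subrr add0r.
  by rewrite vmaxidN vmaxidM // vmaxid_eq1V // addrAC subrr add0r.
have e2 : e \in vmaxid u2.
  have d1 : 1 + b / a - 1 \in vmaxid u2 by rewrite addrAC subrr add0r.
  have -> : e = (1 + b / a)^-1 * (b / a).
    rewrite -[X in _ * X]invf_div -invfM mulrDl mul1r; congr (_^-1).
    by rewrite mulrA divfK // mulfV // addrC.
  by rewrite vmaxidM // vmaxid_eq1V.
have eE := vmaxid_sub e2.
have [y yE h] := common_denominator v eE sKE.
exists (y * e); split=> [u /h[]//||].
  by rewrite vmaxid_eq1M //; have [_ _] := h _ u1v; apply; apply: vmaxid_eq1_ring.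
by rewrite vmaxidM //; have [] := h _ u2v.
Qed.

(** The elements given by [valuation_pair] for [x] and each member of [us] are multiplied together.
    The factor [a] enters with its common denominator, since it need not be integral away from
    [x]. *)
Lemma valuation_approx E K (v : valuation K) (x : valuation E)
    (us : seq (valuation E)) a :
  extends x v -> (forall u, u \in us -> extends u v) -> x \notin us ->
  a \in vring x ->
  exists b, [/\ forall u : valuation E, extends u v -> b \in vring u,
                b - a \in vmaxid x & forall u, u \in us -> b \in vmaxid u].
Proof.
move=> xv; elim: us a => [|u us IHus] a usv xus ax.
  have [y yE h] := common_denominator v (vring_sub ax) (extends_sub xv).
  exists (y * a); split=> // [u /h[]//|].
  by have [_ _ /(_ ax) y1] := h _ xv; rewrite -[X in _ - X]mul1r -mulrBl vmaxidMr.
move: xus; rewrite inE negb_or => /andP[xu xus].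
have uv : extends u v := usv u (mem_head _ _).
have usv' u' : u' \in us -> extends u' v by move=> h; apply: usv; rewrite inE h orbT.
have [b [bO bx bus]] := IHus a usv' xus ax.
have [e [eO ex eu]] := valuation_pair xv uv xu.
exists (e * b); split=> [u' u'v||u']; first by rewrite rpredM ?eO ?bO.
  have -> : e * b - a = (e - 1) * b + (b - a) by rewrite mulrBl mul1r addrA subrK.
  by rewrite vmaxidD // vmaxidMr // bO.
rewrite inE => /predU1P[->|u'us]; first by rewrite vmaxidMr ?bO.
by rewrite vmaxidM ?bus // eO //; apply: usv'.
Qed.

End ValuationBasics.

(** * Residues and value cosets *)

Section Independence.
Variables (F : fieldType) (Om : fieldExtType F).
Implicit Types (E K L : {subfield Om}).

Lemma independent_dim K L n (c : 'I_n -> Om) : (K <= L)%VS ->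
  (forall i, c i \in L) ->
  (forall a : 'I_n -> Om, (forall i, a i \in K) ->
     \sum_i a i * c i = 0 -> forall i, a i = 0) ->
  (n <= \dim_K L)%N.
Proof.
move=> sKL cL ind; rewrite leq_divRL ?adim_gt0 //.
have c0 i : c i != 0.
  apply/eqP => ci0; have := ind (fun j => (j == i)%:R) (fun j => rpred_nat _ _).
  rewrite (bigD1 i) //= eqxx ci0 mulr0 big1 ?addr0 => [/(_ erefl i)/eqP|j /negPf ->].
    by rewrite eqxx oner_eq0.
  by rewrite mul0r.
have dS : directv (\sum_(i < n) K * <[c i]>).
  apply/directv_sum_independent => us usK us0 i _.
  have h j : exists2 a, a \in K & us j = a * c j.
    have /memv_cosetP[a aK ->] := usK j isT; by exists a.
  pose a j := s2val (cid2 (h j)).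
  have aK j : a j \in K := s2valP (cid2 (h j)).
  have aE j : us j = a j * c j := s2valP' (cid2 (h j)).
  have a0 : \sum_j a j * c j = 0 by rewrite -[RHS]us0; apply: eq_bigr => j _.
  by rewrite aE (ind a aK a0) mul0r.
have -> : (n * \dim K = \dim (\sum_(i < n) K * <[c i]>))%N.
  rewrite (directvP dS) /=; transitivity (\sum_(i < n) \dim K)%N.
    by rewrite sum_nat_const card_ord.
  by apply: eq_bigr => i _; rewrite dim_cosetv.
apply: dimvS; apply/subv_sumP => i _.
by apply: (subv_trans (prodvS sKL (_ : (<[c i]> <= L)%VS))); rewrite -?memvE ?prodv_id.
Qed.

Definition vunit E (v : valuation E) : pred Om :=
  [pred a | [&& a != 0, a \in vring v & a^-1 \in vring v]].

Section Units.
Variables (E : {subfield Om}) (v : valuation E).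

Lemma vunitE a : (a \in vunit v) = [&& a != 0, a \in vring v & a^-1 \in vring v].
Proof. by []. Qed.

Lemma vunit_neq0 a : a \in vunit v -> a != 0. Proof. by case/and3P. Qed.
Lemma vunit_ring a : a \in vunit v -> a \in vring v. Proof. by case/and3P. Qed.
Lemma vunitV a : (a^-1 \in vunit v) = (a \in vunit v).
Proof. by rewrite !vunitE invr_eq0 invrK [_ && (a \in _)]andbC. Qed.
Lemma vunit_ringV a : a \in vunit v -> a^-1 \in vring v. Proof. by case/and3P. Qed.
Lemma vunitM a b : a \in vunit v -> b \in vunit v -> a * b \in vunit v.
Proof.
by move=> /and3P[a0 av aV] /and3P[b0 bv bV]; rewrite vunitE mulf_neq0 // invfM !rpredM.
Qed.
Lemma vunit1 : 1 \in vunit v.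
Proof. by rewrite vunitE oner_eq0 invr1 rpred1. Qed.
Lemma vunitX a n : a \in vunit v -> a ^+ n \in vunit v.
Proof. by move=> au; elim: n => [|n IHn]; rewrite ?expr0 ?vunit1 // exprS vunitM. Qed.
Lemma vunitN a : a \in vring v -> (a \in vunit v) = (a \notin vmaxid v).
Proof. by move=> av; rewrite vunitE vmaxid_def av /= negb_or negbK. Qed.
Lemma vunit_max a : a \in vunit v -> a \notin vmaxid v.
Proof. by move=> au; rewrite -vunitN ?vunit_ring. Qed.
Lemma vunit_res a : a \in vring v -> (a \in vunit v) = (res v a != 0).
Proof. by move=> av; rewrite vunitN // res_eq0E. Qed.
Lemma vunit_resP a : (a \in vunit v) = (res v a != 0).
Proof.
have [av|av] := boolP (a \in vring v); first exact: vunit_res.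
by rewrite res_out // eqxx vunitE (negPf av) andbF.
Qed.
Lemma vunit_sub a : a \in vunit v -> a \in E. Proof. by move/vunit_ring/vring_sub. Qed.

Lemma max_term (s : seq Om) : {subset s <= E} -> has (fun b => b != 0) s ->
  exists b, [/\ b \in s, b != 0 & forall b', b' \in s -> b' / b \in vring v].
Proof.
elim: s => // b s IHs sE; have bE : b \in E by apply: sE; rewrite mem_head.
have {}sE : {subset s <= E} by move=> c cs; apply: sE; rewrite inE cs orbT.
have [hs _|hs] := boolP (has (fun b => b != 0) s); last first.
  rewrite /= (negPf hs) orbF => b0; exists b; split; rewrite ?mem_head // => b'.
  rewrite inE => /predU1P[->|b's]; first by rewrite divff ?rpred1.
  move: hs; rewrite -all_predC => /allP/(_ _ b's) /=; rewrite negbK => /eqP ->.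
  by rewrite mul0r rpred0.
have [c [cs c0 hc]] := IHs sE hs.
have [b0|b0] := eqVneq b 0.
  exists c; split; rewrite // ?inE ?cs ?orbT // => b'.
  by rewrite inE => /predU1P[->|/hc//]; rewrite b0 mul0r rpred0.
have [bc|bc] := boolP (b / c \in vring v).
  exists c; split; rewrite // ?inE ?cs ?orbT // => b'.
  by rewrite inE => /predU1P[->|/hc].
have cb : c / b \in vring v by rewrite -invf_div vringVN ?rpred_div ?(sE c).
exists b; split; rewrite ?mem_head // => b'.
rewrite inE => /predU1P[->|/hc h]; first by rewrite divff ?rpred1.
by rewrite -(divfK c0 b') -[_ * c / b]mulrA rpredM.
Qed.

Lemma max_term_ord n (b : 'I_n -> Om) i : (forall i, b i \in E) -> b i != 0 ->
  exists2 j, b j != 0 & forall k, b k / b j \in vring v.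
Proof.
move=> bE bi; have sb : {subset codom b <= E} by move=> _ /codomP[k ->].
have hb : has (fun c => c != 0) (codom b) by apply/hasP; exists (b i); rewrite ?codom_f.
have [_ [/codomP[j ->] bj h]] := max_term sb hb.
by exists j => // k; apply: h; apply: codom_f.
Qed.

End Units.

(* Equality of classes in [L^* / (K^* O_w^* )]. *)
Definition same_coset L (w : valuation L) K (a b : Om) : Prop :=
  exists d, [/\ d \in K, d != 0 & a / (d * b) \in vunit w].

Lemma same_coset_sym L (w : valuation L) K a b :
  same_coset w K a b -> same_coset w K b a.
Proof.
move=> [d [dK d0 u]]; exists d^-1; rewrite rpredV invr_eq0; split=> //.
have -> : b / (d^-1 * a) = (a / (d * b))^-1 by rewrite invf_div invfM invrK mulrA [b * d]mulrC.
by rewrite vunitV.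
Qed.

(** Divide a vanishing combination by a term of least value. Another term with unit quotient would
    lie in the same coset, so all other quotients are in the maximal ideal, and then so is 1. *)
Lemma independent_cosets K L (w : valuation L) n (c : 'I_n -> Om) :
  (K <= L)%VS -> (forall i, c i \in L) -> (forall i, c i != 0) ->
  (forall i j, same_coset w K (c i) (c j) -> i = j) ->
  forall a : 'I_n -> Om, (forall i, a i \in K) ->
     \sum_i a i * c i = 0 -> forall i, a i = 0.
Proof.
move=> sKL cL c0 cinj a aK s0 i; apply/eqP; apply: contraT => ai.
have acL k : a k * c k \in L by rewrite rpredM // (subvP sKL).
have [j acj h] := max_term_ord w acL (mulf_neq0 ai (c0 i)).
have aj : a j != 0 by apply: contraNneq acj => ->; rewrite mul0r.
have : \sum_i (a i * c i) / (a j * c j) \in vmaxid w by rewrite -mulr_suml s0 mul0r vmaxid0.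
rewrite (bigD1 j) //= divff // => hm.
have : \sum_(i < n | i != j) a i * c i / (a j * c j) \in vmaxid w.
  apply: vmaxid_sum => k kj; apply: contraNT kj => km; apply/eqP; apply: cinj.
  have hk := h k; move: km; rewrite -vunitN // => /[dup] /vunit_neq0.
  rewrite -mulrA mulf_eq0 negb_or => /andP[ak _] u.
  exists (a j / a k); rewrite rpred_div // mulf_neq0 ?invr_eq0 //; split=> //.
  have <- : a k * c k / (a j * c j) = c k / (a j / a k * c j); last by rewrite -mulrA.
  by rewrite !invfM invrK mulrACA mulrA [a k / a j]mulrC mulrC mulrA [c k * _]mulrC -!mulrA.
move=> /(vmaxidB hm); rewrite addrK vmaxid1 //.
Qed.

(** Independence bounds the number of cosets by [L:K], so among the powers of [c] with exponents
    from 0 to [L:K] two share a coset. *)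
Lemma coset_torsion K L (w : valuation L) c : (K <= L)%VS -> c \in L -> c != 0 ->
  exists n s, [/\ (0 < n)%N, s \in K, s != 0 & c ^+ n / s \in vunit w].
Proof.
move=> sKL cL c0; pose N := (\dim_K L).+1.
have ninj : ~ (forall i j : 'I_N, same_coset w K (c ^+ i) (c ^+ j) -> i = j).
  move=> cinj; have := @independent_dim K L N (fun i => c ^+ i) sKL.
  rewrite ltnn => /(_ (fun i => rpredX _ cL)) h; suff : false by [].
  apply: h; apply: (@independent_cosets _ _ w) => // i; first by rewrite rpredX.
  exact: expf_neq0.
have [i [j [ij [s [sK s0 u]]]]] : exists i j : 'I_N,
    (i < j)%N /\ same_coset w K (c ^+ j) (c ^+ i).
  apply: contra_notP ninj => h i j sc; apply/eqP; apply: contraT => ne.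
  have := ne; rewrite neq_ltn => /orP[ij|ji]; case: h.
    by exists i, j; split=> //; apply: same_coset_sym.
  by exists j, i.
exists (j - i)%N, s; split; rewrite ?subn_gt0 //.
by move: u; rewrite invfM mulrA -{1}(subnK (ltnW ij)) exprD mulrAC mulfK ?expf_neq0.
Qed.

(** A relation over K, scaled so that a coefficient of least value becomes 1, reduces to a
    non-trivial relation between the residues. *)
Lemma independent_residues K L (w : valuation L) (v : valuation K) n
    (c : 'I_n -> Om) : extends w v -> (forall i, c i \in vring w) ->
  (forall a : 'I_n -> residue w, (forall i, sub_residue w v (a i)) ->
     \sum_i a i * res w (c i) = 0 -> forall i, a i = 0) ->
  forall a : 'I_n -> Om, (forall i, a i \in K) ->
     \sum_i a i * c i = 0 -> forall i, a i = 0.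
Proof.
move=> wv cw ind a aK s0 i; apply/eqP; apply: contraT => ai.
have [j aj h] := max_term_ord v aK ai.
have h' k : a k / a j \in vring w by rewrite (extends_ring wv).
have := ind (fun k => res w (a k / a j)).
have -> : \sum_k res w (a k / a j) * res w (c k) = 0.
  rewrite (eq_bigr (fun k => res w (a k / a j * c k))) => [|k _]; last by rewrite (resM (h' k) (cw k)).
  rewrite -res_sum => [|k _]; last exact: rpredM (h' k) (cw k).
  rewrite (eq_bigr (fun k => (a k * c k) / a j)) => [|k _]; last by rewrite mulrAC.
  by rewrite -mulr_suml s0 mul0r res0.
move=> /(_ _ erefl j); rewrite divff // res1 => h1.
suff /eqP : (1 : residue w) = 0 by rewrite oner_eq0.
by apply: h1 => k; exists (a k / a j); [apply: h|].
Qed.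

End Independence.

(** * Conjugate valuations and decomposition groups *)

Section Conjugates.
Variables (F : fieldType) (Om : splittingFieldType F).
Implicit Types K L M : {subfield Om}.

Section Conj.
Variables (M : {subfield Om}).
Implicit Types (x u : valuation M) (g h : gal_of M).

Lemma galr_mul g a b : g (a * b) = g a * g b. Proof. exact: rmorphM. Qed.
Lemma galr_inv g a : g a^-1 = (g a)^-1. Proof. exact: fmorphV. Qed.
Lemma galr_exp g a n : g (a ^+ n) = g a ^+ n. Proof. exact: rmorphXn. Qed.
Lemma galr_eq0 g a : (g a == 0) = (a == 0). Proof. exact: fmorph_eq0. Qed.
Lemma galr_sub g a b : g (a - b) = g a - g b. Proof. exact: rmorphB. Qed.
Lemma galr_one g : g 1 = 1. Proof. exact: rmorph1. Qed.

Lemma galgV g a : a \in M -> (g^-1)%g (g a) = a.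
Proof. by move=> aM; rewrite -galM // mulgV gal_id. Qed.

Lemma galVg g a : a \in M -> g ((g^-1)%g a) = a.
Proof. by move=> aM; rewrite -galM // mulVg gal_id. Qed.

Lemma vconj_subproof x g :
  valuation_ring M [pred a | (a \in M) && ((g^-1)%g a \in vring x)].
Proof.
split=> [a /andP[] //||a aM a0].
  split=> [|a b|a b]; rewrite !inE ?rpred1 ?rmorph1 ?rpred1 //.
    by move=> /andP[aM ax] /andP[bM bx]; rewrite rmorphB !rpredB.
  by move=> /andP[aM ax] /andP[bM bx]; rewrite rmorphM !rpredM.
rewrite !inE rpredV aM /= fmorphV.
by apply: vring_total; rewrite ?memv_gal // fmorph_eq0.
Qed.

(** A right action, because products in [gal_of M] compose from left to right; this is why right
    cosets of the decomposition group appear below. *)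
Definition vconj x g : valuation M := Valuation (vconj_subproof x g).

Lemma vconjE x g a : (a \in vring (vconj x g)) = (a \in M) && ((g^-1)%g a \in vring x).
Proof. by []. Qed.

Lemma vconj_gal x g a : a \in M -> (g a \in vring (vconj x g)) = (a \in vring x).
Proof. by move=> aM; rewrite vconjE memv_gal // galgV. Qed.

Lemma vconj_max x g a : a \in M -> (g a \in vmaxid (vconj x g)) = (a \in vmaxid x).
Proof. by move=> aM; rewrite !vmaxid_def -fmorphV fmorph_eq0 !vconj_gal ?rpredV. Qed.

Lemma vconj1 x : vconj x 1%g = x.
Proof.
apply: valuation_inj => a; rewrite vconjE invg1 gal_id.
by case: (boolP (a \in M)) => //= aM; apply/esym/negP => /vring_sub; apply/negP.
Qed.

Lemma vconjM x g h : vconj x (g * h)%g = vconj (vconj x g) h.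
Proof.
apply: valuation_inj => a; rewrite !vconjE.
by case: (boolP (a \in M)) => //= aM; rewrite memv_gal // invMg galM.
Qed.

Lemma vconjK x g : vconj (vconj x g) g^-1%g = x.
Proof. by rewrite -vconjM mulgV vconj1. Qed.

Lemma vconjKV x g : vconj (vconj x g^-1%g) g = x.
Proof. by rewrite -vconjM mulVg vconj1. Qed.

Lemma vconj_extends x g K (v : valuation K) : g \in 'Gal(M / K)%g ->
  extends x v -> extends (vconj x g) v.
Proof.
move=> gG [sKM h]; split=> // a; rewrite h vconjE.
case: (boolP (a \in K)) => //= aK; rewrite (subvP sKM _ aK).
by rewrite (fixed_gal sKM _ aK) // groupV.
Qed.

Lemma decomp_groupE x K g :
  (g \in decomp_group x K) = (g \in 'Gal(M / K)%g) && (vconj x g == x).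
Proof.
rewrite inE; congr (_ && _); apply/asboolP/eqP => [h|h].
  apply: valuation_inj => a; rewrite vconjE; apply/andP/idP => [[aM ga]|ax].
    have : (g @` [set` vring x])%classic a by exists ((g^-1)%g a) => //; rewrite galVg.
    by rewrite h.
  have : (g @` [set` vring x])%classic a by rewrite h.
  by move=> [b bx <-]; have bM := vring_sub bx; rewrite memv_gal // galgV.
apply/seteqP; split=> [_ [a ax <-]|a ax] /=.
  by have := vconj_gal x g (vring_sub ax); rewrite h => ->.
have aM := vring_sub ax; exists ((g^-1)%g a); last by rewrite galVg.
by have := vconj_gal x g (memv_gal (g^-1)%g aM); rewrite galVg // h => /= <-.
Qed.

Lemma decomp_sub x K : decomp_group x K \subset 'Gal(M / K)%g.
Proof. by apply/fintype.subsetP => g; rewrite decomp_groupE => /andP[]. Qed.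

Lemma decomp_ring x K g a : g \in decomp_group x K -> a \in M ->
  (g a \in vring x) = (a \in vring x).
Proof.
by rewrite decomp_groupE => /andP[_ /eqP gx] aM; rewrite -{1}gx vconj_gal.
Qed.

Lemma decomp_max x K g a : g \in decomp_group x K -> a \in M ->
  (g a \in vmaxid x) = (a \in vmaxid x).
Proof.
by rewrite decomp_groupE => /andP[_ /eqP gx] aM; rewrite -{1}gx vconj_max.
Qed.

Lemma decomp_group_set x K : group_set (decomp_group x K).
Proof.
apply/group_setP; split=> [|g h]; first by rewrite decomp_groupE group1 vconj1 /=.
rewrite !decomp_groupE => /andP[gG /eqP gx] /andP[hG /eqP hx].
by rewrite groupM // vconjM gx hx /=.
Qed.
Canonical decomp_Group x K := Group (decomp_group_set x K).

Lemma inertiaP x K g :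
  reflect (g \in decomp_group x K /\
           forall a, a \in vring x -> res x (g a) = res x a)
          (g \in inertia_group x K).
Proof.
apply: (iffP idP) => [/finset.setIdP[gD /asboolP]|[gD h]] //.
by apply/finset.setIdP; split=> //; apply/asboolP.
Qed.

Lemma inertia_sub x K : inertia_group x K \subset decomp_group x K.
Proof. by apply/fintype.subsetP => g /inertiaP[]. Qed.

Lemma inertia_group_set x K : group_set (inertia_group x K).
Proof.
apply/group_setP; split=> [|g h].
  by apply/inertiaP; split=> [|a _]; rewrite ?group1 ?gal_id.
move=> /inertiaP[gD gI] /inertiaP[hD hI]; apply/inertiaP.
split=> [|a ax]; first exact: groupM.
have aM := vring_sub ax.
by rewrite galM // hI ?gI // (decomp_ring gD aM).
Qed.
Canonical inertia_Group x K := Group (inertia_group_set x K).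

End Conj.

Section Lifting.
Variables (K M : {subfield Om}) (v : valuation K) (x : valuation M).
Hypotheses (nKM : normalField K M) (xv : extends x v).
Let sKM : (K <= M)%VS := extends_sub xv.
Local Notation G := 'Gal(M / K)%g.
Local Notation D := (decomp_group x K).

(** Some [u = c ^+ n / s] with [s] in K is a unit. Then [(g c / c) ^+ n = g u / u] is a unit, and so
    is any root of it. *)
Lemma decomp_unit g c : g \in D -> c \in M -> c != 0 -> g c / c \in vunit x.
Proof.
move=> gD cM c0; have [n [s [n0 sK s0 u]]] := coset_torsion x sKM cM c0.
have gG := fintype.subsetP (decomp_sub x K) g gD.
have gc0 : g c / c != 0 by rewrite mulf_neq0 ?invr_eq0 ?fmorph_eq0.
have gcM : g c / c \in M by rewrite rpred_div ?memv_gal.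
have gun : (g c / c) ^+ n \in vunit x.
  have sM := subvP sKM _ sK.
  have -> : (g c / c) ^+ n = g (c ^+ n / s) / (c ^+ n / s).
    rewrite galr_mul galr_inv (fixed_gal sKM gG sK) galr_exp expr_div_n.
    by rewrite invf_div mulrA divfK.
  have usM := vunit_sub u.
  rewrite vunitM ?vunitV // vunitE fmorph_eq0 -fmorphV !(decomp_ring gD) ?rpredV //.
have root y : y \in M -> y ^+ n \in vunit x -> y \in vring x.
  move=> yM u'; apply: contraT => yx; have := vmaxidVN yM yx.
  move=> /(vmaxidX n0); rewrite exprVn => ym.
  by move: u'; rewrite -vunitV => /vunit_max; rewrite ym.
by rewrite vunitE gc0 !root ?rpredV // exprVn vunitV.
Qed.

Lemma valuation_conjugate (u : valuation M) : extends u v ->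
  exists2 g, g \in G & u = vconj x g.
Proof.
move=> uv; apply: contrapT => nconj.
pose us := [seq vconj x g | g <- enum G].
have usv u' : u' \in us -> extends u' v.
  by move=> /mapP[g]; rewrite mem_enum => gG ->; apply: vconj_extends.
(* The orbits of [u] and [x] are assumed disjoint, so some [e] is congruent to 1 at the conjugate of
   [u] by [h] and to 0 at all conjugates of [x]. *)
have ex h : exists e, h \in G -> [/\ forall u' : valuation M, extends u' v -> e \in vring u',
    e - 1 \in vmaxid (vconj u h) & forall g, g \in G -> e \in vmaxid (vconj x g)].
  have [hG|hG] := boolP (h \in G); last by exists 0.
  have uhus : vconj u h \notin us.
    apply/negP => /mapP[g]; rewrite mem_enum => gG e; case: nconj.
    by exists (g * h^-1)%g; rewrite ?groupM ?groupV // vconjM -e vconjK.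
  have [e [eO e1 eus]] := valuation_approx (vconj_extends hG uv) usv uhus (rpred1 _).
  by exists e => _; split=> // g gG; apply: eus; apply/mapP; exists g; rewrite ?mem_enum.
have [e eP] := choice ex.
(* Congruent to 1 at every conjugate of [u], where one factor vanishes, and to 0 at every conjugate
   of [x], where all factors are congruent to 1. *)
pose a := 1 - \prod_(h in G) (1 - e h).
have aO (u' : valuation M) : extends u' v -> a \in vring u'.
  move=> u'v; rewrite rpredB ?rpred1 // rpred_prod // => h hG.
  by have [eO _ _] := eP _ hG; apply: rpredB; rewrite ?rpred1 ?eO.
have aM : a \in M by rewrite (vring_sub (aO _ xv)).
have au h : h \in G -> a - 1 \in vmaxid (vconj u h).
  move=> hG; rewrite addrAC subrr add0r vmaxidN; apply: (vmaxid_prod (i := h)) => //.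
    move=> h' h'G; have [eO _ _] := eP _ h'G.
    by rewrite rpredB ?rpred1 ?eO //; apply: vconj_extends.
  by have [_ e1 _] := eP _ hG; rewrite -vmaxidN opprB.
have ax g : g \in G -> a \in vmaxid (vconj x g).
  move=> gG; rewrite -vmaxidN opprB; apply: vmaxid_eq1_prod => h hG.
  by have [_ _ em] := eP _ hG; rewrite addrAC subrr add0r vmaxidN em.
pose N := galNorm K M a.
have NG : N \in fixedField G by apply: galNorm_fixedField.
(* The norm lies in K only after a [q]-th power. This power is in the maximal ideal at [x], hence at
   [u], where it is also congruent to 1. *)
have [q qn Nq] := expr_fixed sKM nKM NG.
have q0 : (0 < q)%N by case/andP: qn.
have Nx : N \in vmaxid x.
  apply: (vmaxid_prod (i := 1%g)) => [g gG||]; rewrite ?gal_id //.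
    rewrite -(vconjKV x g) vconj_gal // vmaxidW // ax ?groupV //.
  by rewrite -(vconj1 x) ax.
have Nu : N - 1 \in vmaxid u.
  apply: vmaxid_eq1_prod => g gG.
  have a1M : a - 1 \in M by rewrite rpredB ?rpred1.
  have := au g^-1%g; rewrite groupV -(vconj_max (vconj u g^-1%g) g a1M) vconjKV.
  by rewrite galr_sub galr_one; apply.
have : N ^+ q \in vmaxid u.
  by rewrite -(extends_max uv Nq) (extends_max xv Nq) vmaxidX.
move/res_max => /eqP; rewrite resX ?(vmaxid_eq1_ring Nu) //.
by move/res_eq1P: Nu => ->; rewrite expr1n oner_eq0.
Qed.

(** Vanishing at the other conjugates of [x] lets sums and products over the whole Galois group
    reduce, in the residue field, to contributions of D. *)
Lemma decomp_lift a : a \in vring x ->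
  exists b, [/\ forall u : valuation M, extends u v -> b \in vring u,
    b - a \in vmaxid x & forall g, g \in G -> g \notin D -> g b \in vmaxid x].
Proof.
move=> ax; pose us := [seq vconj x g | g <- enum G & vconj x g != x].
have usv u : u \in us -> extends u v.
  by move=> /mapP[g]; rewrite mem_filter mem_enum => /andP[_ gG] ->; apply: vconj_extends.
have xus : x \notin us.
  by apply/negP => /mapP[g]; rewrite mem_filter => /andP[/eqP] /[swap] _ /[swap] <-.
have [b [bO bx bus]] := valuation_approx xv usv xus ax.
exists b; split=> // g gG gD; have bM := vring_sub (bO _ xv).
rewrite -(vconjKV x g) vconj_max // bus //; apply/mapP; exists g^-1%g => //.
rewrite mem_filter mem_enum groupV gG andbT.
apply: contraNneq gD => e; rewrite decomp_groupE gG /=.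
by rewrite -{2}(vconjKV x g) e.
Qed.

End Lifting.

End Conjugates.

(** * Number of extensions *)

Lemma fset_set_param (T : choiceType) (I : finType) (A : {pred I}) (f : I -> T)
    (S : set T) :
  (forall i, i \in A -> S (f i)) -> (forall t, S t -> exists2 i, i \in A & t = f i) ->
  fset_set S = [fset f i | i in A]%fset.
Proof.
move=> fS Sf; have SE : S = (f @` [set` A])%classic.
  by apply/seteqP; split=> [t /Sf[i iA ->]|_ [i iA <-]]; [exists i|apply: fS].
have finS : finite_set S by rewrite SE; apply: finite_image; apply: finite_finset.
apply/fsetP => t; rewrite in_fset_set //; apply/idP/imfsetP => /=.
  by rewrite inE => /Sf[i iA ->]; exists i.
by move=> [i iA ->]; rewrite inE; apply: fS.
Qed.

Lemma card_fset_set_param (T : choiceType) (I : finType) (A : {pred I}) (f : I -> T)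
    (S : set T) :
  (forall i, i \in A -> S (f i)) -> (forall t, S t -> exists2 i, i \in A & t = f i) ->
  {in A &, injective f} -> #|` fset_set S| = #|A|.
Proof. by move=> fS Sf finj; rewrite (fset_set_param fS Sf) card_in_imfset //= cardE. Qed.

Section Counting.
Variables (F : fieldType) (Om : splittingFieldType F).
Implicit Types K L M N : {subfield Om}.

Section Orbit.
Variables (K M : {subfield Om}) (v : valuation K) (x : valuation M).
Hypotheses (nKM : normalField K M) (xv : extends x v).
Local Notation G := 'Gal(M / K)%g.
Local Notation D := (decomp_group x K).

Lemma orbit_repr g : g \in G -> exists2 d, d \in D & repr (D :* g)%g = (d * g)%g.
Proof.
move=> gG; have := mem_repr_rcoset (decomp_Group x K) g.
by case/rcosetP => d dD ->; exists d.
Qed.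

Lemma orbit_extends A : A \in rcosets D G -> extends (vconj x (repr A)) v.
Proof.
move=> /rcosetsP[g gG ->]; apply: vconj_extends => //.
have [d dD ->] := orbit_repr gG.
by rewrite groupM // (fintype.subsetP (decomp_sub x K)).
Qed.

Lemma orbit_mem A : A \in rcosets D G -> repr A \in G.
Proof.
move=> /rcosetsP[g gG ->]; have [d dD ->] := orbit_repr gG.
by rewrite groupM // (fintype.subsetP (decomp_sub x K)).
Qed.

Lemma orbit_surj u : extends u v -> exists2 A, A \in rcosets D G & u = vconj x (repr A).
Proof.
move=> uv; have [g gG ->] := valuation_conjugate nKM xv uv.
exists (D :* g)%g; first by apply/rcosetsP; exists g.
have [d] := orbit_repr gG; rewrite decomp_groupE.
by move=> /andP[_ /eqP dx] ->; rewrite vconjM dx.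
Qed.

Lemma orbit_inj : {in rcosets D G &, injective (fun A => vconj x (repr A))}.
Proof.
move=> A B /rcosetsP[g gG ->] /rcosetsP[h hG ->].
have [d dD ->] := orbit_repr gG; have [d' dD' ->] := orbit_repr hG.
move: (dD) (dD'); rewrite !decomp_groupE => /andP[_ /eqP dx] /andP[_ /eqP dx'].
rewrite !vconjM dx dx' => e; apply: rcoset_eqP.
rewrite mem_rcoset /= decomp_groupE groupM ?groupV //=.
by rewrite vconjM e vconjK.
Qed.

Lemma num_ext_index : num_ext M v = #|G : D|%g.
Proof.
exact: (card_fset_set_param (A := mem (rcosets D G)) orbit_extends orbit_surj orbit_inj).
Qed.

End Orbit.

End Counting.

(** * Existence of extensions of a valuation *)

Section Chevalley.
Variables (F : fieldType) (Om : fieldExtType F) (K : {subfield Om}) (v : valuation K).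
Implicit Types (A B : set Om) (a b c : Om).

Definition lies_over A : Prop :=
  [/\ forall a b, A a -> A b -> A (a - b), forall a b, A a -> A b -> A (a * b),
      forall a, a \in vring v -> A a & forall a, a \in K -> A a -> a \in vring v].

Lemma lies_over_max : exists2 A, lies_over A &
  forall B, lies_over B -> (A `<=` B)%classic -> (B `<=` A)%classic.
Proof.
have base : lies_over [set` vring v]%classic.
  split=> [a b /= aO bO|a b /= aO bO|//|//]; first by rewrite rpredB.
  by rewrite rpredM.
have [|A [PA Amax]] := @Zorn_bigcup Om [set A | A = set0 \/ lies_over A]%classic.
  move=> C sC totC.
  have [[A0 [CA0 A00]]|noA] := pselect (exists A, C A /\ A <> set0); last first.
    left; apply/seteqP; split=> // a [A CA Aa]; case: noA; exists A; split=> //.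
    by move=> A0; rewrite A0 in Aa.
  right; have good A a : C A -> A a -> lies_over A.
    by move=> CA Aa; case: (sC _ CA) => // A0'; rewrite A0' in Aa.
  have [a0 A0a0] : exists a, A0 a by apply/set0P/eqP.
  have two a b : (\bigcup_(X in C) X)%classic a -> (\bigcup_(X in C) X)%classic b ->
      exists A, [/\ C A, lies_over A, A a & A b].
    move=> [A CA Aa] [B CB Bb]; have [sAB|sBA] := totC _ _ CA CB.
      by exists B; split=> //; [apply: good Bb|apply: sAB].
    by exists A; split=> //; [apply: good Aa|apply: sBA].
  split=> [a b Ua Ub|a b Ua Ub|a av|a aK [A CA Aa]].
  - have [A [CA [h _ _ _] Aa Ab]] := two _ _ Ua Ub.
    by exists A => //; apply: h.
  - have [A [CA [_ h _ _] Aa Ab]] := two _ _ Ua Ub.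
    by exists A => //; apply: h.
  - by have [_ _ h _] := good _ _ CA0 A0a0; exists A0 => //; apply: h.
  - by have [_ _ _ h] := good _ _ CA Aa; apply: h.
have A0 : A <> set0.
  move=> A0; apply: (Amax [set` vring v]%classic); last by right.
  rewrite A0; split=> [a //|h]; have := h 1; rewrite /= rpred1 => /(_ isT) [].
case: PA => // PA; exists A => // B PB sAB; apply: contrapT => nBA.
by apply: (Amax B); [split|right].
Qed.

Section Maximal.
Variable A : set Om.
Hypothesis lA : lies_over A.
Hypothesis Amax : forall B, lies_over B -> (A `<=` B)%classic -> (B `<=` A)%classic.

Let AB a b : A a -> A b -> A (a - b). Proof. by case: lA => h _ _ _; apply: h. Qed.
Let AM a b : A a -> A b -> A (a * b). Proof. by case: lA => _ h _ _; apply: h. Qed.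
Let AO a : a \in vring v -> A a. Proof. by case: lA => _ _ h _; apply: h. Qed.
Let AK a : a \in K -> A a -> a \in vring v. Proof. by case: lA => _ _ _ h; apply: h. Qed.
Let A1 : A 1. Proof. by apply: AO; rewrite rpred1. Qed.
Let A0 : A 0. Proof. by apply: AO; rewrite rpred0. Qed.
Let AD a b : A a -> A b -> A (a + b).
Proof. by move=> Aa Ab; rewrite -[b]opprK -[- b]add0r; apply: AB => //; apply: AB. Qed.
Let AX a n : A a -> A (a ^+ n).
Proof. by move=> Aa; elim: n => [|n IHn]; rewrite ?expr0 // exprS; apply: AM. Qed.
Let Asum n (f : 'I_n -> Om) : (forall i, A (f i)) -> A (\sum_i f i).
Proof. by move=> h; elim/big_ind : _ => // a b; apply: AD. Qed.

(** The ideal of A generated by the maximal ideal of [v]. Single products are enough, because of two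
    elements of a valuation ring one divides the other. *)
Let mA a := exists b c, [/\ b \in vmaxid v, A c & a = b * c].

Let mA_A a : mA a -> A a.
Proof. by move=> [b [c [bm Ac ->]]]; apply: AM => //; apply: AO; apply: vmaxidW. Qed.

Let mA_M a b : A a -> mA b -> mA (a * b).
Proof.
by move=> Aa [c [d [cm Ad ->]]]; exists c, (a * d); split=> //; [apply: AM|rewrite mulrCA].
Qed.

Let mA_D a b : mA a -> mA b -> mA (a + b).
Proof.
move=> [c [d [cm Ad ->]]] [c' [d' [cm' Ad' ->]]].
have [c0|c0] := eqVneq c 0; first by exists c', d'; rewrite c0 mul0r add0r.
have [c'0|c'0] := eqVneq c' 0; first by exists c, d; rewrite c'0 mul0r addr0.
have ccK : c / c' \in K by rewrite rpred_div // (vmaxid_sub cm, vmaxid_sub cm').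
have /orP[h|h] := vring_total v ccK (mulf_neq0 c0 (invr_neq0 c'0)).
  exists c', (c / c' * d + d'); split=> //; first by apply: AD => //; apply: AM => //; apply: AO.
  by rewrite mulrDr !mulrA [c' * c]mulrC mulfK.
rewrite invf_div in h.
exists c, (d + c' / c * d'); split=> //; first by apply: AD => //; apply: AM => //; apply: AO.
by rewrite mulrDr !mulrA [c * c']mulrC mulfK.
Qed.

Let mA_0 : mA 0. Proof. by exists 0, 0; rewrite vmaxid0 mulr0. Qed.

Let mA_sum n (f : 'I_n -> Om) : (forall i, mA (f i)) -> mA (\sum_i f i).
Proof. by move=> h; elim/big_ind : _ => // a b; apply: mA_D. Qed.

(** A product [b * c = 1] would put [b^-1] in A and in K but outside the ring of [v], against the
    condition on the intersection of A with K. *)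
Let mA_1 : ~ mA 1.
Proof.
move=> [b [c [bm Ac e]]]; have b0 : b != 0.
  by apply/eqP => b0; move/eqP: e; rewrite b0 mul0r oner_eq0.
have cE : c = b^-1 by apply: (mulfI b0); rewrite -e divff.
have := AK (_ : c \in K) Ac; rewrite cE rpredV (vmaxid_sub bm) => /(_ isT).
by move: bm; rewrite vmaxid_def (negPf b0) => /andP[_ /negPf ->].
Qed.

(** By maximality A[a] contains some [k] of K outside the ring of [v]. Dividing its expression by
    [k] moves the coefficients into the ideal, as [k^-1] is in the maximal ideal of [v]. *)
Let adjoin_rel a : ~ A a -> exists p : {poly Om}, (forall i, mA p`_i) /\ p.[a] = 1.
Proof.
move=> Aa; pose B : set Om := [set b | exists p : {poly Om}, (forall i, A p`_i) /\ p.[a] = b]%classic.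
have sAB : (A `<=` B)%classic.
  move=> b Ab; exists b%:P; split=> [i|]; last by rewrite hornerC.
  by rewrite coefC; case: eqP.
have Ba : B a.
  by exists 'X; split=> [i|]; rewrite ?hornerX // coefX; case: eqP.
have nB : ~ lies_over B by move=> lB; apply: Aa; apply: (Amax lB).
have [k [kK [[p [pA pk]] kv]]] : exists k, k \in K /\ B k /\ k \notin vring v.
  apply: contrapT => h; apply: nB; split.
  - move=> _ _ [p [pA <-]] [q [qA <-]]; exists (p - q).
    by split=> [i|]; rewrite ?hornerE // coefB; apply: AB.
  - move=> _ _ [p [pA <-]] [q [qA <-]]; exists (p * q).
    by split=> [i|]; rewrite ?hornerM // coefM; apply: Asum => j; apply: AM.
  - by move=> b /AO/sAB.
  - by move=> b bK Bb; apply: contraT => bv; case: h; exists b.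
have k0 : k != 0 by apply: contraNneq kv => ->; rewrite rpred0.
exists (k^-1 *: p); split=> [i|]; last by rewrite hornerZ pk mulVf.
by rewrite coefZ; exists k^-1, p`_i; split=> //; apply: vmaxidVN.
Qed.

(** This stands in for locality of A. Otherwise the relation for [(1 - a)^-1], multiplied by a power
    of [1 - a], puts that power into the ideal, although it is congruent to 1. *)
Let unit1 a : mA a -> A (1 - a)^-1.
Proof.
move=> ma; apply: contrapT => /adjoin_rel[p [pm p1]].
have u0 : 1 - a != 0.
  by apply/eqP => /eqP; rewrite subr_eq0 => /eqP a1; apply: mA_1; rewrite a1.
have un n : mA (1 - (1 - a) ^+ n).
  elim: n => [|n IHn]; first by rewrite expr0 subrr.
  have -> : 1 - (1 - a) ^+ n.+1 = (1 - (1 - a) ^+ n) + (1 - a) ^+ n * a.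
    by rewrite exprSr mulrBr mulr1 opprB addrA addrAC.
  by apply: mA_D => //; apply: mA_M => //; apply: AX; apply: AB => //; apply: mA_A.
apply: mA_1; rewrite -(subrK ((1 - a) ^+ (size p)) 1); apply: mA_D; first exact: un.
have -> : (1 - a) ^+ size p = \sum_(i < size p) (1 - a) ^+ (size p - i) * p`_i.
  rewrite -[LHS]mulr1 -[X in _ * X = _]p1 horner_coef mulr_sumr; apply: eq_bigr => i _.
  have ip : (i <= size p)%N by rewrite ltnW.
  have -> : (1 - a) ^+ size p = (1 - a) ^+ (size p - i) * (1 - a) ^+ i.
    by rewrite -exprD subnK.
  by rewrite exprVn -mulrA [X in _ * X]mulrC divfK ?expf_neq0.
apply: mA_sum => i; apply: mA_M => //; apply: AX; apply: AB => //; exact: mA_A.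
Qed.

Let no_pair N a (p q : {poly Om}) : (size p + size q <= N)%N -> a != 0 ->
  (forall i, mA p`_i) -> (forall i, mA q`_i) -> p.[a] = 1 -> q.[a^-1] = 1 -> False.
Proof.
elim: N a p q => [|N IHN] a p q sN a0 pm qm p1 q1.
  move: sN; rewrite leqn0 addn_eq0 size_poly_eq0 => /andP[/eqP p0 _].
  by move/eqP: p1; rewrite p0 horner0 eq_sym oner_eq0.
wlog spq : a p q sN a0 pm qm p1 q1 / (size q <= size p)%N.
  move=> IH; have /orP[h|h] := leq_total (size q) (size p); first exact: (IH a p q).
  by apply: (IH a^-1 q p); rewrite ?invrK ?invr_eq0 // addnC.
have [sp|sp] := leqP (size p) 1.
  by move: p1; rewrite (size1_polyC sp) hornerC => p1; apply: mA_1; rewrite -p1.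
set n := (size p).-1; have spE : size p = n.+1 by rewrite prednK // ltnW.
have n0 : (0 < n)%N by rewrite -ltnS -spE.
pose r := drop_poly 1 q; pose u := (1 - q`_0)^-1.
have u0 : 1 - q`_0 != 0.
  apply/eqP => /eqP; rewrite subr_eq0 => /eqP e; apply: mA_1; rewrite e; exact: qm.
have Au : A u by apply: unit1.
have ra : a = u * r.[a^-1].
  have : q`_0 + r.[a^-1] / a = 1.
    rewrite -q1 -[in RHS](poly_take_drop 1 q) hornerD hornerM hornerXn expr1; congr (_ + _).
    rewrite (_ : take_poly 1 q = (q`_0)%:P) ?hornerC //.
    by apply/polyP => -[|i]; rewrite coef_take_poly coefC.
  move=> qr; have e : 1 - q`_0 = r.[a^-1] / a.
    by apply/eqP; rewrite subr_eq addrC qr.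
  have r0 : r.[a^-1] != 0 by apply: contraNneq u0 => r0; rewrite e r0 mul0r.
  by rewrite /u e invf_div divfK.
have sr : (size r <= n)%N by rewrite size_drop_poly leq_subLR add1n -spE.
(* The second relation, solved for [a], reads [a = u * r.[a^-1]]; substituting this for one factor
   of the leading power [a ^+ n] lowers the size of [p]. *)
pose p' := \poly_(i < n) (p`_i + p`_n * u * r`_(n.-1 - i)).
have rm i : mA r`_i by rewrite coef_drop_poly.
apply: (IHN a p' q) => //.
- have := size_poly n (fun i => p`_i + p`_n * u * r`_(n.-1 - i)); rewrite -/p' => sp'.
  by rewrite -ltnS; apply: leq_trans sN; rewrite spE ltn_add2r ltnS.
- move=> i; rewrite coef_poly; case: ifP => // _; apply: mA_D => //.
  by apply: mA_M => //; apply: AM => //; apply: mA_A.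
rewrite horner_poly -p1 horner_coef spE big_ord_recr /=.
under eq_bigr do rewrite mulrDl.
rewrite big_split /=; congr (_ + _).
have an : a ^+ n = a ^+ n.-1 * (u * r.[a^-1]) by rewrite -ra -exprSr prednK.
rewrite (reindex_inj rev_ord_inj) /= an.
rewrite (horner_coef_wide _ sr) !mulr_sumr.
apply: eq_bigr => i _; have ni : (i <= n.-1)%N by rewrite -ltnS prednK.
have -> : (n - i.+1 = n.-1 - i)%N by rewrite -subn1 subnAC subn1 -subnS.
have -> : a ^+ n.-1 = a ^+ (n.-1 - i) * a ^+ i by rewrite -exprD subnK.
rewrite subKn // exprVn -!mulrA; congr (_ * _).
by rewrite (mulrA u _ (_^-1)) [X in _ = _ * X]mulrC divfK ?expf_neq0 // mulrA mulrC.
Qed.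

Lemma lies_over_valuation a : A a \/ A a^-1.
Proof.
apply: contrapT => /not_orP[na nV].
have a0 : a != 0 by apply/eqP => a0; apply: na; rewrite a0.
have [p [pm p1]] := adjoin_rel na; have [q [qm q1]] := adjoin_rel nV.
exact: (@no_pair _ a p q (leqnn _)).
Qed.

End Maximal.

(* A maximal subring of Om lying over the valuation ring of v is a valuation
   ring: if neither a nor its inverse belongs to it, then both satisfy relations
   with constant term 1 modulo the extended maximal ideal, and each of them
   shortens the other. *)
Lemma extension_exists : exists w : valuation {:Om}%AS, extends w v.
Proof.
have [A lA Amax] := lies_over_max.
pose O a : bool := `[< A a >].
have [AB AM AO AK] := lA.
have vO : valuation_ring {:Om}%AS O.
  split=> [a _||a _ _]; first exact: memvf.
    split=> [|a b|a b]; rewrite ?unfold_in.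
    - by apply/asboolP/AO; rewrite rpred1.
    - by move=> /asboolP Aa /asboolP Ab; apply/asboolP/AB.
    - by move=> /asboolP Aa /asboolP Ab; apply/asboolP/AM.
  by apply/orP; have [h|h] := lies_over_valuation lA Amax a; [left|right]; apply/asboolP.
exists (Valuation vO); split=> [|a]; first exact: subvf.
apply/idP/andP => [av|[aK /asboolP]]; last exact: AK.
by split; [apply: vring_sub av|apply/asboolP/AO].
Qed.

End Chevalley.

(** * Extensions in towers and independence of the auxiliary field *)

Section Tower.
Variables (F : fieldType) (Om : splittingFieldType F).
Implicit Types K L M N : {subfield Om}.
Local Notation T := {:Om}%AS.

Lemma gal_lift K N (g : gal_of N) : (K <= N)%VS -> g \in 'Gal(N / K)%g ->
  exists2 h, h \in 'Gal(T / K)%g & {in N, g =1 h}.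
Proof.
move=> sKN gG; have sK : (K <= N <= T)%VS by rewrite sKN subvf.
have [|h hG hE] := @kHom_to_gal _ _ K N T g sK (normalFieldf K); last by exists h.
by rewrite -gal_kHom.
Qed.

Lemma extends_vconj N (u : valuation N) (z : valuation T) (g : gal_of N) (h : gal_of T) :
  {in N, g =1 h} -> extends z u -> extends (vconj z h) (vconj u g).
Proof.
move=> gh [sN zu]; split=> // a; rewrite !vconjE memvf /=.
case: (boolP (a \in N)) => //= aN; rewrite zu memv_gal //=.
by rewrite (_ : (g^-1)%g a = (h^-1)%g a) // -[in RHS](galVg g aN) gh ?memv_gal // galgV ?memvf.
Qed.

Lemma extends_inj K N (u u' : valuation K) (w : valuation N) :
  extends w u -> extends w u' -> u = u'.
Proof. by move=> [_ h] [_ h']; apply: valuation_inj => a; rewrite h h'. Qed.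

(* An extension of v to Om is a translate of an extension of u, determined by
   its restriction to N. *)
Lemma num_ext_tower K N (v : valuation K) (u : valuation N) : normalField K N ->
  extends u v -> num_ext T v = (num_ext N v * num_ext T u)%N.
Proof.
move=> nKN uv; have sKN := extends_sub uv.
have [y yu] := extension_exists u.
have nN := normalFieldf N.
rewrite (num_ext_index nKN uv) (num_ext_index nN yu) -cardsX.
have lift g : exists h, g \in 'Gal(N / K)%g -> h \in 'Gal(T / K)%g /\ {in N, g =1 h}.
  have [gG|gG] := boolP (g \in 'Gal(N / K)%g); last by exists 1%g.
  by have [h hG gh] := gal_lift sKN gG; exists h.
have [l lP] := choice lift.
pose f (p : {set gal_of N} * {set gal_of T}) :=
  vconj (vconj y (repr p.2)) (l (repr p.1)).
apply: (card_fset_set_param (f := f)) => [[A B]|t tv|[A B] [A' B']].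
- move=> /setXP[hA hB]; apply: vconj_extends; first by case: (lP _ (orbit_mem hA)).
  exact: extends_trans (orbit_extends yu hB) uv.
- have tu : extends (restrict (subvf N) t) v.
    exact: extends_restrict tv (restrict_extends _ _) sKN.
  have [A hA tA] := orbit_surj nKN uv tu.
  have [lG lE] := lP _ (orbit_mem hA).
  (* Undoing the lift of the automorphism that carries [u] to the restriction of [t] leaves an
     extension of [u]. *)
  have t'u : extends (vconj t (l (repr A))^-1%g) u.
    rewrite -(vconjK u (repr A)); apply: extends_vconj.
      move=> a aN; have aT : a \in T by apply: memvf.
      by rewrite -[a in RHS](galVg (repr A) aN) lE ?memv_gal // galgV ?memvf.
    by rewrite -tA; apply: restrict_extends.
  have [B hB tB] := orbit_surj nN yu t'u.
  exists (A, B); first by apply/setXP.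
  by rewrite /f /= -tB vconjKV.
move=> /setXP[/= hA hB] /setXP[/= hA' hB'] e.
have [lG lE] := lP _ (orbit_mem hA); have [lG' lE'] := lP _ (orbit_mem hA').
have AA : A = A'.
  apply: (orbit_inj hA hA').
  apply: (@extends_inj _ _ _ _ (f (A, B))).
    by apply: extends_vconj => //; apply: (orbit_extends yu).
  by rewrite e; apply: extends_vconj => //; apply: (orbit_extends yu).
rewrite AA; congr (_, _); apply: (orbit_inj hB hB').
by move: e; rewrite /f /= AA => /(congr1 (fun z => vconj z (l (repr A'))^-1%g)); rewrite !vconjK.
Qed.

Lemma num_ext_gt0 K N (v : valuation K) (u : valuation N) : normalField K N ->
  extends u v -> (0 < num_ext N v)%N.
Proof. by move=> nKN uv; rewrite (num_ext_index nKN uv) indexg_gt0. Qed.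

(** Passing from N to Om multiplies both counts by the same factor, the number of extensions to Om
    of one valuation of N over [w]. The ratio is therefore independent of N. *)
Lemma num_ext_ratio K L N (v : valuation K) (w : valuation L) : extends w v ->
  (L <= N)%VS -> normalField K N ->
  (num_ext N w)%:R / (num_ext N v)%:R = (num_ext T w)%:R / (num_ext T v)%:R :> rat.
Proof.
move=> wv sLN nKN; have sKL := extends_sub wv.
have [y yw] := extension_exists w.
have uw : extends (restrict (subvf N) y) w.
  exact: extends_restrict yw (restrict_extends _ _) sLN.
have nLN := normalFieldS sKL nKN.
rewrite (num_ext_tower nKN (extends_trans uw wv)) (num_ext_tower nLN uw) !natrM.
have yu := restrict_extends (subvf N) y.
have := num_ext_gt0 (normalFieldf N) yu; rewrite lt0n => c0.
by rewrite invfM mulrACA divff ?mulr1 // Num.Theory.pnatr_eq0.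
Qed.

End Tower.

(** * Degrees over subsets of a field *)

Section SubfieldType.
Variable k : fieldType.

Definition subfield_set (S : set k) : Prop :=
  [/\ S 1, forall a b, S a -> S b -> S (a - b) & forall a b, S a -> S b -> S (a / b)].

Definition subfield_pred S of subfield_set S : k -> bool := fun a => `[< S a >].

Lemma subfield_pred_closed S (hS : subfield_set S) : divring_closed (subfield_pred hS).
Proof.
case: (hS) => S1 SB SD; split=> [|a b|a b]; rewrite ?unfold_in; first exact/asboolP.
  by move=> /asboolP Sa /asboolP Sb; apply/asboolP/SB.
by move=> /asboolP Sa /asboolP Sb; apply/asboolP/SD.
Qed.

HB.instance Definition _ S (hS : subfield_set S) :=
  GRing.isDivringClosed.Build k (subfield_pred hS) (subfield_pred_closed hS).

Lemma subfield_predP S (hS : subfield_set S) a : reflect (S a) (a \in subfield_pred hS).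
Proof. exact: asboolP. Qed.

Record subfield_type S (hS : subfield_set S) :=
  SubfieldElt { subfield_val : k; _ : subfield_val \in subfield_pred hS }.
HB.instance Definition _ S (hS : subfield_set S) := [isSub for @subfield_val S hS].
HB.instance Definition _ S (hS : subfield_set S) := [Choice of subfield_type hS by <:].
HB.instance Definition _ S (hS : subfield_set S) :=
  [SubChoice_isSubIntegralDomain of subfield_type hS by <:].
HB.instance Definition _ S (hS : subfield_set S) :=
  [SubIntegralDomain_isSubField of subfield_type hS by <:].

Lemma subfield_valP S (hS : subfield_set S) (a : subfield_type hS) : S (val a).
Proof. exact/subfield_predP/valP. Qed.

Lemma subfield_lift S (hS : subfield_set S) a : S a ->
  exists c : subfield_type hS, val c = a.
Proof. by move=> /(subfield_predP hS) Sa; exists (SubfieldElt Sa). Qed.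

Lemma subfield_lift_fun S (hS : subfield_set S) I (c : I -> k) : (forall i, S (c i)) ->
  exists c' : I -> subfield_type hS, forall i, val (c' i) = c i.
Proof. by move=> Sc; have [f fP] := choice (fun i => subfield_lift hS (Sc i)); exists f. Qed.

(* The rows of the matrix of b in c are independent over S. *)
Lemma is_basis_size S T n m (b : 'I_n -> k) (c : 'I_m -> k) : subfield_set S ->
  is_basis S T b -> is_basis S T c -> (n <= m)%N.
Proof.
move=> hS [bT _ bI] [_ cG _].
have ex i : exists d : 'I_m -> k, (forall j, S (d j)) /\ b i = \sum_j d j * c j.
  by have [d Sd e] := cG _ (bT i); exists d.
have [d dP] := choice ex.
have [A AE] := subfield_lift_fun hS (c := fun p : 'I_n * 'I_m => d p.1 p.2)
  (fun p => (dP p.1).1 p.2).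
pose B := \matrix_(i, j) A (i, j).
rewrite leqNgt; apply/negP => mn.
have : ~~ row_free B by rewrite /row_free ltn_eqF // (leq_ltn_trans (rank_leq_col _)).
rewrite -kermx_eq0 => /rowV0Pn[u /sub_kermxP uB u0].
case/negP: u0; apply/eqP/rowP => i; rewrite mxE; apply: val_inj; rewrite rmorph0.
apply: (bI (fun i => val (u 0 i))) => [j|]; first exact: subfield_valP.
under eq_bigr => j _ do rewrite (dP j).2 mulr_sumr.
rewrite exchange_big big1 //= => j _.
transitivity (val (\sum_l u 0 l * B l j) * c j).
  rewrite rmorph_sum mulr_suml; apply: eq_bigr => l _.
  by rewrite rmorphM /= mxE AE /= mulrA.
have := congr1 (fun C : 'rV_m => C 0 j) uB; rewrite !mxE => ->.
by rewrite rmorph0 mul0r.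
Qed.

Lemma ext_degree_basis S T n (b : 'I_n -> k) : subfield_set S ->
  is_basis S T b -> ext_degree S T = n.
Proof.
move=> hS bb; rewrite /ext_degree; case: xgetP => [m _ [c cb]|none].
  by apply/eqP; rewrite eqn_leq (is_basis_size hS cb bb) (is_basis_size hS bb cb).
by case: (none n); exists b.
Qed.

(** A free family of maximal size generates, since an element of T outside its span could be added
    to it. *)
Lemma bounded_basis S T N : subfield_set S ->
  (forall n (b : 'I_n -> k), (forall i, T (b i)) ->
     (forall c : 'I_n -> k, (forall i, S (c i)) ->
       \sum_i c i * b i = 0 -> forall i, c i = 0) -> (n <= N)%N) ->
  exists n (b : 'I_n -> k), is_basis S T b.
Proof.
move=> hS bound.
pose free n := `[< exists b : 'I_n -> k, (forall i, T (b i)) /\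
  forall c : 'I_n -> k, (forall i, S (c i)) -> \sum_i c i * b i = 0 -> forall i, c i = 0 >].
have ex : exists n, free n.
  by exists 0%N; apply/asboolP; exists (fun=> 0); split=> [[]|c _ _ []].
have ub n : free n -> (n <= N)%N by move=> /asboolP[b []]; apply: bound.
case: (ex_maxnP ex ub) => n /asboolP[b [bT bI]] nmax; exists n, b; split=> // y Ty.
have [S1 SB SD] := hS.
have S0 : S 0 by rewrite -(subrr 1); apply: SB.
have SN a : S a -> S (- a) by move=> Sa; rewrite -sub0r; apply: SB.
apply: contrapT => ny; suff : free n.+1 by move/nmax; rewrite ltnn.
apply/asboolP; exists (fun i => if unlift ord0 i is Some j then b j else y).
split=> [i|c Sc]; first by case: unliftP.
rewrite big_ord_recl /= unlift_none.
under eq_bigr => i _ do rewrite liftK.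
move=> e; have c0 : c ord0 = 0.
  apply/eqP; apply: contraT => c0; case: ny.
  exists (fun i => - c (lift ord0 i) / c ord0) => [i|]; first by apply: SD => //; apply: SN.
  apply: (mulfI c0); have /eqP := e; rewrite addr_eq0 => /eqP ->.
  rewrite mulr_sumr -sumrN; apply: eq_bigr => i _.
  by rewrite mulrA [c ord0 * _]mulrC divfK // mulNr.
move: e; rewrite c0 mul0r add0r => /bI c1 i.
by case: (unliftP ord0 i) => [j ->|->] //; apply: c1 => j'; apply: Sc.
Qed.

End SubfieldType.

Section Over.
Variables (k : fieldType) (S : set k) (hS : subfield_set S).
Variables (n : nat) (b : 'I_n -> k) (bb : is_basis S setT b).

(* An alias of k that carries the structure of a finite extension of S. *)
Definition field_over of subfield_set S & is_basis S setT b : Type := k.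
Local Notation L := (field_over hS bb).
Local Notation k0 := (subfield_type hS).

HB.instance Definition _ := GRing.Field.on L.

Definition over_scale (a : k0) (u : L) : L := val a * u.

Fact over_scaleA a c u : over_scale a (over_scale c u) = over_scale (a * c) u.
Proof. exact: mulrA. Qed.

Fact over_scale1 u : over_scale 1 u = u.
Proof. by rewrite /over_scale rmorph1 mul1r. Qed.

Fact over_scaleDr a u v : over_scale a (u + v) = over_scale a u + over_scale a v.
Proof. exact: mulrDr. Qed.

Fact over_scaleDl v a c : over_scale (a + c) v = over_scale a v + over_scale c v.
Proof. exact: mulrDl. Qed.

HB.instance Definition _ := GRing.Zmodule_isLmodule.Build _ L
  over_scaleA over_scale1 over_scaleDr over_scaleDl.

Lemma over_scaleE a (u : k) : a *: (u : L) = val a * u :> k.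
Proof. by []. Qed.

Fact over_scaleAl a u v : over_scale a (u * v) = (over_scale a u) * v.
Proof. exact: mulrA. Qed.

HB.instance Definition _ := GRing.Lmodule_isLalgebra.Build _ L over_scaleAl.

Fact over_scaleAr a u v : over_scale a (u * v) = u * (over_scale a v).
Proof. exact: mulrCA. Qed.

HB.instance Definition _ := GRing.Lalgebra_isAlgebra.Build _ L over_scaleAr.

Fact over_vectMixin : Lmodule_hasFinDim k0 L.
Proof.
have [_ bG bI] := bb.
pose r2v (v : 'rV[k0]_n) : L := \sum_i v 0 i *: (b i : L).
have r2v_lin : linear r2v.
  move=> a u v; rewrite /r2v scaler_sumr -big_split /=; apply: eq_bigr => i _.
  by rewrite scalerA -scalerDl !mxE.
pose r2vlM := GRing.isLinear.Build _ _ _ _ r2v r2v_lin.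
pose r2vL : {linear _ -> _} := HB.pack r2v r2vlM.
have v2rP x : {r : 'rV[k0]_n | x = r2v r}.
  apply: sig_eqW; have [c Sc ->] := bG x I.
  have [c' c'E] := subfield_lift_fun hS Sc.
  by exists (\row_i c' i); apply: eq_bigr => i _; rewrite mxE over_scaleE c'E.
pose v2r x := sval (v2rP x).
have v2rK : cancel v2r r2vL by rewrite /v2r => x; case: (v2rP x).
suffices r2vK : cancel r2v v2r.
  by exists n, v2r; [apply: can2_linear v2rK | exists r2v].
move=> r; have : r2vL (v2r (r2v r) - r) = 0.
  by rewrite linearB (v2rK (r2v r)) subrr.
move=> e; apply/eqP; rewrite -subr_eq0; apply/eqP/rowP => i; rewrite [RHS]mxE.
apply: val_inj; rewrite rmorph0.
by apply: (bI (fun i => val ((v2r (r2v r) - r) 0 i))) => // j; apply: subfield_valP.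
Qed.

HB.instance Definition _ := over_vectMixin.

Lemma mem1_over (a : L) : (a \in 1%VS) <-> S a.
Proof.
split=> [/vlineP[c ->]|Sa].
  by rewrite over_scaleE mulr1; apply: subfield_valP.
apply/vlineP; have [c cE] := subfield_lift hS Sa.
by exists c; rewrite over_scaleE cE mulr1.
Qed.

Lemma is_basis_vbasis (V : {vspace L}) :
  is_basis S [set` V]%classic (fun i : 'I_(\dim V) => (vbasis V)`_i : k).
Proof.
split=> [i|y yV|c Sc].
- exact/vbasis_mem/memt_nth.
- exists (fun i => val (coord (vbasis V) i (y : L))) => [i|]; first exact: subfield_valP.
  exact: (coord_vbasis yV).
have [c' c'E] := subfield_lift_fun hS Sc; move=> e i.
have /freeP/(_ c') := basis_free (vbasisP V); rewrite -c'E => -> //.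
by rewrite -[RHS]e; apply: eq_bigr => j _; rewrite -c'E.
Qed.

Lemma sep_closureP a : sep_closure S a <-> separable_element 1%AS (a : L).
Proof.
split=> [[p [pS ps pa]]|/separable_elementP[p [pS pa ps]]].
  apply/separable_elementP; exists p; split=> //.
  by apply/polyOverP => i; apply/mem1_over.
by exists p; split=> // i; apply/mem1_over/(polyOverP pS).
Qed.

End Over.

(** The separable degree of L/K as a ratio of group orders; the next lemma is the form applied to
    residue fields. *)
Lemma dim_sep_subfield (F : fieldType) (Om : splittingFieldType F)
    (K L M : {subfield Om}) : (K <= L)%VS -> (L <= M)%VS -> normalField K M ->
  (\dim_K (sep_subfield K L) * #|'Gal(M / L)%g|)%N = #|'Gal(M / K)%g|.
Proof.
move=> sKL sLM nKM; have sKM := subv_trans sKL sLM.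
rewrite -(sep_fixed_gal_sub sKL sLM nKM) (dim_sep_fixed sKM nKM) ?galS //=.
by rewrite mulnC Lagrange ?galS.
Qed.

Lemma dim_sep_subfield1 (F : fieldType) (L : splittingFieldType F) (E : {subfield L}) :
  (\dim (sep_subfield 1%AS E) * #|'Gal({:L} / E)%g|)%N = #|'Gal({:L} / 1%AS)%g|.
Proof.
by rewrite -(dim_sep_subfield (sub1v E) (subvf E) (normalFieldf 1%AS)) dimv1 divn1.
Qed.

Section Degrees.
Variables (k : fieldType).
Implicit Types S T U : set k.

Lemma is_basis_prod S T U m n (b : 'I_m -> k) (c : 'I_n -> k) :
  (forall a, S a -> T a) -> subfield_set T -> (forall a d, T a -> U d -> U (a * d)) ->
  is_basis S T b -> is_basis T U c ->
  is_basis S U (fun i : 'I_#|{: 'I_m * 'I_n}| => b (enum_val i).1 * c (enum_val i).2).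
Proof.
move=> ST [T1 TB TD] TU [bT bG bI] [cU cG cI].
have T0 : T 0 by rewrite -(subrr 1); apply: (TB).
have TAdd a d : T a -> T d -> T (a + d).
  by move=> Ta Td; rewrite -[d]opprK -[- d]sub0r; apply: (TB) => //; apply: (TB).
have TM a d : T a -> T d -> T (a * d).
  move=> Ta Td; have [->|d0] := eqVneq d 0; first by rewrite mulr0.
  by rewrite -[d]invrK -[d^-1]mul1r; apply: (TD) => //; apply: (TD).
have sum_enum (f : 'I_m * 'I_n -> k) :
    \sum_(i < #|{: 'I_m * 'I_n}|) f (enum_val i) = \sum_j \sum_i f (i, j).
  rewrite exchange_big pair_big /= -(big_enum_val (A := {: 'I_m * 'I_n}) f).
  by apply: eq_big => [|[]].
split=> [i|y Uy|d Sd].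
- exact: TU.
- have [d Td ->] := cG _ Uy.
  have ex j : exists e : 'I_m -> k, (forall i, S (e i)) /\ d j = \sum_i e i * b i.
    by have [e Se ->] := bG _ (Td j); exists e.
  have [e eP] := choice ex.
  exists (fun i => e (enum_val i).2 (enum_val i).1) => [i|]; first by case: (eP (enum_val i).2).
  rewrite (sum_enum (fun p => e p.2 p.1 * (b p.1 * c p.2))); apply: eq_bigr => j _.
  by rewrite (eP j).2 mulr_suml; apply: eq_bigr => i _ /=; rewrite mulrA.
move=> e0 i.
pose d' p := d (enum_rank p).
have dE j : d j = d' (enum_val j) by rewrite /d' enum_valK.
have e1 : \sum_j (\sum_i d' (i, j) * b i) * c j = 0.
  rewrite -[RHS]e0.
  under [RHS]eq_bigr => j _ do rewrite dE.
  rewrite (sum_enum (fun p => d' p * (b p.1 * c p.2))); apply: eq_bigr => j _.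
  by rewrite mulr_suml; apply: eq_bigr => l _; rewrite mulrA.
have e2 j : \sum_i d' (i, j) * b i = 0.
  apply: (cI (fun j => \sum_i d' (i, j) * b i)) => // j'.
  apply: big_rec => // l a _ Ta; apply: TAdd => //; apply: TM => //; apply: ST; exact: Sd.
have e3 j := bI (fun i => d' (i, j)) (fun i => Sd _) (e2 j).
by rewrite dE; case: (enum_val i) => i' j'; apply: e3.
Qed.

Variables (S : set k) (hS : subfield_set S) (n : nat) (b : 'I_n -> k).
Hypothesis bb : is_basis S setT b.
Local Notation L := (field_over hS bb).

Let Sep : {subfield L} := <<1; separable_generator 1%AS {:L}>>%AS.

Lemma mem_Sep (a : L) : (a \in Sep) <-> sep_closure S a.
Proof.
rewrite (sep_closureP hS bb); split=> [aS|aK].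
  have := separable_generatorP {:L} 1%AS; rewrite adjoin_separable_eq.
  by move/separableP/(_ _ aS).
rewrite -separable_inseparable_element.
have /purely_inseparableP-> := separable_generator_maximal {:L} 1%AS; rewrite ?memvf //.
by rewrite (separable_elementS _ aK) // subv_adjoin.
Qed.

Lemma sep_closure_subfield : subfield_set (sep_closure S).
Proof.
split=> [|a c /mem_Sep aS /mem_Sep cS|a c /mem_Sep aS /mem_Sep cS]; apply/mem_Sep.
- exact: (rpred1 Sep).
- exact: (rpredB aS cS).
- exact: (rpred_div aS cS).
Qed.

Lemma sub_sep_closure a : S a -> sep_closure S a.
Proof.
move=> Sa; apply/mem_Sep; have h : (a : L) \in 1%VS by apply/mem1_over.
exact: (subvP (subv_adjoin 1%AS _) _ h).
Qed.

Lemma free_over_size m (c : 'I_m -> k) : (forall d : 'I_m -> k, (forall i, S (d i)) ->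
     \sum_i d i * c i = 0 -> forall i, d i = 0) -> (m <= \dim {:L})%N.
Proof.
move=> cI; pose X : m.-tuple L := [tuple c i | i < m].
have Xf : free X.
  apply/freeP => d e i; apply: val_inj; rewrite rmorph0.
  apply: (cI (fun i => val (d i))) => [j|]; first exact: subfield_valP.
  by rewrite -[RHS]e; apply: eq_bigr => j _; rewrite -tnth_nth tnth_mktuple.
have := dimvS (subvf <<X>>); rewrite (eqP Xf) size_tuple //.
Qed.

Lemma ext_degree_sep_insep :
  ext_degree S setT = (sep_degree S * insep_degree S)%N /\ (0 < ext_degree S setT)%N.
Proof.
have hT := sep_closure_subfield.
have [m [c cb]] : exists m (c : 'I_m -> k), is_basis (sep_closure S) setT c.
  apply: (bounded_basis (N := \dim {:L}) hT) => m c _ cI; apply: free_over_size => d Sd.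
  by apply: cI => i; apply: sub_sep_closure.
have sepE := is_basis_vbasis (hS := hS) (bb := bb) Sep.
have sT : [set` Sep]%classic = sep_closure S.
  by apply/seteqP; split=> a; [move/mem_Sep|move=> h; apply/mem_Sep].
rewrite sT in sepE.
have pb := is_basis_prod sub_sep_closure hT (fun _ _ _ _ => I) sepE cb.
rewrite (ext_degree_basis hS pb) /sep_degree /insep_degree.
rewrite (ext_degree_basis hS sepE) (ext_degree_basis hT cb) card_prod !card_ord.
split=> //; rewrite muln_gt0 adim_gt0 /= lt0n; apply/eqP => m0.
(* An empty family cannot generate 1, so the inseparable degree is not 0. *)
have [_ cG _] := cb; have [d _ e] := cG 1 I.
suff /eqP : (1 : k) = 0 by rewrite oner_eq0.
by rewrite e big1 // => i; have := ltn_ord i; rewrite {2}m0.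
Qed.

Lemma subfield_of_set T : subfield_set T -> (forall a, S a -> T a) ->
  exists E : {subfield L}, forall a : L, (a \in E) <-> T a.
Proof.
move=> [T1 TB TD] ST.
have T0 : T 0 by rewrite -(subrr 1); apply: TB.
have TAdd a d : T a -> T d -> T (a + d).
  by move=> Ta Td; rewrite -[d]opprK -[- d]sub0r; apply: (TB) => //; apply: (TB).
have TM a d : T a -> T d -> T (a * d).
  move=> Ta Td; have [->|d0] := eqVneq d 0; first by rewrite mulr0.
  by rewrite -[d]invrK -[d^-1]mul1r; apply: (TD) => //; apply: (TD).
have [m [c [cT cG _]]] : exists m (c : 'I_m -> k), is_basis S T c.
  by apply: (bounded_basis (N := \dim {:L}) hS) => m c _; apply: free_over_size.
pose X : m.-tuple L := [tuple c i | i < m].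
have XT (a : L) : a \in <<X>>%VS <-> T a.
  split=> [/coord_span ->|/cG[d Sd ->]].
    apply: (big_ind T) => // i _; rewrite over_scaleE -tnth_nth tnth_mktuple.
    by apply: TM => //; apply: ST; apply: subfield_valP.
  apply: memv_suml => i _; have [d' d'E] := subfield_lift hS (Sd i).
  rewrite -d'E -[_ * _]/(d' *: (c i : L)); apply/memvZ/memv_span.
  by apply/mapP; exists i; rewrite ?mem_enum.
have XA : is_aspace <<X>>%VS.
  apply/andP; split; first by apply: has_algid1; apply/XT.
  by apply/prodvP => a d /XT Ta /XT Td; apply/XT; apply: TM.
by exists (ASpace XA).
Qed.

End Degrees.

(** * Transport along embeddings, and splitting fields *)

Section Transport.
Variables (k l : fieldType) (f : {rmorphism k -> l}).
Implicit Types S T : set k.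

(** Lets degrees in k_w be computed in a larger residue field k_x, where all residue fields of a
    tower live together. *)
Lemma is_basis_image S T (S' T' : set l) n (b : 'I_n -> l) :
  (f @` S)%classic = S' -> (f @` T)%classic = T' -> is_basis S' T' b ->
  exists c : 'I_n -> k, is_basis S T c.
Proof.
move=> <- <- [bT bG bI].
have [c cP] := choice (fun i => let: ex_intro2 c Tc e := bT i in ex_intro _ c (conj Tc e)).
exists c; split=> [i|y Ty|d Sd d0 i]; first by case: (cP i).
  have [d Sd e] := bG (f y) (ex_intro2 _ _ y Ty erefl).
  have [d' dP] := choice (fun i => let: ex_intro2 c Tc e := Sd i in ex_intro _ c (conj Tc e)).
  exists d' => [i|]; first by case: (dP i).
  apply: (fmorph_inj f); rewrite e rmorph_sum; apply: eq_bigr => i _.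
  by rewrite rmorphM (dP i).2 (cP i).2.
apply: (fmorph_inj f); rewrite rmorph0.
apply: (bI (fun i => f (d i))) => [j|]; first by exists (d j).
transitivity (f (\sum_i d i * c i)); last by rewrite d0 rmorph0.
rewrite rmorph_sum; apply: eq_bigr => j _.
by rewrite rmorphM (cP j).2.
Qed.

Lemma sep_closure_image S :
  (f @` sep_closure S)%classic = [set a | range f a /\ sep_closure (f @` S) a]%classic.
Proof.
apply/seteqP; split=> [_ [a [p [pS ps pa]] <-]|_ [[a _ <-] [q [qS qs qa]]]].
  split; first by exists a.
  exists (map_poly f p); split; rewrite ?separable_map ?fmorph_root //.
  by move=> i; rewrite coef_map; exists p`_i.
exists a => //.
have [c cP] := choice (fun i => let: ex_intro2 c Tc e := qS i in ex_intro _ c (conj Tc e)).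
pose p := \poly_(i < size q) c i.
have pq : map_poly f p = q.
  apply/polyP => i; rewrite coef_map coef_poly; case: ltnP => [_|iq]; first by case: (cP i).
  by rewrite raddf0 nth_default.
have ps : separable_poly p by rewrite -(separable_map f) pq.
have pa : root p a by rewrite -(fmorph_root f) pq.
exists p; split=> //.
move=> i; rewrite coef_poly; case: ltnP => [_|_]; first by case: (cP i).
(* S is an arbitrary set; that it contains 0 is read off from the coefficient of [q] just past its
   degree. *)
have := (cP (size q)); rewrite nth_default // => -[Sc /eqP].
by rewrite fmorph_eq0 => /eqP <-.
Qed.

End Transport.

Section Splitting.
Variables (k : fieldType) (S : set k) (hS : subfield_set S).
Variables (n : nat) (b : 'I_n -> k) (bb : is_basis S setT b).

(** Normality of k over S, phrased with split polynomials that need not be minimal, so that it can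
    be checked before k carries any extension structure. *)
Definition splits : Prop := forall a : k, exists rs : seq k,
  (forall i, S (\prod_(r <- rs) ('X - r%:P))`_i) /\ a \in rs.

Hypothesis hN : splits.

(* The splitting field structure needs [splits] as a further phantom argument. *)
Definition nover of splits : Type := field_over hS bb.
Local Notation L := (nover hN).
HB.instance Definition _ := FieldExt.on L.

Fact nover_splitting : splitting_field_axiom L.
Proof.
apply: normal_field_splitting => E a; have [rs [rsS ars]] := hN a.
have : minPoly E (a : L) %| \prod_(r <- rs) ('X - (r : L)%:P).
  apply: minPoly_dvdp; last by rewrite root_prod_XsubC.
  apply/polyOverP => i; apply: (subvP (sub1v E)).
  exact/mem1_over.
move=> /dvdp_prod_XsubC[m e]; exists (mask m rs).
by rewrite -eqp_monic ?monic_minPoly ?monic_prod_XsubC.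
Qed.

HB.instance Definition _ := FieldExt_isSplittingField.Build _ L nover_splitting.

Lemma mem1_nover (a : L) : (a \in 1%VS) <-> S a.
Proof. exact: mem1_over. Qed.

Lemma mem_sep_nover (E : {subfield L}) (a : L) :
  (a \in sep_subfield 1%AS E) <-> (a \in E /\ sep_closure S a).
Proof.
rewrite mem_sep_subfield ?sub1v //; split.
  move=> /andP[aE /separable_elementP[p [pS pa ps]]]; split=> //; exists p; split=> // i.
  by apply/mem1_nover/(polyOverP pS).
move=> [aE [p [pS ps pa]]]; rewrite aE; apply/separable_elementP; exists p; split=> //.
by apply/polyOverP => i; apply/mem1_nover.
Qed.

Lemma is_basis_nover (V : {vspace L}) :
  is_basis S [set` V]%classic (fun i : 'I_(\dim V) => (vbasis V)`_i : k).
Proof. exact: is_basis_vbasis. Qed.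

End Splitting.

Section Lift.
Variables (F : fieldType) (Om : fieldExtType F) (E : {subfield Om}) (v : valuation E).

Definition res_lift (r : residue v) : Om := s2val (cid2 (res_surj r)).
Lemma res_liftP r : res_lift r \in vring v.
Proof. exact: (s2valP (cid2 (res_surj r))). Qed.
Lemma res_liftK r : res v (res_lift r) = r.
Proof. exact: (s2valP' (cid2 (res_surj r))). Qed.

End Lift.

(** * Residue field extensions *)

Section ResidueMap.
Variables (F : fieldType) (Om : fieldExtType F).
Variables (L E : {subfield Om}) (w : valuation L) (x : valuation E).
Hypothesis xw : extends x w.

Lemma sub_residue_subfield : subfield_set (sub_residue x w).
Proof.
split=> [|_ _ [a aw <-] [c cw <-]|_ _ [a aw <-] [c cw <-]].
- by exists 1; rewrite ?res1 //= rpred1.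
- exists (a - c); first by rewrite /= rpredB.
  by rewrite resB // (extends_ring xw).
rewrite /= in aw cw; have [ax cx] := (extends_ring xw aw, extends_ring xw cw).
have [cm|cm] := boolP (c \in vmaxid x).
  by rewrite (res_max cm) invr0 mulr0; exists 0; rewrite ?res0 //= rpred0.
have cu : c \in vunit x by rewrite vunitN.
have cV : c^-1 \in vring w.
  by rewrite (extends_ringE xw) ?(vunit_ringV cu) // rpredV (vring_sub cw).
exists (a / c); first by rewrite /= rpredM.
by rewrite resM // ?resV // (extends_ring xw cV).
Qed.

(** The proof of [extends x w] is an argument of the function, so that the morphism structures
    attached to it can depend on it. *)
Definition residue_map & extends x w := fun r : residue w => res x (res_lift r).
Local Notation f := (residue_map xw).

Lemma residue_mapE a : a \in vring w -> f (res w a) = res x a.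
Proof.
move=> aw; have ax := extends_ring xw aw; have bw := res_liftP (res w a).
apply/res_eqP => //; first exact: (extends_ring xw bw).
by rewrite (extends_maxW xw) //; apply/res_eqP; rewrite ?res_liftK.
Qed.

Fact residue_map_zmod : zmod_morphism f.
Proof.
move=> r s; rewrite -{1}[r]res_liftK -{1}[s]res_liftK.
rewrite -resB ?res_liftP // residue_mapE ?rpredB ?res_liftP //.
by rewrite resB // (extends_ring xw) ?res_liftP.
Qed.

Fact residue_map_monoid : monoid_morphism f.
Proof.
split=> [|r s]; first by rewrite -(res1 w) residue_mapE ?rpred1 // res1.
rewrite -{1}[r]res_liftK -{1}[s]res_liftK.
rewrite -resM ?res_liftP // residue_mapE ?rpredM ?res_liftP //.
by rewrite resM // (extends_ring xw) ?res_liftP.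
Qed.

HB.instance Definition _ := GRing.isZmodMorphism.Build _ _ f residue_map_zmod.
HB.instance Definition _ := GRing.isMonoidMorphism.Build _ _ f residue_map_monoid.

Lemma range_residue_map : range f = sub_residue x w.
Proof.
apply/seteqP; split=> [_ [r _ <-]|_ [a aw <-]].
  by exists (res_lift r); first exact: res_liftP.
by exists (res w a) => //; rewrite residue_mapE.
Qed.

Lemma image_sub_residue (K : {subfield Om}) (v : valuation K) : extends w v ->
  (f @` sub_residue w v)%classic = sub_residue x v.
Proof.
move=> wv; apply/seteqP; split=> [_ [_ [a av <-] <-]|_ [a av <-]].
  by exists a => //; rewrite residue_mapE // (extends_ring wv).
exists (res w a); first by exists a.
by rewrite residue_mapE // (extends_ring wv).
Qed.

Lemma char_exp_extends : char_exp x = char_exp w.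
Proof.
rewrite /char_exp; congr (xget _ _); apply/seteqP.
by split=> p /=; rewrite (fmorph_pchar f).
Qed.

(** Independent residues lift to independent elements, so their number is at most [E:L]. *)
Lemma residue_basis : exists n (b : 'I_n -> residue x), is_basis (sub_residue x w) setT b.
Proof.
apply: (bounded_basis (N := \dim_L E) sub_residue_subfield) => n b _ bI.
apply: (independent_dim (extends_sub xw) (c := fun i => res_lift (b i))).
  by move=> i; apply: vring_sub (res_liftP _).
apply: (independent_residues xw) => [i|c cS]; first exact: res_liftP.
by under eq_bigr do rewrite res_liftK; apply: bI.
Qed.

End ResidueMap.

(* Naming this product keeps unification from comparing the instances of two
   products of polynomials term by term. *)
Definition root_poly (R : nzRingType) (I : finType) (A : {set I}) (c : I -> R) :
    {poly R} :=
  \prod_(j in A) ('X - (c j)%:P).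

Lemma map_root_poly (R S : nzRingType) (f : {rmorphism R -> S}) (I : finType)
    (A : {set I}) (c : I -> R) :
  map_poly f (root_poly A c) = root_poly A (f \o c).
Proof. exact: map_prod_XsubC. Qed.

Lemma eq_root_poly (R : nzRingType) (I : finType) (A : {set I}) (c d : I -> R) :
  {in A, c =1 d} -> root_poly A c = root_poly A d.
Proof. by move=> cd; apply: eq_bigr => i iA; rewrite cd. Qed.

(** In characteristic p, X^q - c^q = (X - c)^q: substituting X^q turns a polynomial whose roots are
    [q]-th powers into one whose roots are the [c i], each repeated [q] times. *)
Lemma root_poly_comp_Xn (R : idomainType) (I : finType) (A : {set I}) (c : I -> R) q :
  [pchar R].-nat q ->
  root_poly A (fun i => c i ^+ q) \Po 'X^q
    = \prod_(r <- flatten (nseq q [seq c i | i <- enum A])) ('X - r%:P).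
Proof.
move=> qR; have qp : [pchar {poly R}].-nat q.
  apply: sub_in_pnat qR => p _ /andP[pp /eqP p0]; apply/andP; split=> //.
  by rewrite -polyC_natr p0.
rewrite big_flatten /= big_nseq iter_mulr_1 big_map -prodrXl big_enum /=.
rewrite /root_poly rmorph_prod /=; apply: eq_bigr => i _.
rewrite comp_polyB comp_polyX comp_polyC rmorphXn /=.
by rewrite exprDn_pchar // exprNn_pchar.
Qed.

Section ResidueVal.
Variables (F : fieldType) (Om : fieldExtType F) (E : {subfield Om}) (v : valuation E).

Definition res_vint (a : vint v) : residue v := res v (val a).

Fact res_vint_zmod : zmod_morphism res_vint.
Proof. by move=> a b; rewrite /res_vint rmorphB resB //; apply: valP. Qed.

Fact res_vint_monoid : monoid_morphism res_vint.
Proof.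
split=> [|a b]; rewrite /res_vint; first by rewrite rmorph1 res1.
by rewrite rmorphM resM //; apply: valP.
Qed.

HB.instance Definition _ := GRing.isZmodMorphism.Build _ _ res_vint res_vint_zmod.
HB.instance Definition _ := GRing.isMonoidMorphism.Build _ _ res_vint res_vint_monoid.

Lemma res_nat n : res v n%:R = n%:R.
Proof.
elim: n => [|n IHn]; first by rewrite res0.
by rewrite -!natr1 resD ?rpred1 ?rpred_nat // IHn res1.
Qed.

Lemma pchar_residue q : [pchar Om].-nat q -> [pchar residue v].-nat q.
Proof.
apply: sub_in_pnat => p _ /andP[pp /eqP p0]; apply/andP; split=> //.
by rewrite -res_nat p0 res0.
Qed.

(* Fixes the ring structure of Om to that of a field extension. *)
Definition Om_poly (I : finType) (A : {set I}) (c : I -> Om) : {poly Om} := root_poly A c.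

(** The product can be formed over the valuation ring, on which both the inclusion into Om and the
    residue map are ring morphisms. *)
Lemma res_coef_prod (I : finType) (A : {set I}) (c : I -> Om) i :
  (forall j, j \in A -> c j \in vring v) ->
  (Om_poly A c)`_i \in vring v /\
  res v (Om_poly A c)`_i = (root_poly A (fun j => res v (c j)))`_i.
Proof.
move=> cv; pose d j : vint v := insubd 0 (c j).
have dE j : j \in A -> val (d j) = c j by move=> jA; rewrite /d insubdK // cv.
have -> : Om_poly A c = map_poly val (root_poly A d).
  by rewrite map_root_poly; apply: eq_root_poly => j jA; rewrite /= dE.
have -> : root_poly A (fun j => res v (c j)) = map_poly res_vint (root_poly A d).
  by rewrite map_root_poly; apply: eq_root_poly => j jA; rewrite /= /res_vint dE.
by rewrite !coef_map; split; first exact: valP.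
Qed.

End ResidueVal.

Section Normal.
Variables (F : fieldType) (Om : splittingFieldType F).
Variables (K M : {subfield Om}) (v : valuation K) (x : valuation M).
Hypotheses (nKM : normalField K M) (xv : extends x v).
Let sKM : (K <= M)%VS := extends_sub xv.
Local Notation G := 'Gal(M / K)%g.
Local Notation D := (decomp_group x K).

(** The polynomial with roots [g a ^+ q] is invariant under G and, for [q] making [a ^+ q]
    separable, has separable coefficients; so these lie in K and reduce into k_v. Choosing [a] by
    [decomp_lift] makes the roots outside D reduce to 0. *)
Lemma residue_conjugates (r : residue x) : exists a q,
  [/\ [pchar Om].-nat q, a \in vring x, res x a = r,
      forall g, g \in G -> g \notin D -> res x (g a) = 0 &
      forall i, sub_residue x v (root_poly G (fun g => res x (g a) ^+ q))`_i].
Proof.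
have [b bx <-] := res_surj r.
have [a [aO ab aD]] := decomp_lift xv bx.
have aM : a \in M := vring_sub (aO x xv).
have [q qn aq] := expr_sep_subfield K aM.
exists a, q; split=> //; first exact: aO; first by apply/res_eqP; rewrite ?aO.
  by move=> g gG gD; rewrite res_max ?aD.
have gax g : g \in G -> g a \in vring x.
  move=> gG; rewrite -(vconjKV x g) vconj_gal // aO //.
  by apply: vconj_extends => //; rewrite groupV.
pose c (g : gal_of M) : Om := g a ^+ q.
have cx g : g \in G -> c g \in vring x by move=> gG; rewrite rpredX ?gax.
have PK i : (Om_poly G c)`_i \in K.
  have [Pv _] := res_coef_prod i cx.
  suff : (Om_poly G c)`_i \in sep_fixed K G by rewrite (sep_fixed_gal sKM nKM).
  rewrite memv_cap; apply/andP; split.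
    apply/fixedFieldP => [|h hG]; first exact: (vring_sub Pv).
    suff hP : map_poly h (Om_poly G c) = Om_poly G c by rewrite -[in RHS]hP coef_map.
    rewrite map_root_poly /Om_poly /root_poly [RHS](reindex_inj (mulIg h)) /=.
    apply: eq_big => [g|g gG]; first by rewrite groupMr.
    by rewrite /= /c galM // galr_exp.
  move: i {Pv}; apply/polyOverP; apply: rpred_prod => g gG; rewrite rpredB ?polyOverX //.
  rewrite polyOverC /c -galr_exp.
  by apply: (subvP (gal_sep_img sKM gG)); apply: memv_img.
move=> i; have [Pv Pr] := res_coef_prod i cx.
exists (Om_poly G c)`_i; first by rewrite /= (extends_ringE xv).
rewrite Pr; apply: (congr1 (fun p : {poly residue x} => p`_i)).
by apply: eq_root_poly => g gG; apply: (resX _ (gax g gG)).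
Qed.

Lemma residue_splits : splits (sub_residue x v).
Proof.
move=> r; have [a [q [qn ax ar aD Scoef]]] := residue_conjugates r.
have qr : [pchar residue x].-nat q := pchar_residue x qn.
have q0 : (0 < q)%N by case/andP: qn.
pose c (g : gal_of M) := res x (g a).
exists (flatten (nseq q [seq c g | g <- enum G])); split=> [i|].
  rewrite -root_poly_comp_Xn // coef_comp_poly_Xn //; case: ifP => _; first exact: Scoef.
  by exists 0; rewrite ?res0 //= rpred0.
apply/flattenP; exists [seq c g | g <- enum G]; first by rewrite mem_nseq q0 eqxx.
by apply/mapP; exists 1%g; rewrite ?mem_enum ?group1 // /c gal_id.
Qed.

End Normal.

(** M is purely inseparable over the subfield that the generator spans with E, so the value there
    determines the automorphism. *)
Lemma gal_separable_generator_eq (F : fieldType) (L : splittingFieldType F)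
    (E M : {subfield L}) s t : (E <= M)%VS ->
  s \in 'Gal(M / E)%g -> t \in 'Gal(M / E)%g ->
  s (separable_generator E M) = t (separable_generator E M) -> s = t.
Proof.
move=> sEM sE tE st; apply/eqP/gal_eqP => a aM.
set g := separable_generator E M in st.
have /purely_inseparableP/(_ _ aM) := separable_generator_maximal M E.
move=> /purely_inseparable_elementP_pchar[q qn aq].
apply: (pchar_nat_expI qn) => /=; rewrite -!galr_exp.
have [p pP ->] := Fadjoin_polyP aq.
rewrite -!horner_map /= (fixedPoly_gal sEM sE pP) (fixedPoly_gal sEM tE pP).
by rewrite -/g st.
Qed.

Lemma root_poly_fixed (k : fieldType) (f : {rmorphism k -> k}) (I : finType)
    (A : {set I}) (c : I -> k) :
  (forall i, f (root_poly A c)`_i = (root_poly A c)`_i) ->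
  forall i, i \in A -> exists2 j, j \in A & f (c i) = c j.
Proof.
move=> fP i iA; have fp : map_poly f (root_poly A c) = root_poly A c.
  by apply/polyP => j; rewrite coef_map; apply: fP.
have rootE z : root (root_poly A c) z = [exists j in A, z == c j].
  rewrite /root_poly rootE horner_prod prodf_seq_eq0; apply/hasP/existsP.
    move=> [j _ /andP[jA]]; rewrite hornerXsubC subr_eq0 => zc.
    by exists j; rewrite jA.
  move=> [j /andP[jA zc]]; exists j; rewrite ?mem_index_enum // jA.
  by rewrite hornerXsubC subr_eq0.
have : root (root_poly A c) (f (c i)).
  by rewrite -fp fmorph_root rootE; apply/existsP; exists i; rewrite iA /=.
by rewrite rootE => /existsP[j /andP[jA /eqP fc]]; exists j.
Qed.

Section NoverGal.
Variables (k : fieldType) (S : set k) (hS : subfield_set S).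
Variables (n : nat) (b : 'I_n -> k) (bb : is_basis S setT b).
Variable hN : splits S.
Local Notation L := (nover hS bb hN).

(** A ring endomorphism fixing E is linear over the base, and normality turns it into an element of
    the Galois group. *)
Lemma nover_gal (E : {subfield L}) (f : {rmorphism k -> k}) :
  (forall a : L, a \in E -> f a = a) ->
  exists2 t, t \in 'Gal({:L} / E)%g & forall a : L, t a = f a.
Proof.
move=> fE.
have flin : linear (f : L -> L).
  move=> c u w; rewrite !over_scaleE rmorphD rmorphM; congr (_ * _ + _).
  have c1 : (val c : field_over hS bb) \in 1%VS by apply/mem1_over; apply: subfield_valP.
  exact: fE (subvP (sub1v E) _ c1).
pose fm := GRing.isLinear.Build _ _ _ _ (f : L -> L) flin.
pose fL : {linear L -> L} := HB.pack (f : L -> L) fm.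
have fk : kHom E {:L} (linfun fL).
  apply/kHomP_tmp; split=> [a aE|a c _ _]; first by rewrite lfunE /= fE.
  by rewrite !lfunE /= rmorphM.
have sE : (E <= {:L} <= {:L})%VS by rewrite !subvf.
have [t tE tf] := kHom_to_gal sE (normalFieldf E) fk.
by exists t => // a; rewrite -tf ?memvf // lfunE.
Qed.

End NoverGal.

(** * Action of the decomposition group on the residue field *)

Section ResidueGalois.
Variables (F : fieldType) (Om : splittingFieldType F).
Variables (K L M : {subfield Om}).
Variables (v : valuation K) (w : valuation L) (x : valuation M).
Hypotheses (nKM : normalField K M) (xv : extends x v) (xw : extends x w).
Hypothesis wv : extends w v.
Let sKL : (K <= L)%VS := extends_sub wv.
Let sLM : (L <= M)%VS := extends_sub xw.
Let nLM : normalField L M := normalFieldS sKL nKM.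
Local Notation G := 'Gal(M / L)%g.
Local Notation D := (decomp_group x L).
Local Notation I := (inertia_group x L).
Local Notation l := (residue x).

Lemma res_gal_eq g a c : g \in D -> a \in vring x -> c \in vring x ->
  res x a = res x c -> res x (g a) = res x (g c).
Proof.
move=> gD ax cx /(res_eqP ax cx) ac.
have [aM cM] := (vring_sub ax, vring_sub cx).
by apply/res_eqP; rewrite ?(decomp_ring gD) // -galr_sub (decomp_max gD) ?rpredB.
Qed.

Section OneGal.
Variables (g : gal_of M) (gD : g \in D).
Definition residue_gal & g \in D := fun r : l => res x (g (res_lift r)).
Local Notation f := (residue_gal gD).

Lemma residue_galE a : a \in vring x -> f (res x a) = res x (g a).
Proof. by move=> ax; apply: res_gal_eq; rewrite ?res_liftK // res_liftP. Qed.

Let gx a : a \in vring x -> g a \in vring x.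
Proof. by move=> ax; rewrite (decomp_ring gD) ?(vring_sub ax). Qed.

Fact residue_gal_zmod : zmod_morphism f.
Proof.
move=> r s; rewrite -{1}[r]res_liftK -{1}[s]res_liftK.
rewrite -resB ?res_liftP // residue_galE ?rpredB ?res_liftP //.
by rewrite galr_sub resB // gx ?res_liftP.
Qed.

Fact residue_gal_monoid : monoid_morphism f.
Proof.
split=> [|r s]; first by rewrite -(res1 x) residue_galE ?rpred1 // galr_one.
rewrite -{1}[r]res_liftK -{1}[s]res_liftK.
rewrite -resM ?res_liftP // residue_galE ?rpredM ?res_liftP //.
by rewrite galr_mul resM // gx ?res_liftP.
Qed.

HB.instance Definition _ := GRing.isZmodMorphism.Build _ _ f residue_gal_zmod.
HB.instance Definition _ := GRing.isMonoidMorphism.Build _ _ f residue_gal_monoid.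

Lemma residue_gal_fix a : a \in vring w -> f (res x a) = res x a.
Proof.
move=> aw; rewrite residue_galE ?(extends_ring xw) //.
by rewrite (fixed_gal sLM (fintype.subsetP (decomp_sub x L) _ gD) (vring_sub aw)).
Qed.

End OneGal.

Lemma inertia_mod g h : g \in D -> h \in D ->
  (forall a, a \in vring x -> res x (g a) = res x (h a)) <-> (g * h^-1)%g \in I.
Proof.
move=> gD hD; split=> [e|/inertiaP[_ e] a ax].
  apply/inertiaP; split=> [|a ax]; first by rewrite groupM ?groupV.
  have aM := vring_sub ax; rewrite galM //.
  rewrite (@res_gal_eq h^-1%g (g a) (h a)) ?groupV ?(decomp_ring gD) ?(decomp_ring hD) //.
    by rewrite galgV.
  exact: e.
have aM := vring_sub ax.
have := @res_gal_eq h _ _ hD _ ax (e a ax).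
rewrite galM // galVg ?memv_gal // => -> //.
by rewrite (decomp_ring (_ : h^-1%g \in D)) ?groupV ?memv_gal // (decomp_ring gD).
Qed.

Section Counting.
Variables (n : nat) (b : 'I_n -> l) (bb : is_basis (sub_residue x v) setT b).
Local Notation LL := (nover (sub_residue_subfield xv) bb (residue_splits nKM xv)).
Variable E : {subfield LL}.
Hypothesis EP : forall a : LL, (a \in E) <-> sub_residue x w a.

Lemma decomp_to_gal g : g \in D ->
  exists2 t, t \in 'Gal({:LL} / E)%g & forall a, a \in vring x -> t (res x a : LL) = res x (g a).
Proof.
move=> gD; have [|t tE tf] := @nover_gal _ _ _ _ _ _ (residue_splits nKM xv) E (residue_gal gD).
  by move=> a /EP[c cw <-]; apply: residue_gal_fix.
by exists t => // a ax; rewrite tf; apply: residue_galE.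
Qed.

Lemma gal_to_decomp t : t \in 'Gal({:LL} / E)%g ->
  exists2 g, g \in D & forall a, a \in vring x -> t (res x a : LL) = res x (g a).
Proof.
move=> tE; set r := separable_generator E {:LL}.
have [a [q [qn ax ar aD Scoef]]] := residue_conjugates nLM xw (r : l).
have [g gD tg] : exists2 g, g \in D & t r = res x (g a).
  have tz : zmod_morphism (t : l -> l) by move=> y z; apply: (rmorphB t).
  have tm : monoid_morphism (t : l -> l).
    by split=> [|y z]; [apply: (rmorph1 t)|apply: (rmorphM t)].
  pose t1 := GRing.isZmodMorphism.Build _ _ (t : l -> l) tz.
  pose t2 := GRing.isMonoidMorphism.Build _ _ (t : l -> l) tm.
  pose T : {rmorphism l -> l} := HB.pack (t : l -> l) t1 t2.
  have Tfix i : T (root_poly G (fun g => res x (g a) ^+ q))`_i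
      = (root_poly G (fun g => res x (g a) ^+ q))`_i.
    by apply: (fixed_gal (subvf E) tE); apply/EP; apply: Scoef.
  (* [t] maps roots to roots, so [t r ^+ q] is the [q]-th power of the residue of [g a] for some [g]
     in G, not yet in D. *)
  have [g gG] := root_poly_fixed Tfix (group1 _).
  rewrite gal_id ar rmorphXn => /(pchar_nat_expI (pchar_residue x qn)) tg.
  (* Outside D the residue of [g a] is 0, hence [t r = 0] and [r = 0]; then the identity serves
     instead of [g]. *)
  have [gD|gD] := boolP (g \in D); first by exists g.
  exists 1%g; rewrite ?group1 // gal_id ar.
  move: tg; rewrite (aD _ gG gD) => /eqP; rewrite fmorph_eq0 => /eqP r0.
  by rewrite -[t r]/(T r) r0 rmorph0.
have [s sE sf] := decomp_to_gal gD.
exists g => // c cx; rewrite -sf //; congr (_ _).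
by rewrite (gal_separable_generator_eq (subvf E) tE sE) // -/r tg -ar sf.
Qed.

Lemma card_gal_residue : #|'Gal({:LL} / E)%g| = #|D : I|%g.
Proof.
have sID : I \subset D := inertia_sub x L.
have ex g : exists t, g \in D -> t \in 'Gal({:LL} / E)%g /\
    forall a, a \in vring x -> t (res x a : LL) = res x (g a).
  have [gD|gD] := boolP (g \in D); last by exists 1%g.
  by have [t tE tf] := decomp_to_gal gD; exists t.
have [t tP] := choice ex.
have rD g : g \in D -> exists2 i, i \in I & repr (I :* g)%g = (i * g)%g.
  move=> gD; have := mem_repr_rcoset (inertia_Group x L) g.
  by case/rcosetP => i iI ->; exists i.
have rDD A : A \in rcosets I D -> repr A \in D.
  move=> /rcosetsP[g gD ->]; have [i iI ->] := rD _ gD.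
  by rewrite groupM // (fintype.subsetP sID).
have tinj : {in rcosets I D &, injective (fun A => t (repr A))}.
  move=> A B hA hB e.
  have [_ tA] := tP _ (rDD _ hA); have [_ tB] := tP _ (rDD _ hB).
  have : (repr A * (repr B)^-1)%g \in I.
    by apply/inertia_mod => [||a ax]; rewrite ?rDD // -tA // e tB.
  case/rcosetsP: (hA) => g gD gA; case/rcosetsP: (hB) => h hD hB'.
  rewrite gA hB'; have [i iI ->] := rD _ gD; have [j jI ->] := rD _ hD => ij.
  apply: rcoset_eqP; rewrite mem_rcoset.
  have -> : (g * h^-1 = i^-1 * (i * g * (j * h)^-1) * j)%g.
    by rewrite invMg !mulgA mulVg mul1g mulgKV.
  by rewrite groupM // groupM // groupV.
rewrite /indexg -(card_in_imset tinj); congr #|pred_of_set _|.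
apply/setP => s; apply/idP/imsetP => [sE|[A hA ->]]; last by case: (tP _ (rDD _ hA)).
have [g gD sg] := gal_to_decomp sE.
exists (I :* g)%g; first by apply/rcosetsP; exists g.
have gI : (I :* g)%g \in rcosets I D by apply/rcosetsP; exists g.
have [tE tf] := tP _ (rDD _ gI).
apply: (gal_separable_generator_eq (subvf E) sE tE).
have [c cx <-] := res_surj (separable_generator E {:LL} : l).
rewrite sg // tf //; have [i /inertiaP[iD ie] ->] := rD _ gD.
have cM := vring_sub cx; rewrite galM //; apply: res_gal_eq => //.
  by rewrite (decomp_ring iD).
by rewrite ie.
Qed.

End Counting.
End ResidueGalois.

Section ResidueDegree.
Variables (F : fieldType) (Om : splittingFieldType F).
Variables (K L M : {subfield Om}).
Variables (v : valuation K) (w : valuation L) (x : valuation M).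
Hypotheses (nKM : normalField K M) (xv : extends x v) (xw : extends x w).
Hypothesis wv : extends w v.

Lemma extends_refl E (u : valuation (E : {subfield Om})) : extends u u.
Proof.
split=> // a; case: (boolP (a \in E)) => //= aE; apply/negP => /vring_sub.
by rewrite (negPf aE).
Qed.

Section Transport.
Variables (n : nat) (b : 'I_n -> residue x).
Variable bb : is_basis (sub_residue x v) setT b.
Local Notation LL := (nover (sub_residue_subfield xv) bb (residue_splits nKM xv)).

Lemma val_fs_dim (E : {subfield LL}) :
  (forall a : LL, (a \in E) <-> sub_residue x w a) ->
  val_fs w v = \dim (sep_subfield 1%AS E).
Proof.
move=> EP; pose f := residue_map xw.
have hw := sub_residue_subfield wv.
have sepE : (f @` sep_closure (sub_residue w v))%classic
    = [set` (sep_subfield 1%AS E : {vspace LL})]%classic.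
  rewrite sep_closure_image (image_sub_residue xw wv) (range_residue_map xw).
  apply/seteqP; split=> a.
    by move=> [/EP aE aS]; apply/mem_sep_nover.
  by move=> /mem_sep_nover[/EP aE aS].
have bV := is_basis_nover (sep_subfield 1%AS E : {vspace LL}).
have [c cb] := is_basis_image (image_sub_residue xw wv) sepE bV.
exact: ext_degree_basis hw cb.
Qed.

End Transport.
End ResidueDegree.

Section ResidueIndex.
Variables (F : fieldType) (Om : splittingFieldType F).
Variables (K L M : {subfield Om}).
Variables (v : valuation K) (w : valuation L) (x : valuation M).
Hypotheses (nKM : normalField K M) (xv : extends x v) (xw : extends x w).
Hypothesis wv : extends w v.

(** Both indices are orders of automorphism groups of k_x, over k_w and over k_v, and their ratio is
    the separable degree of k_w/k_v. *)
Lemma val_fs_index :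
  (val_fs w v * #|decomp_group x L : inertia_group x L|%g)%N
    = #|decomp_group x K : inertia_group x K|%g.
Proof.
have [n [b bb]] := residue_basis xv.
have sST (a : residue x) : sub_residue x v a -> sub_residue x w a.
  by move=> [c cv <-]; exists c => //; apply: (extends_ring wv).
have [E0 E0P] := subfield_of_set (sub_residue_subfield xv) bb (sub_residue_subfield xw) sST.
pose LL := nover (sub_residue_subfield xv) bb (residue_splits nKM xv).
pose E : {subfield LL} := E0.
have EP (a : LL) : a \in E <-> sub_residue x w a := E0P a.
have oneP (a : LL) : a \in (1%AS : {subfield LL}) <-> sub_residue x v a.
  exact: mem1_nover.
rewrite -(card_gal_residue xw wv EP).
rewrite -(card_gal_residue xv (extends_refl v) oneP).
rewrite (val_fs_dim xw wv EP).
exact: dim_sep_subfield1.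
Qed.

Lemma val_f_decomp : (val_f w v = val_fs w v * val_fi w v)%N /\ (0 < val_f w v)%N.
Proof.
have [n [b bb]] := residue_basis wv.
exact: (ext_degree_sep_insep (sub_residue_subfield wv) bb).
Qed.

End ResidueIndex.

(** * Value cosets and the ramification group *)

Section Dedekind.
Variables (k : fieldType) (T : Type) (mul : T -> T -> T) (dom : T -> Prop).
Variables (I : finType) (chi : I -> T -> k).
Hypothesis dom_mul : forall s t, dom s -> dom t -> dom (mul s t).
Hypothesis chiM : forall i s t, dom s -> dom t -> chi i (mul s t) = chi i s * chi i t.
Hypothesis chi_neq0 : forall i, exists2 t, dom t & chi i t != 0.
Hypothesis chi_inj : forall i j, i != j -> exists2 t, dom t & chi i t != chi j t.

(** Artin's argument, by induction on the number of non-zero coefficients. The operation and its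
    domain are abstract, to cover characters of groups as well as automorphisms of a residue field
    followed by a power of Frobenius. *)
Lemma characters_independent (a : I -> k) :
  (forall t, dom t -> \sum_i a i * chi i t = 0) -> forall i, a i = 0.
Proof.
have [n] := ubnP #|[pred i | a i != 0]|.
elim: n a => // n IHn a sa a0 i; apply/eqP; apply: contraT => ai.
have [j /andP[ji aj]|none] := pickP [pred j | (j != i) && (a j != 0)].
  have [t dt tij] := chi_inj ji.
  (* Subtracting [chi i t] times the relation at [s] from the relation at [mul t s] removes the
     coefficient of [i] and keeps a non-zero coefficient at [j]. *)
  pose a' l := a l * (chi l t - chi i t).
  have a'0 : forall s, dom s -> \sum_l a' l * chi l s = 0.
    move=> s ds; transitivity (\sum_l a l * chi l (mul t s) - chi i t * \sum_l a l * chi l s).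
      rewrite mulr_sumr -sumrB; apply: eq_bigr => l _.
      by rewrite chiM // /a' mulrBr mulrBl -!mulrA [in X in _ - X]mulrCA.
    by rewrite !a0 ?mulr0 ?subrr //; apply: dom_mul.
  have sa' : (#|[pred l | a' l != 0%R]| < n)%N.
    rewrite ltnS in sa; apply: leq_trans sa; apply: proper_card; apply/properP; split.
      by apply/fintype.subsetP => l; rewrite !inE; apply: contra_neq => al; rewrite /a' al mul0r.
    by exists i; rewrite !inE // /a' subrr mulr0 eqxx.
  have /eqP := IHn a' sa' a'0 j.
  by rewrite mulf_eq0 subr_eq0 (negPf aj) (negPf tij).
have [t dt ti] := chi_neq0 i.
have := a0 t dt; rewrite (bigD1 i) //= big1 => [|l li].
  by rewrite addr0 => /eqP; rewrite mulf_eq0 (negPf ai) (negPf ti).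
by have := none l; rewrite /= li /= => /negbFE/eqP ->; rewrite mul0r.
Qed.

End Dedekind.

Lemma independent_functions_card (k : fieldType) (I J : finType) (f : I -> J -> k) :
  (forall a : I -> k, (forall j, \sum_i a i * f i j = 0) -> forall i, a i = 0) ->
  (#|I| <= #|J|)%N.
Proof.
move=> ind; pose X := \matrix_(i < #|I|, j < #|J|) f (enum_val i) (enum_val j).
suff : row_free X by rewrite /row_free => /eqP <-; apply: rank_leq_col.
rewrite -kermx_eq0; apply/rowV0P => u /sub_kermxP uX.
apply/rowP => i; rewrite mxE.
have h := ind (fun i => u 0 (enum_rank i)) _ (enum_val i).
rewrite enum_valK in h; apply: h => j.
have := congr1 (fun Z : 'rV_#|J| => Z 0 (enum_rank j)) uX; rewrite !mxE; apply: etrans.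
rewrite (reindex (fun i : 'I_#|I| => enum_val i)) /=; last by apply: onW_bij; apply: enum_val_bij.
by apply: eq_big => // i' _; rewrite mxE enum_valK enum_rankK.
Qed.

Section Pairing.
Variables (k : fieldType) (gT hT : finGroupType) (A V : {group gT}) (B : {group hT}).
Variable b : gT -> hT -> k.
Hypothesis sVA : V \subset A.
Hypothesis bMl : forall g h s, g \in A -> h \in A -> s \in B ->
  b (g * h)%g s = b g s * b h s.
Hypothesis bMr : forall g s t, g \in A -> s \in B -> t \in B ->
  b g (s * t)%g = b g s * b g t.
Hypothesis b_neq0 : forall g s, g \in A -> s \in B -> b g s != 0.
Hypothesis kerl : forall g, g \in A -> (forall s, s \in B -> b g s = 1) <-> g \in V.
Hypothesis kerr : forall s, s \in B -> (forall g, g \in A -> b g s = 1) -> s = 1%g.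

Let rep (i : 'I_#|rcosets V A|) : gT := repr (enum_val i).

Let repP g : g \in A -> exists i, exists2 c, c \in V & g = (c * rep i)%g.
Proof.
move=> gA; have cA : (V :* g)%g \in rcosets V A by apply/rcosetsP; exists g.
exists (enum_rank_in cA (V :* g)%g); rewrite /rep enum_rankK_in //.
have := mem_repr_rcoset V g; case/rcosetP => c cV ->.
by exists c^-1%g; rewrite ?groupV // mulKg.
Qed.

Let repA i : rep i \in A.
Proof.
have /rcosetsP[g gA e] := enum_valP i; rewrite /rep e.
have := mem_repr_rcoset V g; case/rcosetP => c cV ->.
by rewrite groupM // (fintype.subsetP sVA).
Qed.

Let rep_inj i j : (rep i * (rep j)^-1)%g \in V -> i = j.
Proof.
move=> ij; apply: enum_val_inj.
have /rcosetsP[g gA ei] := enum_valP i; have /rcosetsP[h hA ej] := enum_valP j.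
move: ij; rewrite /rep ei ej.
have := mem_repr_rcoset V g; case/rcosetP => c cV ->.
have := mem_repr_rcoset V h; case/rcosetP => d dV ->.
rewrite invMg !mulgA groupMr ?groupV // -mulgA groupMl // => gh.
by apply: rcoset_eqP; rewrite mem_rcoset.
Qed.

Let b_inv g h s : g \in A -> h \in A -> s \in B -> b g s = b h s -> b (g * h^-1)%g s = 1.
Proof.
move=> gA hA sB e; apply: (mulIf (b_neq0 hA sB)).
by rewrite -bMl ?groupM ?groupV // mulgKV mul1r.
Qed.

(* Dedekind independence of the characters b g _ of B and of the characters
   b _ s of A. *)
Lemma pairing_card : #|A : V|%g = #|B|.
Proof.
apply/eqP; rewrite eqn_leq; apply/andP; split.
  have -> : #|A : V|%g = #|{: 'I_#|rcosets V A|}| by rewrite card_ord.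
  have -> : #|B| = #|{: 'I_#|B|}| by rewrite card_ord.
  apply: (@independent_functions_card _ _ _ (fun i j => b (rep i) (enum_val j))) => a a0.
  apply: (@characters_independent _ _ (fun s t : hT => (s * t)%g) (fun s => s \in B)
            _ (fun i s => b (rep i) s)).
  - by move=> s t; apply: groupM.
  - by move=> i s t sB tB; rewrite bMr.
  - by move=> i; exists 1%g; rewrite ?group1 // b_neq0.
  - move=> i j ij; apply: contrapT => nex; case/eqP: ij; apply: rep_inj.
    apply/kerl; rewrite ?groupM ?groupV // => s sB; apply: b_inv => //.
    by apply: contrapT => /eqP ne; apply: nex; exists s.
  - by move=> s sB; rewrite -[RHS](a0 (enum_rank_in sB s)); apply: eq_bigr => i _; rewrite enum_rankK_in.
have -> : #|A : V|%g = #|{: 'I_#|rcosets V A|}| by rewrite card_ord.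
have -> : #|B| = #|{: 'I_#|B|}| by rewrite card_ord.
apply: (@independent_functions_card _ _ _ (fun j i => b (rep i) (enum_val j))) => a a0.
have bV g s : g \in V -> s \in B -> b g s = 1.
  by move=> gV; move: s; apply/kerl; rewrite ?(fintype.subsetP sVA).
apply: (@characters_independent _ _ (fun g h : gT => (g * h)%g) (fun g => g \in A)
            _ (fun (j : 'I_#|B|) g => b g (enum_val j))).
- by move=> g h; apply: groupM.
- by move=> i g h gA hA; rewrite bMl // enum_valP.
- by move=> i; exists 1%g; rewrite ?group1 // b_neq0 // enum_valP.
- move=> i j ij; apply: contrapT => nex; case/eqP: ij; apply: enum_val_inj.
  have [iB jB] := (enum_valP i, enum_valP j).
  apply/eqP; rewrite eq_mulgV1; apply/eqP; apply: kerr; rewrite ?groupM ?groupV // => g gA.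
  apply: (mulIf (b_neq0 gA jB)).
  rewrite -bMr ?groupM ?groupV // mulgKV mul1r.
  by apply: contrapT => /eqP ne; apply: nex; exists g.
(* The relation is given at the representatives only; it extends to A because V pairs trivially with
   B. *)
move=> g gA; have [i [c cV ->]] := repP gA.
rewrite -[RHS](a0 i); apply: eq_bigr => j _.
have cA := fintype.subsetP sVA c cV.
by rewrite bMl ?enum_valP // bV ?enum_valP // mul1r.
Qed.

End Pairing.

(** * Representatives of value cosets *)

Section Cosets.
Variables (F : fieldType) (Om : fieldExtType F).
Implicit Types (K L M : {subfield Om}).

Section Same.
Variables (L : {subfield Om}) (w : valuation L) (K : {subfield Om}).
Local Notation same := (same_coset w K).

Lemma same_coset_refl a : a != 0 -> same a a.
Proof. by move=> a0; exists 1; rewrite rpred1 oner_eq0 mul1r divff // vunit1. Qed.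

Lemma same_coset_trans b a c : b != 0 -> same a b -> same b c -> same a c.
Proof.
move=> b0 [d [dK d0 u]] [e [eK e0 u']]; exists (d * e).
rewrite rpredM // mulf_neq0 //; split=> //.
have -> : a / (d * e * c) = a / (d * b) * (b / (e * c)); last exact: vunitM.
have [a0|a0] := eqVneq c 0; first by rewrite a0 !mulr0 invr0 !mulr0.
by field; rewrite a0 e0 b0 d0.
Qed.

Lemma same_cosetM a a' b b' : same a a' -> same b b' -> same (a * b) (a' * b').
Proof.
move=> [d [dK d0 u]] [e [eK e0 u']]; exists (d * e).
rewrite rpredM // mulf_neq0 //; split=> //.
have -> : a * b / (d * e * (a' * b')) = a / (d * a') * (b / (e * b')); last exact: vunitM.
by rewrite [d * e * _]mulrACA invfM mulrACA.
Qed.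

Lemma same_coset_mulI a b c : a != 0 -> same (a * b) (a * c) -> same b c.
Proof.
move=> a0 [d [dK d0 u]]; exists d; split=> //.
have <- // : a * b / (d * (a * c)) = b / (d * c).
by rewrite mulrCA invfM mulrACA divff // mul1r.
Qed.

End Same.

(** A transversal of the quotient of the value groups, used in place of the quotient group. The
    index type is arbitrary so that products of transversals fit. *)
Definition coset_reps L (w : valuation L) K (I : finType) (c : I -> Om) : Prop :=
  [/\ forall i, c i \in L, forall i, c i != 0,
      forall a, a \in L -> a != 0 -> exists i, same_coset w K a (c i) &
      forall i j, same_coset w K (c i) (c j) -> i = j].

Lemma coset_reps_exists L (w : valuation L) K : (K <= L)%VS ->
  exists n (c : 'I_n -> Om), coset_reps w K c.
Proof.
move=> sKL.
pose free n := `[< exists c : 'I_n -> Om, [/\ forall i, c i \in L, forall i, c i != 0 &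
  forall i j, same_coset w K (c i) (c j) -> i = j] >].
have ex : exists n, free n.
  by exists 0%N; apply/asboolP; exists (fun=> 0); split=> [[]|[]|[]].
have ub n : free n -> (n <= \dim_K L)%N.
  move=> /asboolP[c [cL c0 cI]]; apply: (independent_dim sKL cL).
  exact: independent_cosets cI.
case: (ex_maxnP ex ub) => n /asboolP[c [cL c0 cI]] nmax; exists n, c; split=> // a aL a0.
apply: contrapT => na; suff : free n.+1 by move/nmax; rewrite ltnn.
apply/asboolP; exists (fun i => if unlift ord0 i is Some j then c j else a); split.
- by move=> i; case: unliftP.
- by move=> i; case: unliftP.
move=> i j; case: unliftP => [i' ->|->]; case: unliftP => [j' ->|->] //.
- by move/cI => ->.
- by move=> /same_coset_sym h; case: na; exists i'.
- by move=> h; case: na; exists j'.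
Qed.

Lemma vclass_eq L (w : valuation L) a b : a != 0 -> b != 0 ->
  (vclass w a = vclass w b) <-> a / b \in vunit w.
Proof.
move=> a0 b0; split=> [e|u].
  have : vclass w b a by rewrite -e; exists 1; [exact: (vunit1 w)|rewrite mulr1].
  by move=> [u uu <-]; rewrite mulrAC divff // mul1r.
apply/seteqP; split=> _ [t tu <-].
  by exists (a / b * t); [exact: (vunitM u tu)|rewrite mulrA [b * _]mulrC divfK].
exists (b / a * t); last by rewrite mulrA [a * _]mulrC divfK.
by apply: (vunitM _ tu); rewrite -invf_div vunitV.
Qed.

Lemma class_mul_vclass L (w : valuation L) a b :
  class_mul (vclass w a) (vclass w b) = vclass w (a * b).
Proof.
apply/seteqP; split=> [_ [_ [u uu <-] [_ [t tu <-] <-]]|_ [u uu <-]].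
  by exists (u * t); [exact: (vunitM uu tu)|rewrite mulrACA].
exists a; first by exists 1; [exact: (vunit1 w)|rewrite mulr1].
by exists (b * u); [exists u|rewrite mulrA].
Qed.

Lemma val_e_reps K L (v : valuation K) (w : valuation L) (I : finType) (c : I -> Om) :
  extends w v -> coset_reps w K c -> val_e w v = #|I|.
Proof.
move=> wv [cL c0 cG cI]; have sKL := extends_sub wv.
pose cos a : set (set Om) :=
  [set class_mul (vclass w a) d | d in sub_value_group w v]%classic.
have cosE a : cos a = [set vclass w (a * d) | d in [set d | (d \in K) && (d != 0)]]%classic.
  apply/seteqP; split=> [_ [_ [d dK <-] <-]|_ [d dK <-]].
    by exists d => //; rewrite class_mul_vclass.
  by exists (vclass w d); [exists d|rewrite class_mul_vclass].
have cosP a b : a != 0 -> b != 0 -> (cos a = cos b) <-> same_coset w K a b.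
  move=> a0 b0; rewrite !cosE; split=> [e|[d [dK d0 u]]].
    have : [set vclass w (a * d) | d in [set d | (d \in K) && (d != 0)]]%classic (vclass w a).
      by exists 1; rewrite ?mulr1 //= rpred1 oner_eq0.
    rewrite e => -[d /= /andP[dK d0] /esym/(vclass_eq w a0 (mulf_neq0 b0 d0)) u].
    by exists d; split; rewrite // [d * b]mulrC.
  apply/seteqP; split=> [_ [e /= /andP[eK e0] <-]|_ [e /= /andP[eK e0] <-]].
    exists (d * e); first by rewrite /= rpredM ?mulf_neq0.
    apply/vclass_eq; rewrite ?mulf_neq0 //.
    rewrite -vunitV invf_div.
    by have -> // : a * e / (b * (d * e)) = a / (d * b) by field; rewrite d0 e0 b0.
  exists (e / d); first by rewrite /= rpred_div ?mulf_neq0 ?invr_eq0.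
  apply/vclass_eq; rewrite ?mulf_neq0 ?invr_eq0 //.
  by have -> // : a * (e / d) / (b * e) = a / (d * b) by field; rewrite d0 e0 b0.
rewrite /val_e (@card_fset_set_param _ _ predT (fun i => cos (c i))) //.
- by move=> i _; exists (vclass w (c i)) => //; exists (c i) => //=; rewrite cL c0.
- move=> _ [_ [a /= /andP[aL a0] <-] <-]; have [i ai] := cG a aL a0.
  by exists i => //; apply/cosP.
by move=> i j _ _ /(cosP _ _ (c0 i) (c0 j))/cI.
Qed.

Lemma val_e_gt0 K L (v : valuation K) (w : valuation L) : extends w v -> (0 < val_e w v)%N.
Proof.
move=> wv; have [n [c cr]] := coset_reps_exists w (extends_sub wv).
rewrite (val_e_reps wv cr) card_ord; case: cr => _ _ cG _.
have [i _] := cG 1 (rpred1 _) (oner_neq0 _).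
exact: leq_ltn_trans (ltn_ord i).
Qed.

Lemma val_e_tower K L M (v : valuation K) (w : valuation L) (x : valuation M) :
  extends w v -> extends x w -> val_e x v = (val_e x w * val_e w v)%N.
Proof.
move=> wv xw; have xv := extends_trans xw wv.
have [sKL sLM] := (extends_sub wv, extends_sub xw).
have [n [c cr]] := coset_reps_exists x sLM.
have [m [d dr]] := coset_reps_exists w sKL.
rewrite (val_e_reps xw cr) (val_e_reps wv dr) -card_prod; apply: (val_e_reps (c := fun p => c p.1 * d p.2)) => //.
case: cr dr => cL c0 cG cI [dL d0 dG dI].
have uw a : a \in L -> (a \in vunit w) = (a \in vunit x).
  by move=> aL; rewrite !vunitE !(extends_ringE xw) ?rpredV.
split=> [[i j]|[i j]|a aM a0|[i j] [i' j'] /=].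
- by rewrite /= rpredM // (subvP sLM).
- by rewrite /= mulf_neq0.
- have [i [e [eL e0 u]]] := cG a aM a0.
  have [j [k [kK k0 u']]] := dG e eL e0.
  exists (i, j), k; split=> //=.
  have -> : a / (k * (c i * d j)) = a / (e * c i) * (e / (k * d j)).
    by field; rewrite k0 e0 c0 d0.
  by rewrite vunitM // -uw // rpred_div // rpredM // (subvP sKL).
move=> [k [kK k0 u]].
have ii : i = i'.
  apply: cI; exists (k * d j' / d j).
  split; first by rewrite rpred_div // rpredM // (subvP sKL).
    by rewrite mulf_neq0 ?invr_eq0 // mulf_neq0.
  by have <- // : c i * d j / (k * (c i' * d j')) = c i / (k * d j' / d j * c i')
    by field; rewrite k0 c0 !d0.
rewrite ii in u *; congr pair; apply: dI; exists k; split=> //.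
rewrite uw; last by rewrite rpred_div // rpredM // (subvP sKL).
by have <- // : c i' * d j / (k * (c i' * d j')) = d j / (k * d j') by field; rewrite k0 c0 !d0.
Qed.

End Cosets.

(** * Relative norms and traces, and the tame pairing *)

Section RelTrace.
Variables (F : fieldType) (Om : splittingFieldType F) (M : {subfield Om}).
Variables (H J : {group gal_of M}).
Hypothesis sHJ : H \subset J.
Implicit Types (a : Om) (g h : gal_of M).

(** The trace from the invariants of H to those of J. Representatives are arbitrary, so the value is
    canonical only for H-invariant [a]. *)
Definition rel_trace a := \sum_(A in rcosets H J) repr A a.
Definition rel_norm a := \prod_(h in H) h a.

Lemma rel_trace_mem a : a \in M -> rel_trace a \in M.
Proof. by move=> aM; apply: rpred_sum => A _; apply: memv_gal. Qed.

Lemma rel_norm_mem a : a \in M -> rel_norm a \in M.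
Proof. by move=> aM; apply: rpred_prod => A _; apply: memv_gal. Qed.

Lemma rel_norm_gal (g : gal_of M) a : a \in M -> g (rel_norm a) = \prod_(h in H) (h * g)%g a.
Proof. by move=> aM; rewrite rmorph_prod; apply: eq_bigr => h _ /=; rewrite galM. Qed.

Lemma rel_norm_fixed (h : gal_of M) a : h \in H -> a \in M -> h (rel_norm a) = rel_norm a.
Proof.
move=> hH aM; rewrite rel_norm_gal // [RHS](reindex_inj (mulIg h)) /=.
by apply: eq_bigl => g; rewrite groupMr.
Qed.

Lemma rel_trace_gal (g : gal_of M) a : a \in M ->
  g (rel_trace a) = \sum_(A in rcosets H J) (repr A * g)%g a.
Proof. by move=> aM; rewrite rmorph_sum; apply: eq_bigr => A _ /=; rewrite galM. Qed.

Lemma repr_rcoset_gal (g : gal_of M) a : a \in M -> (forall h, h \in H -> h a = a) ->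
  repr (H :* g)%g a = g a.
Proof.
move=> aM aH; have := mem_repr_rcoset H g; case/rcosetP => h hH ->.
by rewrite galM // aH.
Qed.

Lemma repr_rcosets_mem A : A \in rcosets H J -> repr A \in J.
Proof.
move=> /rcosetsP[g gJ ->]; have := mem_repr_rcoset H g; case/rcosetP => h hH ->.
by rewrite groupM // (fintype.subsetP sHJ).
Qed.

Lemma rel_trace_fixed (g : gal_of M) a : g \in J -> a \in M -> (forall h, h \in H -> h a = a) ->
  g (rel_trace a) = rel_trace a.
Proof.
move=> gJ aM aH; rewrite rel_trace_gal // /rel_trace.
have ginj : injective (fun A : {set gal_of M} => (A :* g)%g).
  move=> A B /(congr1 (fun C : {set gal_of M} => (C :* g^-1)%g)).
  by rewrite -!rcosetM mulgV !rcoset1.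
rewrite [RHS](reindex_inj ginj) /=.
have memg A : ((A :* g)%g \in rcosets H J) = (A \in rcosets H J).
  apply/rcosetsP/rcosetsP => [[k kJ e]|[k kJ ->]].
    exists (k * g^-1)%g; rewrite ?groupM ?groupV //.
    by rewrite rcosetM -e -rcosetM mulgV rcoset1.
  by exists (k * g)%g; rewrite ?groupM // rcosetM.
apply: eq_big => [A|A AJ]; first by rewrite memg.
case/rcosetsP: AJ => k kJ ->; rewrite -rcosetM repr_rcoset_gal //.
have := mem_repr_rcoset H k; case/rcosetP => h hH ->.
by rewrite -mulgA galM // aH.
Qed.

End RelTrace.

Section TamePairing.
Variables (F : fieldType) (Om : splittingFieldType F).
Variables (K M : {subfield Om}) (v : valuation K) (x : valuation M).
Hypotheses (nKM : normalField K M) (xv : extends x v).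
Let sKM : (K <= M)%VS := extends_sub xv.
Local Notation G := 'Gal(M / K)%g.
Local Notation D := (decomp_group x K).
Local Notation I := (inertia_group x K).
Local Notation p := (char_exp x).
Local Notation l := (residue x).

Let DG g : g \in D -> g \in G. Proof. exact: (fintype.subsetP (decomp_sub x K)). Qed.
Let ID g : g \in I -> g \in D. Proof. exact: (fintype.subsetP (inertia_sub x K)). Qed.

Definition tame (g : gal_of M) c : l := res x (g c / c).

Lemma decomp_div_ring g c : g \in D -> c \in M -> c != 0 -> g c / c \in vring x.
Proof. by move=> gD cM c0; apply: vunit_ring (decomp_unit xv gD cM c0). Qed.

Lemma tame_neq0 g c : g \in D -> c \in M -> c != 0 -> tame g c != 0.
Proof. by move=> gD cM c0; rewrite -vunit_resP (decomp_unit xv). Qed.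

Lemma tameMr g a c : g \in D -> a \in M -> c \in M -> a != 0 -> c != 0 ->
  tame g (a * c) = tame g a * tame g c.
Proof.
move=> gD aM cM a0 c0; rewrite /tame -resM ?decomp_div_ring //.
by rewrite galr_mul invfM mulrACA.
Qed.

Lemma tameXr g c n : g \in D -> c \in M -> c != 0 -> tame g (c ^+ n) = tame g c ^+ n.
Proof.
move=> gD cM c0; elim: n => [|n IHn].
  by rewrite !expr0 /tame galr_one divff ?oner_eq0 // res1.
by rewrite !exprS tameMr ?rpredX ?expf_neq0 // IHn.
Qed.

Lemma inertia_res g a : g \in I -> a \in vring x -> res x (g a) = res x a.
Proof. by move=> /inertiaP[_]; apply. Qed.

Lemma tame_unit g u : g \in I -> u \in vunit x -> tame g u = 1.
Proof.
move=> gI uu; have uV := vunit_ringV uu; have uR := vunit_ring uu.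
have guR : g u \in vring x by rewrite (decomp_ring (ID gI)) ?(vring_sub uR).
rewrite /tame resM // (inertia_res gI uR) resV // divff //.
by rewrite -vunit_resP.
Qed.

Lemma tame_base g d : g \in G -> d \in K -> d != 0 -> tame g d = 1.
Proof. by move=> gG dK d0; rewrite /tame (fixed_gal sKM gG dK) divff // res1. Qed.

Lemma tame_same g a c : g \in I -> a \in M -> c \in M -> a != 0 -> c != 0 ->
  same_coset x K a c -> tame g a = tame g c.
Proof.
move=> gI aM cM a0 c0 [d [dK d0 u]].
have dM := subvP sKM _ dK; have gD := ID gI.
have -> : a = a / (d * c) * (d * c) by rewrite divfK ?mulf_neq0.
rewrite tameMr ?rpred_div ?rpredM ?mulf_neq0 ?invr_eq0 ?mulf_neq0 //.
by rewrite tame_unit // mul1r tameMr // tame_base ?mul1r // DG.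
Qed.

(** The factor [h (g c / c)] of [(g * h) c / c] is still congruent to 1: [h] may move residues, but
    it preserves the maximal ideal. *)
Lemma tameMl g h c : g \in I -> h \in D -> c \in M -> c != 0 ->
  tame g c = 1 -> tame (g * h)%g c = tame h c.
Proof.
move=> gI hD cM c0 gc; have gD := ID gI.
have gcM := memv_gal g cM.
have -> : tame (g * h)%g c = res x (h (g c / c)) * tame h c.
  rewrite /tame -resM ?decomp_div_ring //.
    by rewrite galM // galr_mul galr_inv -mulrA mulKf ?galr_eq0.
  by rewrite (decomp_ring hD) ?decomp_div_ring // rpred_div.
have /res_eq1P h1 : res x (h (g c / c)) = 1.
  apply/res_eq1P; rewrite -(galr_one h) -galr_sub (decomp_max hD) ?rpredB ?rpred1 ?rpred_div //.
  exact/res_eq1P.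
by move/res_eq1P: h1 => ->; rewrite mul1r.
Qed.

Lemma tameM_inertia g h c : g \in I -> h \in I -> c \in M -> c != 0 ->
  tame (g * h)%g c = tame g c * tame h c.
Proof.
move=> gI hI cM c0; have [gD hD] := (ID gI, ID hI).
have gcM := memv_gal g cM.
rewrite /tame -(inertia_res hI (decomp_div_ring gD cM c0)) -resM ?decomp_div_ring //.
  by rewrite galM // galr_mul galr_inv -[in RHS]mulrA mulKf ?galr_eq0.
by rewrite (decomp_ring hD) ?decomp_div_ring // rpred_div.
Qed.

Lemma ramifP g : (g \in ramif_group x K) <->
  (g \in I /\ forall c, c \in M -> c != 0 -> tame g c = 1).
Proof.
split=> [/finset.setIdP[gI /asboolP]|[gI h]] //.
by apply/finset.setIdP; split=> //; apply/asboolP.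
Qed.

Lemma ramif_group_set : group_set (ramif_group x K).
Proof.
apply/group_setP; split=> [|g h /ramifP[gI gV] /ramifP[hI hV]]; apply/ramifP.
  split=> [|c cM c0]; first exact: group1.
  by rewrite /tame gal_id divff // res1.
split=> [|c cM c0]; first exact: groupM.
by rewrite tameM_inertia // gV // hV // mulr1.
Qed.

(** Outside D the value of [g c / c] is not controlled, so a lift [a] vanishing at the other
    conjugates does not suffice. Take a unit [e = c ^+ n / s] with [s] in K and its common
    denominator [y]. With the extra factor [y], the [n]-th power of [g (a * y * c) / c] becomes an
    integral element times [g a ^+ n]. *)
Lemma scaled_lift c beta : c \in M -> c != 0 -> exists b,
  [/\ b \in vring x, res x b = beta &
      forall g, g \in G -> g \notin D -> g (b * c) / c \in vmaxid x].
Proof.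
move=> cM c0; have [n [s [n0 sK s0 eu]]] := coset_torsion x sKM cM c0.
set e := c ^+ n / s in eu; have eM : e \in M := vunit_sub eu.
have [a1 a1x <-] := res_surj beta.
have [a [aO a1a aD]] := decomp_lift xv a1x.
have [y yM yP] := common_denominator v eM sKM.
have ax := aO _ xv; have aM := vring_sub ax.
have [yx yex /(_ (vunit_ring eu)) y1] := yP _ xv.
exists (a * y); split; first by rewrite rpredM.
  rewrite resM //; move/res_eq1P: y1 => ->; rewrite mulr1.
  exact/res_eqP.
move=> g gG gD.
have gext : extends (vconj x g^-1%g) v by apply: vconj_extends; rewrite ?groupV.
have gx u : u \in M -> u \in vring (vconj x g^-1%g) -> g u \in vring x.
  by move=> uM uV; rewrite -(vconjKV x g) vconj_gal.
have [gy gye _] := yP _ gext.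
have gyx : g y \in vring x by apply: gx.
have gyex : g (y * e) \in vring x by apply: gx => //; rewrite rpredM.
have gam : g a \in vmaxid x by apply: aD.
apply: (@vmaxidXE _ _ _ _ _ n); first by rewrite rpred_div ?memv_gal ?rpredM.
have -> : (g (a * y * c) / c) ^+ n = g (y * e) * (g y ^+ n.-1) * e^-1 * g a ^+ n.
  have gs : g s = s := fixed_gal sKM gG sK.
  have gc : g c ^+ n = s * g e.
    by rewrite -galr_exp -{1}gs -galr_mul /e mulrC divfK.
  have cn : c ^+ n = s * e by rewrite /e mulrC divfK.
  rewrite expr_div_n !galr_mul !exprMn gc cn -{2}(prednK n0) exprS.
  by field; rewrite (vunit_neq0 eu) fmorph_eq0 s0.
apply: vmaxidM; last exact: vmaxidX.
apply: rpredM; last exact: vunit_ringV.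
by apply: rpredM => //; apply: rpredX.
Qed.

End TamePairing.

Section CharExp.
Variables (F : fieldType) (Om : fieldExtType F) (E : {subfield Om}) (x : valuation E).
Local Notation p := (char_exp x).
Local Notation l := (residue x).

Lemma char_exp_prime q : q \in [pchar l] -> p = q.
Proof.
rewrite /char_exp; case: xgetP => [p' _ /= p'l ql|none ql]; last by case: (none q).
have pp : prime q by case/andP: ql.
have d : (p' %| q)%N by rewrite (dvdn_pcharf p'l) (pcharf0 ql).
by apply/eqP; rewrite -dvdn_prime2 // (pcharf_prime p'l).
Qed.

Lemma char_exp_pchar : prime p -> p \in [pchar l].
Proof. by rewrite /char_exp; case: xgetP => [p' _ /= p'l|none]. Qed.

Lemma char_exp_case : p = 1%N \/ prime p.
Proof.
by rewrite /char_exp; case: xgetP => [p' _ /= /pcharf_prime|none]; [right|left].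
Qed.

(** When the residue characteristic is 0, [p = 1] and both sides mean [r = 1]. *)
Lemma char_exp_pnat r : p.-nat r = [pchar l].-nat r.
Proof.
apply/idP/idP; apply: sub_in_pnat => q; rewrite mem_primes => /andP[pq _].
  by rewrite inE => /eqP e; rewrite e in pq *; apply: char_exp_pchar.
by move=> ql; rewrite inE (char_exp_prime ql).
Qed.

Lemma natr_residue_neq0 n : p^'.-nat n -> n%:R != 0 :> l.
Proof.
move=> pn; have n0 : (0 < n)%N by case/andP: pn.
apply/negP => e; have [q ql] := natf0_pchar n0 e.
have qn : (q %| n)%N by rewrite (dvdn_pcharf ql).
have := pnatPpi pn (_ : q \in \pi(n)); rewrite mem_primes (pcharf_prime ql) n0 qn.
by move=> /(_ isT); rewrite !inE (char_exp_prime ql) eqxx.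
Qed.

End CharExp.

Section TameKernel.
Variables (F : fieldType) (Om : splittingFieldType F).
Variables (K M : {subfield Om}) (v : valuation K) (x : valuation M).
Hypotheses (nKM : normalField K M) (xv : extends x v).
Let sKM : (K <= M)%VS := extends_sub xv.
Local Notation G := 'Gal(M / K)%g.
Local Notation D := (decomp_group x K).
Local Notation I := (inertia_group x K).
Local Notation p := (char_exp x).
Local Notation l := (residue x).

Let DG g : g \in D -> g \in G. Proof. exact: (fintype.subsetP (decomp_sub x K)). Qed.
Let ID g : g \in I -> g \in D. Proof. exact: (fintype.subsetP (inertia_sub x K)). Qed.

Lemma repr_decomp A : A \in rcosets I D -> repr A \in D.
Proof. exact: repr_rcosets_mem (inertia_sub x K) A. Qed.

Lemma repr_decomp_inj A B : A \in rcosets I D -> B \in rcosets I D ->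
  (repr A * (repr B)^-1)%g \in I -> A = B.
Proof.
move=> /rcosetsP[g gD ->] /rcosetsP[h hD ->].
have := mem_repr_rcoset (inertia_Group x K) g; case/rcosetP => i iI ->.
have := mem_repr_rcoset (inertia_Group x K) h; case/rcosetP => j jI ->.
rewrite invMg !mulgA groupMr ?groupV // -mulgA groupMl // => gh.
by apply: rcoset_eqP; rewrite mem_rcoset.
Qed.

(* By Dedekind independence of the automorphisms of the residue field,
   composed with a power of Frobenius. *)
Lemma tame_trace_neq0 r c : [pchar l].-nat r -> c \in M -> c != 0 ->
  exists beta : l, \sum_(A in rcosets I D)
    (tame x (repr A) c * res x (repr A (res_lift beta))) ^+ r != 0.
Proof.
move=> rl cM c0; apply: contrapT => none.
pose rep (i : 'I_#|rcosets I D|) : gal_of M := repr (enum_val i).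
have repD i : rep i \in D by apply/repr_decomp/enum_valP.
pose chi i (t : l) := residue_gal (repD i) t ^+ r.
have chiE i t : chi i t = res x (rep i (res_lift t)) ^+ r by [].
have one : (I :* 1%g)%g \in rcosets I D by apply/rcosetsP; exists 1%g; rewrite ?group1.
pose i1 : 'I_#|rcosets I D| := enum_rank_in one (I :* 1%g)%g.
have a0 i : tame x (rep i) c ^+ r != 0 by rewrite expf_neq0 // (tame_neq0 xv).
case/eqP: (a0 i1).
apply: (@characters_independent _ _ *%R (fun=> True) _ chi _ _ _ _ (fun i => tame x (rep i) c ^+ r)) => //.
- by move=> i s t _ _; rewrite /chi rmorphM exprMn.
- by move=> i; exists 1; rewrite // /chi rmorph1 expr1n oner_eq0.
- move=> i j ij; apply: contrapT => nex; case/eqP: ij; apply: enum_val_inj.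
  apply: (repr_decomp_inj (enum_valP i) (enum_valP j)).
  apply/(inertia_mod (repD i) (repD j)) => a ax.
  rewrite -(residue_galE (repD i) ax) -(residue_galE (repD j) ax).
  apply: (pchar_nat_expI rl) => /=; apply: contrapT => /eqP ne; apply: nex.
  by exists (res x a).
move=> t _; apply: contrapT => /eqP ne; apply: none; exists t.
rewrite big_enum_val /=.
have -> // : \sum_(i < #|rcosets I D|) (tame x (repr (enum_val i)) c *
    res x (repr (enum_val i) (res_lift t))) ^+ r = \sum_i tame x (rep i) c ^+ r * chi i t.
by apply: eq_bigr => i _; rewrite exprMn chiE.
Qed.

(** A trace over all of I would multiply residues by |I|, which is 0 in the residue field when p
    divides it. The norm over a Sylow p-subgroup P only raises them to the power r = |P|, and the
    remaining trace from P to I contributes the factor [I:P], prime to p. *)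
Lemma tame_trivial_torsion c : c \in M -> c != 0 ->
  (forall g, g \in I -> tame x g c = 1) ->
  exists2 r, p.-nat r & same_coset x K (c ^+ r) 1.
Proof.
move=> cM c0 cI.
have [P] := Sylow_exists p (inertia_Group x K).
case/and3P=> /= sPI pP p'P.
have sPD g : g \in P -> g \in I := fintype.subsetP sPI g.
pose r := #|P|; have rl : [pchar l].-nat r by rewrite -char_exp_pnat.
have [beta nz] := tame_trace_neq0 rl cM c0.
have [b [bx bbeta bD]] := scaled_lift xv beta cM c0.
have bM := vring_sub bx; have bcM : b * c \in M by rewrite rpredM.
(* The residue of [g (b * c) / c] for [g] in D. By the hypothesis on [c] it depends only on the
   coset of [g] modulo I, so the norm and the inner trace act on it by a power and a multiple. *)
pose psi g : l := tame x g c * res x (g b).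
have psiM (k g : gal_of M) : k \in I -> g \in D -> psi (k * g)%g = psi g.
  move=> kI gD; rewrite /psi (tameMl xv kI gD cM c0 (cI k kI)) galM //.
  congr (_ * _); apply: (res_gal_eq gD) => //; last exact: (inertia_res kI bx).
  by rewrite (decomp_ring (ID kI)).
have gbx (g : gal_of M) : g \in D -> g b \in vring x by move=> gD; rewrite (decomp_ring gD).
have bcx (g : gal_of M) : g \in D -> g (b * c) / c \in vring x /\ res x (g (b * c) / c) = psi g.
  move=> gD; have gcc := decomp_div_ring xv gD cM c0.
  rewrite galr_mul -mulrA; split; first by rewrite rpredM ?gbx.
  by rewrite resM ?gbx // mulrC.
pose N := rel_norm P (b * c); have NM : N \in M by apply: rel_norm_mem.
have gN (g : gal_of M) : g N / c ^+ r = \prod_(h in P) ((h * g)%g (b * c) / c).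
  by rewrite rel_norm_gal // big_split /= prodr_const exprVn.
have PgD h g : h \in P -> g \in D -> (h * g)%g \in D.
  by move=> hP gD; rewrite groupM // ID // sPD.
have Nx (g : gal_of M) : g \in D -> g N / c ^+ r \in vring x /\ res x (g N / c ^+ r) = psi g ^+ r.
  move=> gD; rewrite gN.
  have h1 h : h \in P -> (h * g)%g (b * c) / c \in vring x.
    by move=> hP; case: (bcx _ (PgD _ _ hP gD)).
  split; first by apply: rpred_prod.
  rewrite res_prod // -prodr_const; apply: eq_bigr => h hP.
  by rewrite (bcx _ (PgD _ _ hP gD)).2 psiM // sPD.
have gNm (g : gal_of M) : g \in G -> g \notin D -> g N / c ^+ r \in vmaxid x.
  move=> gG gD; rewrite gN.
  have h1 h : h \in P -> (h * g)%g (b * c) / c \in vmaxid x.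
    move=> hP; have hD := ID (sPD _ hP).
    by apply: bD; [rewrite groupM // DG|rewrite groupMl].
  apply: (vmaxid_prod (i := 1%g)) => [h /h1/vmaxidW||] //.
  exact/h1/group1.
pose W := rel_trace P I N; have WM : W \in M by apply: rel_trace_mem.
have Wfix h : h \in I -> h W = W.
  by move=> hI; apply: rel_trace_fixed => // k kP; apply: rel_norm_fixed.
have rI A : A \in rcosets P I -> repr A \in I := @repr_rcosets_mem _ _ _ P (inertia_Group x K) sPI A.
have gW (g : gal_of M) : g W / c ^+ r = \sum_(A in rcosets P I) ((repr A * g)%g N / c ^+ r).
  by rewrite rel_trace_gal // mulr_suml.
have Wx (g : gal_of M) : g \in D -> g W / c ^+ r \in vring x /\
    res x (g W / c ^+ r) = psi g ^+ r * #|I : P|%g%:R.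
  move=> gD; rewrite gW.
  have h1 A : A \in rcosets P I -> (repr A * g)%g \in D.
    by move=> AI; rewrite groupM // ID // rI.
  split; first by apply: rpred_sum => A AI; case: (Nx _ (h1 A AI)).
  rewrite res_sum => [|A AI]; last by case: (Nx _ (h1 A AI)).
  rewrite (eq_bigr (fun=> psi g ^+ r)) => [|A AI].
    by rewrite sumr_const mulr_natr.
  by rewrite (Nx _ (h1 A AI)).2 psiM // rI.
have gWm (g : gal_of M) : g \in G -> g \notin D -> g W / c ^+ r \in vmaxid x.
  move=> gG gD; rewrite gW; apply: vmaxid_sum => A AI.
  have aD := ID (rI A AI); by apply: gNm; [rewrite groupM // DG|rewrite groupMl].
pose T := rel_trace I G W; have TM : T \in M by apply: rel_trace_mem.
have sIG : I \subset G by apply/fintype.subsetP => g /ID/DG.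
have TG : T \in fixedField G.
  apply/fixedFieldP => // g gG.
  exact: (@rel_trace_fixed _ _ _ (inertia_Group x K) 'Gal(M / K)%G).
have Tu : T / c ^+ r \in vunit x.
  (* Cosets inside D give the sum of [tame_trace_neq0] times [I:P]; the others fall into the maximal
     ideal by the choice of [b]. *)
  rewrite vunit_resP /T /rel_trace mulr_suml (bigID (mem (rcosets I D))) /=.
  set S1 := \sum_(A in _ | _) _; set S2 := \sum_(A in _ | _) _.
  have S1E : S1 = \sum_(A in rcosets I D) repr A W / c ^+ r.
    apply: eq_bigl => A; apply: andb_idl => /rcosetsP[g gD ->].
    by apply/rcosetsP; exists g; rewrite ?DG.
  have S1x : S1 \in vring x.
    by rewrite S1E; apply: rpred_sum => A /repr_decomp/Wx[].
  have S2m : S2 \in vmaxid x.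
    apply: vmaxid_sum => A /andP[AG AD]; apply: gWm.
      exact: (repr_rcosets_mem sIG AG).
    apply: contra AD => rD; apply/rcosetsP; exists (repr A) => //.
    case/rcosetsP: AG => g gG ->; apply/esym/rcoset_eqP.
    exact: (mem_repr_rcoset (inertia_Group x K)).
  rewrite (resD S1x (vmaxidW S2m)) (res_max S2m) (addr0 (res x S1)) S1E.
  rewrite res_sum => [|A /repr_decomp/Wx[]//].
  pose f A := (tame x (repr A) c * res x (repr A (res_lift beta))) ^+ r.
  have fE A : A \in rcosets I D ->
      res x (repr A W / c ^+ r) = f A * #|I : P|%g%:R.
    move=> /repr_decomp AD; rewrite (Wx _ AD).2 /psi /f; congr ((_ * _) ^+ r * _).
    by apply: (res_gal_eq AD) => //; rewrite ?res_liftP // res_liftK.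
  rewrite (eq_bigr _ fE).
  have <- := mulr_suml (index_enum _) (mem (rcosets I D)) f (#|I : P|%g%:R : l).
  exact: (mulf_neq0 nz (natr_residue_neq0 p'P)).
have T0 : T != 0 by apply: contraTneq Tu => ->; rewrite mul0r vunitE eqxx.
(* [T] is fixed by G, so its [q]-th power is in K; the exponent of [c] becomes [r * q], still a
   power of p. *)
have [q qn Tq] := expr_fixed sKM nKM TG.
exists (r * q)%N.
  by rewrite char_exp_pnat pnatM rl (pchar_residue x qn).
exists (T ^+ q); rewrite expf_neq0 //; split=> //.
by rewrite mulr1 -vunitV invf_div exprM -expr_div_n vunitX.
Qed.

End TameKernel.

Lemma coprime_pnat p m : (0 < m)%N -> p = 1%N \/ prime p -> coprime m p = p^'.-nat m.
Proof.
move=> m0 [->|pp]; last by rewrite coprime_sym prime_coprime // p'natE.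
rewrite coprimen1; apply/esym; rewrite /pnat m0; apply/allP => q.
by rewrite mem_primes !inE => /andP[/prime_gt1 q1 _]; rewrite neq_ltn q1 orbT.
Qed.

(** The p'-part of [e] is itself one of the divisors in the lcm, and all others divide it. For
    [p = 1] it is [e]. *)
Lemma biglcm_part p e : (0 < e)%N -> p = 1%N \/ prime p ->
  \big[lcmn/1%N]_(1 <= m < e.+1 | (m %| e)%N && coprime m p) m = partn e p^'.
Proof.
move=> e0 hp; apply/eqP; rewrite eqn_dvd; apply/andP; split.
  apply: (big_ind (fun m => (m %| (partn e p^'))%N)) => [|a b ha hb|m /andP[me mp]].
  - exact: dvd1n.
  - by rewrite dvdn_lcm ha hb.
  have m0 := dvdn_gt0 e0 me; rewrite coprime_pnat // in mp.
  by rewrite -(part_pnat_id mp) partn_dvd.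
have ep : ((partn e p^') %| e)%N && coprime (partn e p^') p.
  by rewrite dvdn_part coprime_pnat ?part_gt0 // part_pnat.
rewrite -big_filter (bigD1_seq (partn e p^')) /= ?dvdn_lcml ?filter_uniq ?iota_uniq //.
by rewrite mem_filter ep mem_index_iota part_gt0 ltnS dvdn_leq // dvdn_part.
Qed.

Section TameIndex.
Variables (F : fieldType) (Om : splittingFieldType F).
Variables (K M : {subfield Om}) (v : valuation K) (x : valuation M).
Hypotheses (nKM : normalField K M) (xv : extends x v).
Let sKM : (K <= M)%VS := extends_sub xv.
Local Notation I := (inertia_group x K).
Local Notation V := (ramif_group x K).
Local Notation p := (char_exp x).
Local Notation same := (same_coset x K).

Section Reps.
Variables (n : nat) (c : 'I_n -> Om).
Hypothesis cr : coset_reps x K c.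
Let cM i : c i \in M. Proof. by case: cr. Qed.
Let c0 i : c i != 0. Proof. by case: cr. Qed.
Let cG a : a \in M -> a != 0 -> exists i, same a (c i). Proof. by case: cr => _ _ h _; apply: h. Qed.
Let cI i j : same (c i) (c j) -> i = j. Proof. by case: cr => _ _ _; apply. Qed.

Let cls_ex : exists f : Om -> 'I_n, forall a, a \in M -> a != 0 -> same a (c (f a)).
Proof.
have ex a : exists i, a \in M -> a != 0 -> same a (c i).
  have [/andP[aM a0]|na] := boolP ((a \in M) && (a != 0)).
    by have [i ai] := cG aM a0; exists i.
  have [i _] := cG (rpred1 M) (oner_neq0 _).
  by exists i => aM a0; rewrite aM a0 in na.
by have [f fP] := choice ex; exists f.
Qed.
Let cls := proj1_sig (cid cls_ex).
Let clsP a : a \in M -> a != 0 -> same a (c (cls a)).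
Proof. exact: (proj2_sig (cid cls_ex)). Qed.

Let cls_eq a i : a \in M -> a != 0 -> same a (c i) -> cls a = i.
Proof.
move=> aM a0 ai; apply: cI; apply: (same_coset_trans a0) ai.
exact/same_coset_sym/clsP.
Qed.

Let ccM i j : c i * c j \in M. Proof. by rewrite rpredM. Qed.
Let cc0 i j : c i * c j != 0. Proof. by rewrite mulf_neq0. Qed.

Let trans_inj i : injective (fun j => cls (c i * c j)).
Proof.
move=> j k e; apply: cI; apply: (same_coset_mulI (c0 i)).
apply: (same_coset_trans (c0 (cls (c i * c j)))); first exact: clsP.
by rewrite e; apply/same_coset_sym/clsP.
Qed.

(* The quotient of the value groups is realised as a group of permutations of
   the coset representatives. *)
Let t i : {perm 'I_n} := perm (@trans_inj i).

Let tE i j : t i j = cls (c i * c j). Proof. by rewrite permE. Qed.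

(** The index of the trivial coset, whose representative need not be 1. Evaluating the permutation
    [t i] at it recovers [i]. *)
Let e1 := cls 1.
Let c_e1 : same 1 (c e1). Proof. by apply: clsP; rewrite ?rpred1 ?oner_neq0. Qed.

Let t_e1 i : t i e1 = i.
Proof.
rewrite tE; apply: cls_eq => //.
have := same_cosetM (same_coset_refl x K (c0 i)) (same_coset_sym c_e1).
by rewrite mulr1.
Qed.

Let t_inj : injective t.
Proof. by move=> i j e; rewrite -(t_e1 i) -(t_e1 j) e. Qed.

Let tM i j : (t i * t j)%g = t (cls (c i * c j)).
Proof.
apply/permP => k; rewrite permM !tE; apply: cls_eq => //.
apply: (same_coset_trans (b := c j * (c i * c k))); first exact: mulf_neq0.
  apply: same_cosetM; first exact: same_coset_refl.
  exact/same_coset_sym/clsP.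
rewrite mulrCA mulrA.
apply: (same_coset_trans (b := c (cls (c i * c j)) * c k)); first exact: mulf_neq0.
  by apply: same_cosetM; [apply: clsP|apply: same_coset_refl].
exact: clsP.
Qed.

Let Q := [set t i | i : 'I_n].

Let Q_group_set : group_set Q.
Proof.
apply/group_setP; split=> [|_ _ /imsetP[i _ ->] /imsetP[j _ ->]]; last first.
  by apply/imsetP; exists (cls (c i * c j)).
apply/imsetP; exists e1 => //; apply/permP => k; rewrite perm1 tE; apply/esym/cls_eq => //.
have := same_cosetM (same_coset_sym c_e1) (same_coset_refl x K (c0 k)).
by rewrite mul1r.
Qed.
Let QG := Group Q_group_set.

Let cardQ : #|Q| = n.
Proof. by rewrite card_imset // card_ord. Qed.

Let Qabel : abelian QG.
Proof.
apply/centsP => _ /imsetP[i _ ->] _ /imsetP[j _ ->]; rewrite /commute !tM.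
by rewrite mulrC.
Qed.

Let tX i m : (t i ^+ m)%g = t (cls (c i ^+ m)).
Proof.
elim: m => [|m IHm].
  rewrite expg0 expr0; apply/permP => k; rewrite perm1 tE; apply/esym/cls_eq => //.
  have := same_cosetM (same_coset_sym c_e1) (same_coset_refl x K (c0 k)).
  by rewrite mul1r.
rewrite expgS IHm tM; congr t; apply: cls_eq => //.
apply: (same_coset_trans (b := c i ^+ m.+1)); first exact: expf_neq0.
  rewrite exprS; apply: same_cosetM; first exact: same_coset_refl.
  by apply/same_coset_sym/clsP; rewrite ?rpredX ?expf_neq0.
by apply: clsP; rewrite ?rpredX ?expf_neq0.
Qed.

Let B := 'O_p^'(QG)%G.
Let sBQ : B \subset QG. Proof. exact: pcore_sub. Qed.

Let cardB : #|B| = (partn n p^').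
Proof. by rewrite (card_Hall (nilpotent_pcore_Hall p^' (abelian_nil Qabel))) /= cardQ. Qed.

Let pair g (s : {perm 'I_n}) := tame x g (c (s e1)).

Let sVI : V \subset I. Proof. by apply/fintype.subsetP => g /ramifP[]. Qed.
Let ID g : g \in I -> g \in decomp_group x K.
Proof. exact: (fintype.subsetP (inertia_sub x K)). Qed.

Lemma ramif_index_reps : #|I : V|%g = (partn n p^').
Proof.
pose VG := Group (ramif_group_set xv).
rewrite -cardB.
have BE s : s \in B -> exists i, s = t i.
  by move=> /(fintype.subsetP sBQ)/imsetP[i _ ->]; exists i.
apply: (@pairing_card (residue x) _ _ (inertia_Group x K) VG B pair) => //.
- by move=> g h s gI hI _; apply: (tameM_inertia xv).
- move=> g s s' gI /BE[i ->] /BE[j ->]; rewrite /pair tM !t_e1.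
  rewrite -(tameMr xv (ID gI)) //; apply/esym.
  by apply: (tame_same xv gI) => //; apply: clsP.
- by move=> g s gI _; apply: (tame_neq0 xv (ID gI)).
- move=> g gI; split=> [h|/ramifP[_ h] s _]; last exact: h.
  apply/ramifP; split=> // a aM a0; have gD := ID gI.
  have [i ai] := cG aM a0; rewrite (tame_same xv gI aM (cM i) a0 (c0 i) ai).
  (* The [r]-th power of any coset lies in the p'-part, where [g] pairs trivially; injectivity of
     Frobenius on the residue field removes the exponent. *)
  pose r := partn n p; have rl : [pchar residue x].-nat r by rewrite -char_exp_pnat part_pnat.
  apply: (pchar_nat_expI rl); rewrite /= expr1n -(tameXr xv _ gD) //.
  have tQ : t i \in QG by apply/imsetP; exists i.
  have tB : (t i ^+ r)%g \in B.
    rewrite /= (mem_normal_Hall (nilpotent_pcore_Hall p^' (abelian_nil Qabel))) ?pcore_normal //.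
      apply: (pnat_dvd _ (part_pnat p^' n)); rewrite order_dvdn -expgM partnC.
        by rewrite -order_dvdn; have := order_dvdG tQ; rewrite /= cardQ.
      by have := cardG_gt0 QG; rewrite /= cardQ.
    by rewrite groupX.
  rewrite -(h _ tB) /pair tX t_e1; apply: (tame_same xv gI); rewrite ?rpredX ?expf_neq0 //.
  by apply: clsP; rewrite ?rpredX ?expf_neq0.
move=> s sB h; have [i si] := BE s sB.
have ti : forall g, g \in I -> tame x g (c i) = 1.
  by move=> g gI; rewrite -(h g gI) /pair si t_e1.
(* Hence [s] has p-power order in a group of order prime to p. *)
have [r pr rsame] := tame_trivial_torsion nKM xv (cM i) (c0 i) ti.
have s1 : (s ^+ r = 1)%g.
  rewrite si tX (_ : cls (c i ^+ r) = e1); last first.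
    apply: cls_eq; rewrite ?rpredX ?expf_neq0 //.
    exact: (same_coset_trans (oner_neq0 _) rsame).
  by rewrite -(tX e1 0) expg0.
have p's : (p^'.-elt s)%g by apply: mem_p_elt sB; apply: pcore_pgroup.
apply/eqP; rewrite -order_eq1 -dvdn1.
have pt : p.-nat #[s]%g by apply: pnat_dvd pr; rewrite order_dvdn s1.
by rewrite (pnat_1 pt p's).
Qed.

End Reps.

End TameIndex.

Section TameDegree.
Variables (F : fieldType) (Om : splittingFieldType F).
Variables (K L : {subfield Om}) (v : valuation K) (w : valuation L).
Hypothesis wv : extends w v.

Lemma val_etE : val_et w v = partn (val_e w v) (char_exp w)^'.
Proof.
rewrite /val_et -(char_exp_extends wv); apply: biglcm_part (char_exp_case w).
exact: val_e_gt0 wv.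
Qed.

Lemma val_et_gt0 : (0 < val_et w v)%N.
Proof. by rewrite val_etE part_gt0. Qed.

End TameDegree.

Section TameIndexTower.
Variables (F : fieldType) (Om : splittingFieldType F).
Variables (K L M : {subfield Om}).
Variables (v : valuation K) (w : valuation L) (x : valuation M).
Hypotheses (nKM : normalField K M) (xv : extends x v) (xw : extends x w) (wv : extends w v).

Lemma ramif_index : #|inertia_group x K : ramif_group x K|%g = val_et x v.
Proof.
have [n [c cr]] := coset_reps_exists x (extends_sub xv).
rewrite (ramif_index_reps nKM xv cr) (val_etE xv).
by rewrite (val_e_reps xv cr) card_ord.
Qed.

Lemma val_et_tower : val_et x v = (val_et x w * val_et w v)%N.
Proof.
rewrite (val_etE xv) (val_etE xw) (val_etE wv) -(char_exp_extends xw).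
rewrite (val_e_tower wv xw) partnM //; first exact: val_e_gt0 xw.
exact: val_e_gt0 wv.
Qed.

End TameIndexTower.

(** * Decomposition, inertia and ramification fields *)

Section RelativeGroups.
Variables (F : fieldType) (Om : splittingFieldType F).
Variables (K L M : {subfield Om}) (x : valuation M).
Hypotheses (sKL : (K <= L)%VS).

Lemma decomp_group_sub : decomp_group x L = decomp_group x K :&: 'Gal(M / L)%g.
Proof.
apply/setP => g; rewrite finset.in_setI !decomp_groupE.
have [gL|] := boolP (g \in 'Gal(M / L)%g); last by rewrite andbF.
by rewrite (fintype.subsetP (galS M sKL) _ gL) andbT.
Qed.

Lemma inertia_group_sub : inertia_group x L = inertia_group x K :&: 'Gal(M / L)%g.
Proof.
apply/setP => g; rewrite finset.in_setI; apply/inertiaP/andP.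
  rewrite decomp_group_sub finset.in_setI => -[/andP[gD gL] h]; split=> //.
  exact/inertiaP.
case=> /inertiaP[gD h] gL; split=> //.
by rewrite decomp_group_sub finset.in_setI gD.
Qed.

Lemma ramif_group_sub : ramif_group x L = ramif_group x K :&: 'Gal(M / L)%g.
Proof.
apply/setP => g; rewrite finset.in_setI; apply/idP/andP.
  move/ramifP; rewrite inertia_group_sub finset.in_setI => -[/andP[gI gL] h]; split=> //.
  exact/ramifP.
case=> /ramifP[gI h] gL; apply/ramifP; split=> //.
by rewrite inertia_group_sub finset.in_setI gI.
Qed.

End RelativeGroups.

Section FixedDegrees.
Variables (F : fieldType) (Om : splittingFieldType F).
Variables (K L M : {subfield Om}).
Hypotheses (nKM : normalField K M) (sKL : (K <= L)%VS) (sLM : (L <= M)%VS).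
Let sKM := subv_trans sKL sLM.

Lemma sep_fixedS (A B : {set gal_of M}) :
  B \subset A -> (sep_fixed K A <= sep_fixed L B)%VS.
Proof.
move=> sBA; apply/subvP => a /memv_capP[aA].
rewrite mem_sep_subfield // => /andP[aM aK].
apply/memv_capP; split; last by rewrite mem_sep_subfield // aM (separable_elementS sKL aK).
apply/fixedFieldP => // g /(fintype.subsetP sBA).
by have /(fixedFieldP aM) := aA; apply.
Qed.

(** The degree of the upper fixed field over K, computed once through the lower fixed field and once
    through L. *)
Lemma dim_sep_fixedS (A B : {group gal_of M}) :
  A \subset 'Gal(M / K)%g -> B \subset 'Gal(M / L)%g -> B \subset A ->
  (\dim_(sep_fixed K A) (sep_fixed L B) * #|'Gal(M / K) : A|%g =
   #|'Gal(M / L) : B|%g * \dim_K L)%N.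
Proof.
move=> sA sB sBA; rewrite -(dim_sep_fixed sKM nKM sA).
rewrite -(dim_sep_fixed sLM (normalFieldS sKL nKM) sB) mulnC [RHS]mulnC.
rewrite -dim_tower ?sub_sep_fixed ?sep_fixedS // -dim_tower //.
exact: sub_sep_fixed.
Qed.

End FixedDegrees.

(** * The defect and the degree formulas *)

Section Defect.
Variables (F : fieldType) (Om : splittingFieldType F).
Variables (K L : {subfield Om}) (v : valuation K) (w : valuation L).
Hypothesis wv : extends w v.

Lemma val_fs_gt0 : (0 < val_fs w v)%N.
Proof. by case: (val_f_decomp wv) => ->; rewrite muln_gt0 => /andP[]. Qed.

(** Cancels e = e_t e_w and f = f_s f_i. That f is non-zero uses finiteness of k_w/k_v, as
    [ext_degree] is 0 for infinite degrees. *)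
Lemma val_dwE (N : {subfield Om}) : 
  val_dw w v N * (val_et w v)%:R * (val_fs w v)%:R = val_n w v N.
Proof.
have [fE] := val_f_decomp wv; rewrite /val_dw /val_d /val_ew fE muln_gt0 natrM.
move=> /andP[fs0 fi0]; have e0 := val_e_gt0 wv; have et0 := val_et_gt0 wv.
have nz (m : nat) : (0 < m)%N -> m%:R != 0 :> rat by rewrite Num.Theory.pnatr_eq0 lt0n.
move: (val_n _ _ _) => n.
by field; rewrite !nz.
Qed.

End Defect.

Section Tower.
Variables (F : fieldType) (Om : splittingFieldType F).
Variables (K L M N : {subfield Om}).
Variables (v : valuation K) (w : valuation L) (x : valuation M).
Hypotheses (nKM : normalField K M) (xv : extends x v) (xw : extends x w) (wv : extends w v).
Hypotheses (sLN : (L <= N)%VS) (nKN : normalField K N).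
Let sKL : (K <= L)%VS := extends_sub wv.
Let sLM : (L <= M)%VS := extends_sub xw.

(** [num_ext_ratio] exchanges N for M, where the numbers of extensions are indices of decomposition
    groups. *)
Lemma val_n_index :
  val_n w v N * #|'Gal(M / K) : decomp_group x K|%g%:R =
  #|'Gal(M / L) : decomp_group x L|%g%:R * (\dim_K L)%:R.
Proof.
have nLM := normalFieldS sKL nKM.
rewrite /val_n (num_ext_ratio wv sLN nKN) -(num_ext_ratio wv sLM nKM).
rewrite -(num_ext_index nKM xv) -(num_ext_index nLM xw).
rewrite mulrAC divfK // Num.Theory.pnatr_eq0 -lt0n.
exact: num_ext_gt0 xv.
Qed.

Lemma val_et_index :
  (val_et w v * #|inertia_group x L : ramif_group x L|%g =
   #|inertia_group x K : ramif_group x K|%g)%N.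
Proof.
rewrite (ramif_index (normalFieldS sKL nKM) xw) (ramif_index nKM xv).
by rewrite (val_et_tower xv xw wv) mulnC.
Qed.

End Tower.

Section Top.
Variables (F : fieldType) (Om : splittingFieldType F).
Variables (K M : {subfield Om}) (v : valuation K) (x : valuation M).
Hypotheses (nKM : normalField K M) (xv : extends x v).

(** The case L = M of [val_fs_index]: over M itself the decomposition group is trivial. *)
Lemma inertia_index : #|decomp_group x K : inertia_group x K|%g = val_fs x v.
Proof.
rewrite -(val_fs_index nKM xv (extends_refl x) xv).
rewrite (_ : #|_ : _|%g = 1%N) ?muln1 //; apply/eqP; rewrite indexg_eq1.
apply/fintype.subsetP => g gD; apply/inertiaP; split=> // a ax.
have gM := fintype.subsetP (decomp_sub x M) g gD.
by rewrite (fixed_gal (subvv M) gM) // (vring_sub ax).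
Qed.

End Top.

Lemma gal_self (F : fieldType) (Om : splittingFieldType F) (M : {subfield Om}) :
  'Gal(M / M)%g = 1%g.
Proof.
apply/trivgP/fintype.subsetP => g gM; rewrite inE; apply/gal_eqP => a aM.
by rewrite gal_id (fixed_gal (subvv M) gM).
Qed.

Section FixedGroups.
Variables (F : fieldType) (Om : splittingFieldType F).
Variables (K M : {subfield Om}) (v : valuation K) (x : valuation M).
Hypotheses (nKM : normalField K M) (xv : extends x v).
Let sKM : (K <= M)%VS := extends_sub xv.

Lemma inertia_sub_gal : inertia_group x K \subset 'Gal(M / K)%g.
Proof. exact: fintype.subset_trans (inertia_sub x K) (decomp_sub x K). Qed.

Lemma ramif_sub : ramif_group x K \subset inertia_group x K.
Proof. by apply/fintype.subsetP => g /ramifP[]. Qed.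

Lemma ramif_sub_gal : ramif_group x K \subset 'Gal(M / K)%g.
Proof. exact: fintype.subset_trans ramif_sub inertia_sub_gal. Qed.

Lemma dim_sep_fixed_index (A B : {group gal_of M}) :
  A \subset 'Gal(M / K)%g -> B \subset A ->
  \dim_(sep_fixed K A) (sep_fixed K B) = #|A : B|%g.
Proof.
move=> sA sBA; have sB := fintype.subset_trans sBA sA.
apply/eqP; rewrite -(eqn_pmul2r (indexg_gt0 'Gal(M / K) A)).
rewrite (dim_sep_fixedS nKM (subvv K) sKM sA sB sBA) divnn adim_gt0 muln1.
by rewrite mulnC Lagrange_index.
Qed.

Lemma restrict_sep_fixed_extends (A B : {set gal_of M}) : B \subset A ->
  extends (restrict (sep_fixed_sub K B) x) (restrict (sep_fixed_sub K A) x).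
Proof.
move=> sBA; apply: (extends_restrict (u := x)); try exact: restrict_extends.
exact: (sep_fixedS (subvv K) sKM sBA).
Qed.

Section Group.
Variables (A : {group gal_of M}) (sA : A \subset 'Gal(M / K)%g).
Let sKA := sub_sep_fixed sKM sA.

Lemma decomp_sep_fixed : decomp_group x (sep_fixed K A) = decomp_group x K :&: A.
Proof. by rewrite (decomp_group_sub x sKA) gal_sep_fixed. Qed.

Lemma inertia_sep_fixed : inertia_group x (sep_fixed K A) = inertia_group x K :&: A.
Proof. by rewrite (inertia_group_sub x sKA) gal_sep_fixed. Qed.

Lemma ramif_sep_fixed : ramif_group x (sep_fixed K A) = ramif_group x K :&: A.
Proof. by rewrite (ramif_group_sub x sKA) gal_sep_fixed. Qed.

Lemma normal_sep_fixed : normalField (sep_fixed K A) M.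
Proof. exact: normalFieldS nKM. Qed.

End Group.

(** The index formula with base K_h and intermediate field K_i: over K_h the groups D and I are
    unchanged, over K_i both become I. *)
Lemma val_fs_inertia_field :
  val_fs (restrict (sep_fixed_sub K (inertia_group x K)) x)
         (restrict (sep_fixed_sub K (decomp_group x K)) x) =
  #|decomp_group x K : inertia_group x K|%g.
Proof.
have sD := decomp_sub x K; have sID := inertia_sub x K; have sI := inertia_sub_gal.
have := val_fs_index (normal_sep_fixed (A := decomp_Group x K) sD)
  (restrict_extends _ x) (restrict_extends _ x) (restrict_sep_fixed_extends sID).
rewrite (decomp_sep_fixed (A := decomp_Group x K) sD) (inertia_sep_fixed (A := decomp_Group x K) sD).
rewrite (decomp_sep_fixed (A := inertia_Group x K) sI) (inertia_sep_fixed (A := inertia_Group x K) sI).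
by rewrite /= !finset.setIid (finset.setIidPr sID) (finset.setIidPl sID) (indexgg (inertia_Group x K)) muln1.
Qed.

(** One step higher: over K_i the groups I and V are unchanged, over K_v both become V. *)
Lemma val_et_ramif_field :
  val_et (restrict (sep_fixed_sub K (ramif_group x K)) x)
         (restrict (sep_fixed_sub K (inertia_group x K)) x) =
  #|inertia_group x K : ramif_group x K|%g.
Proof.
have sVI := ramif_sub; have sI := inertia_sub_gal; have sV := ramif_sub_gal.
pose VG := Group (ramif_group_set xv).
have := val_et_index (normal_sep_fixed (A := inertia_Group x K) sI)
  (restrict_extends _ x) (restrict_extends _ x) (restrict_sep_fixed_extends sVI).
rewrite (inertia_sep_fixed (A := inertia_Group x K) sI) (ramif_sep_fixed (A := inertia_Group x K) sI).
rewrite (inertia_sep_fixed (A := VG) sV) (ramif_sep_fixed (A := VG) sV).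
by rewrite /= !finset.setIid (finset.setIidPr sVI) (finset.setIidPl sVI) (indexgg VG) muln1.
Qed.

Lemma val_n_top (N : {subfield Om}) : (M <= N)%VS -> normalField K N ->
  val_n x v N * #|'Gal(M / K) : decomp_group x K|%g%:R = (\dim_K M)%:R.
Proof.
move=> sMN nKN; rewrite (val_n_index nKM xv (extends_refl x) xv sMN nKN).
rewrite (_ : #|_ : _|%g = 1%N) ?mul1r //.
have := decomp_sub x M; rewrite gal_self => s1.
by apply/eqP; rewrite indexg_eq1 sub1G.
Qed.

(** Both sides are compared after multiplication by e_t f_s [G:D], which the index formulas identify
    with [G:V] = [K_v:K]. *)
Lemma dim_above_ramif_field (N : {subfield Om}) : (M <= N)%VS -> normalField K N ->
  (\dim_(ramif_field x K) M)%:R = val_dw x v N.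
Proof.
move=> sMN nKN; pose VG := Group (ramif_group_set xv).
have sV : VG \subset 'Gal(M / K)%g := ramif_sub_gal.
have nz (m : nat) : (0 < m)%N -> m%:R != 0 :> rat by rewrite Num.Theory.pnatr_eq0 lt0n.
have et0 := nz _ (val_et_gt0 xv); have fs0 := nz _ (val_fs_gt0 xv).
have g0 := nz _ (indexg_gt0 'Gal(M / K) (decomp_Group x K)).
apply: (mulIf et0); apply: (mulIf fs0); rewrite (val_dwE xv) /=; apply: (mulIf g0).
rewrite (val_n_top sMN nKN).
rewrite (dim_tower (sub_sep_fixed sKM sV) (sep_fixed_sub K _)).
rewrite (dim_sep_fixed sKM nKM sV).
rewrite -(Lagrange_index (decomp_sub x K : decomp_Group x K \subset _) (K := VG)); last first.
  exact: fintype.subset_trans ramif_sub (inertia_sub x K).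
rewrite -(Lagrange_index (inertia_sub x K : inertia_Group x K \subset decomp_Group x K) (K := VG)) ?ramif_sub //.
rewrite (ramif_index nKM xv) (inertia_index nKM xv) !natrM.
by ring.
Qed.

End FixedGroups.

Theorem proposition3p7 (F : fieldType) (Om : splittingFieldType F)
    (K M : {subfield Om}) (v : valuation K) (x : valuation M)
    (nKM : normalField K M) (xv : extends x v) :
  let Kh := decomp_field x K in
  let Ki := inertia_field x K in
  let Kv := ramif_field x K in
  let xh := restrict (sep_fixed_sub K (decomp_group x K)) x in
  let xi := restrict (sep_fixed_sub K (inertia_group x K)) x in
  let xr := restrict (sep_fixed_sub K (ramif_group x K)) x in
  [/\ \dim_K Kh = num_ext M v,
      \dim_Kh Ki = val_fs x v /\ val_fs x v = val_fs xi xh,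
      \dim_Ki Kv = val_et x v /\ val_et x v = val_et xr xi,
      (forall N : {subfield Om}, (M <= N)%VS -> normalField K N ->
         (\dim_Kv M)%:R = val_dw x v N) &
      (forall N : {subfield Om}, (M <= N)%VS -> normalField Kv N ->
         (\dim_Kv M)%:R = val_dw x xr N)]
  /\
  forall (L : {subfield Om}) (sKL : (K <= L)%VS) (sLM : (L <= M)%VS),
  let w := restrict sLM x in
  let Lh := decomp_field x L in
  let Li := inertia_field x L in
  let Lv := ramif_field x L in
  forall N : {subfield Om}, (L <= N)%VS -> normalField K N ->
  [/\ (\dim_Kh Lh)%:R = val_dw w v N * (val_et w v)%:R * (val_fs w v)%:R,
      (\dim_Ki Li)%:R = val_dw w v N * (val_et w v)%:R &
      (\dim_Kv Lv)%:R = val_dw w v N].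
Proof.
move=> Kh Ki Kv xh xi xr; have sKM := extends_sub xv.
have [[sD sI] sV] := (decomp_sub x K, inertia_sub_gal K x, ramif_sub_gal K x).
have [sID sVI] := (inertia_sub x K, ramif_sub K x).
pose DG := decomp_Group x K; pose IG := inertia_Group x K; pose VG := Group (ramif_group_set xv).
split.
  split.
  - by rewrite (num_ext_index nKM xv); apply: (dim_sep_fixed sKM nKM (H := DG)).
  - rewrite /xi /xh (val_fs_inertia_field nKM xv) -(inertia_index nKM xv).
    by split=> //; apply: (dim_sep_fixed_index nKM xv (A := DG) (B := IG)).
  - rewrite /xi /xr (val_et_ramif_field nKM xv) -(ramif_index nKM xv).
    by split=> //; apply: (dim_sep_fixed_index nKM xv (A := IG) (B := VG)).
  - exact: (dim_above_ramif_field nKM xv).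
  (* Over K_v the Galois group and its three subgroups all equal V, so e_t = f_s = 1 and d_w = n =
     [M:K_v]. *)
  - move=> N sMN nN; have nVM := normal_sep_fixed nKM xv (A := VG) sV.
    have xxr : extends x xr := restrict_extends _ x.
    have dV := decomp_sep_fixed xv (A := VG) sV; have iV := inertia_sep_fixed xv (A := VG) sV.
    have rV := ramif_sep_fixed xv (A := VG) sV; rewrite /= in nVM dV iV rV.
    rewrite -(val_n_top nVM xxr sMN nN) -(val_dwE xxr).
    rewrite -(ramif_index nVM xxr) -(inertia_index nVM xxr).
    rewrite dV iV rV (gal_sep_fixed (H := VG) sV) (finset.setIidPr sVI).
    by rewrite (finset.setIidPr (fintype.subset_trans sVI sID)) finset.setIid (indexgg VG) !mulr1.
move=> L sKL sLM w Lh Li Lv N sLN nKN.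
have xw : extends x w := restrict_extends sLM x.
have wv : extends w v := extends_restrict xv xw sKL.
have nz (m : nat) : (0 < m)%N -> m%:R != 0 :> rat by rewrite Num.Theory.pnatr_eq0 lt0n.
pose GD := #|'Gal(M / K) : decomp_group x K|%g; pose GI := #|'Gal(M / K) : inertia_group x K|%g.
pose DI := #|decomp_group x K : inertia_group x K|%g.
pose IV := #|inertia_group x K : ramif_group x K|%g.
pose GDL := #|'Gal(M / L) : decomp_group x L|%g; pose GIL := #|'Gal(M / L) : inertia_group x L|%g.
pose DIL := #|decomp_group x L : inertia_group x L|%g.
pose IVL := #|inertia_group x L : ramif_group x L|%g.
have nE : val_dw w v N * (val_et w v)%:R * (val_fs w v)%:R * GD%:R = GDL%:R * (\dim_K L)%:R.
  by rewrite (val_dwE wv); apply: val_n_index nKM xv xw wv sLN nKN.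
have fsE : (val_fs w v * DIL = DI)%N := val_fs_index nKM xv xw wv.
have etE : (val_et w v * IVL = IV)%N := val_et_index nKM xv xw wv.
have [[sDL sIL] sVL] := (decomp_sub x L, inertia_sub_gal L x, ramif_sub_gal L x).
pose DL := decomp_Group x L; pose IL := inertia_Group x L; pose VL := Group (ramif_group_set xw).
have sDD : DL \subset DG by rewrite /= (decomp_group_sub x sKL) subsetIl.
have sII : IL \subset IG by rewrite /= (inertia_group_sub x sKL) subsetIl.
have sVV : VL \subset VG by rewrite /= (ramif_group_sub x sKL) subsetIl.
(* For H the decomposition, inertia and ramification group in turn, the relative degree times [G:H]
   equals the corresponding index over L times [L:K]. *)
have hE : (\dim_Kh Lh * GD = GDL * \dim_K L)%N.
  exact: (dim_sep_fixedS nKM sKL sLM (A := DG) (B := DL) sD sDL sDD).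
have iE : (\dim_Ki Li * GI = GIL * \dim_K L)%N.
  exact: (dim_sep_fixedS nKM sKL sLM (A := IG) (B := IL) sI sIL sII).
have rE : (\dim_Kv Lv * (GI * IV) = GIL * IVL * \dim_K L)%N.
  rewrite (Lagrange_index (sI : IG \subset 'Gal(M / K)%g) (sVI : VG \subset IG)).
  rewrite (Lagrange_index (sIL : IL \subset 'Gal(M / L)%g) (ramif_sub L x : VL \subset IL)).
  exact: (dim_sep_fixedS nKM sKL sLM (A := VG) (B := VL) sV sVL sVV).
have GIE : (GD * DI = GI)%N := Lagrange_index (sD : DG \subset _) (sID : IG \subset DG).
have GILE : (GDL * DIL = GIL)%N := Lagrange_index (sDL : DL \subset _) (inertia_sub x L : IL \subset DL).
have GD0 : GD%:R != 0 :> rat := nz _ (indexg_gt0 'Gal(M / K) DG).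
have DI0 : DI%:R != 0 :> rat := nz _ (indexg_gt0 DG IG).
have IV0 : IV%:R != 0 :> rat := nz _ (indexg_gt0 IG VG).
have GI0 : GI%:R != 0 :> rat by rewrite -GIE natrM mulf_neq0.
have hE' : (\dim_Kh Lh)%:R = val_dw w v N * (val_et w v)%:R * (val_fs w v)%:R.
  by apply: (mulIf GD0); rewrite nE -!natrM hE.
(* Passing from h to i removes the factor f_s, the ratio of the indices [D:I] over K and over L;
   passing from i to v removes e_t in the same way. *)
have iE' : (\dim_Ki Li)%:R = val_dw w v N * (val_et w v)%:R.
  apply: (mulIf GI0); rewrite -[LHS]natrM iE -GILE -GIE -fsE !natrM mulrAC -nE.
  by ring.
split=> //; apply: (mulIf (mulf_neq0 GI0 IV0)).
rewrite -!natrM rE mulnAC -iE -etE !natrM iE'.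
by ring.
Qed.
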